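(* Let $\{F_n\}_{n\ge 0}$ be the Fibonacci sequence, defined by $F_0=0$, $F_1=1$ and $F_{n+2}=F_{n+1}+F_n$ for all $n\ge 0$. The only integers $c$ having at least two representations of the form $c=F_n-3^m$ with integers $n\ge 2$ and $m\ge 0$ are $c\in\{-26,-6,-1,0,2,4,7,12\}$. Furthermore, all the representations of these integers as $F_n-3^m$ with integers $n\ge 2$ and $m\ge 0$ are exactly: $-26=F_{10}-3^4=F_2-3^3$; $-6=F_8-3^3=F_4-3^2$; $-1=F_6-3^2=F_3-3^1$; $0=F_4-3^1=F_2-3^0$; $2=F_5-3^1=F_4-3^0$; $4=F_7-3^2=F_5-3^0$; $7=F_9-3^3=F_6-3^0$; $12=F_8-3^2=F_7-3^0$.
   Context: A representation of $c$ is a pair $(n,m)$ of integers with $n\ge 2$, $m\ge 0$ and $F_n-3^m=c$; two representations are distinct if the pairs $(n,m)$ differ. (The restriction $n\ge 2$ avoids counting $F_1=F_2=1$ as giving different representations.) *)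

(* Defs.v *)
From Stdlib Require Import ZArith Lia.
Open Scope Z_scope.

Fixpoint fib (n : nat) : Z :=
  match n with
  | O => 0
  | S O => 1
  | S ((S k) as k1) => fib k1 + fib k
  end.

Definition is_rep (c : Z) (n m : nat) : Prop :=
  (2 <= n)%nat /\ fib n - 3 ^ Z.of_nat m = c.

(* Main.v *)
(* Two representations give [F_n - F_n1 = 3^m - 3^m1] with [n = n1 + a] and [m = m1 + b].
   Depending on which of [a], [b] are large, one of four linear forms in [ln al] ([al] the
   golden ratio), [ln 3] and the logarithm of an algebraic number built from [sqrt 5],
   [al^a - 1] and [3^b - 1] is exponentially small.

   A lower bound for such forms is proved by Baker's method. Siegel's lemma gives an
   auxiliary exponential sum vanishing to high order at the odd integers below [2 L];
   Newton interpolation makes its derivatives small at the half-odd points, and a Liouville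
   estimate in the field generated by the square roots of [al], [3] and the third number
   turns small into zero. As these square roots are independent, the sum splits by the
   parities of the exponents (Kummer descent), and iterated halving leaves a single nonzero
   term that vanishes. This yields [n < 2^320].

   If [4] divides [a] then [F_n - F_n1 = F_d L_(n1+d)] with [d = a/2], and the power of [3]
   dividing a Lucas number is bounded logarithmically; the cases [a = 4] and [a = 8], where
   the logarithms become dependent, reduce to [L_e = 3^u (3^b - 1)], which is
   solved by congruences.

   Two Baker-Davenport reductions bring the bound from [2^320] to [528] and then to [58].
   Their logarithms are computed from [lam a = - ln (1 - 1/al^a)]: one has
   [2 ln al = lam 1], [ln (sqrt 5) = lam 1 - lam 4] and [ln 3 = lam 1 + lam 4 - lam 8], and
   Fibonacci numbers serve as fixed-point values of [1/al^j]. *)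

Require Import Defs.
From Stdlib Require Import Reals Lra Lia Psatz ZArith Znumtheory Zpow_facts Arith Bool List
  Permutation FinFun Classical ClassicalEpsilon.
Import ListNotations.

Open Scope R_scope.

(** Why half-odd points: for odd [k] the product [k1 * k] has the parity of [k1], so the square
    roots that occur at [k / 2] depend only on the parities of the exponents, and one parity class
    can be rewritten as a sum at odd integers again. Each such descent spends part of the order of
    vanishing and removes one binary digit from the exponents.

    The argument stays over the reals: a confluent Newton formula for Taylor polynomials takes the
    place of complex function theory, and algebraic numbers are real numbers with a bound for all
    conjugates.

    The lower bound is exp(-C h) with [C] of order (log n)^7 and [h] a height. The heights met are
    1, then about [a] or [b], then the larger of both, so [n] is at most of order C^3, which is
    absurd for large [n].

    Independence of the square roots is read off from norms. The norm of [sqrt 5 * (al^a - 1)] is -5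
    times an integer that 5 divides exactly when 4 divides [a], hence the separate case. There
    [al^a - 1 = sqrt 5 * al^d * F_d] with [d = a / 2], and [F_d] is a power of 3 exactly for [a = 4]
    and [a = 8]. *)

Definition rsum {A : Type} (l : list A) (f : A -> R) : R :=
  fold_right (fun x s => f x + s) 0 l.

Lemma rsum_cons {A} (x : A) l f : rsum (x :: l) f = f x + rsum l f.
Proof. reflexivity. Qed.

Lemma rsum_ext {A} (l : list A) f g :
  (forall x, In x l -> f x = g x) -> rsum l f = rsum l g.
Proof.
induction l as [|x l IH]; intros H; simpl; [reflexivity|].
rewrite H by (left; reflexivity). rewrite IH; [reflexivity|].
intros y Hy; apply H; right; exact Hy.
Qed.

Lemma rsum_plus {A} (l : list A) f g :
  rsum l (fun x => f x + g x) = rsum l f + rsum l g.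
Proof. induction l as [|x l IH]; simpl; [lra|]; rewrite IH; lra. Qed.

Lemma rsum_scal {A} (l : list A) c f : rsum l (fun x => c * f x) = c * rsum l f.
Proof. induction l as [|x l IH]; simpl; [lra|]; rewrite IH; lra. Qed.

Lemma rsum_minus {A} (l : list A) f g :
  rsum l (fun x => f x - g x) = rsum l f - rsum l g.
Proof. induction l as [|x l IH]; simpl; [lra|]; rewrite IH; lra. Qed.

Lemma rsum_zero {A} (l : list A) : rsum l (fun _ => 0) = 0.
Proof. induction l as [|x l IH]; simpl; [lra|]; rewrite IH; lra. Qed.

Lemma rsum_app {A} (l l' : list A) f : rsum (l ++ l') f = rsum l f + rsum l' f.
Proof. induction l as [|x l IH]; simpl; [lra|]; rewrite IH; lra. Qed.

Lemma rsum_map {A B} (g : A -> B) (l : list A) f :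
  rsum (map g l) f = rsum l (fun x => f (g x)).
Proof. induction l as [|x l IH]; simpl; [lra|]; rewrite IH; lra. Qed.

Lemma rsum_abs {A} (l : list A) f : Rabs (rsum l f) <= rsum l (fun x => Rabs (f x)).
Proof.
induction l as [|x l IH]; simpl; [rewrite Rabs_R0; lra|].
eapply Rle_trans; [apply Rabs_triang|]; lra.
Qed.

Lemma rsum_le {A} (l : list A) f g :
  (forall x, In x l -> f x <= g x) -> rsum l f <= rsum l g.
Proof.
induction l as [|x l IH]; intros H; simpl; [lra|].
apply Rplus_le_compat; [apply H; left; reflexivity|].
apply IH; intros y Hy; apply H; right; exact Hy.
Qed.

Lemma rsum_const {A} (l : list A) c : rsum l (fun _ => c) = INR (length l) * c.
Proof.
induction l as [|x l IH]; [simpl; lra|].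
change (length (x :: l)) with (S (length l)); rewrite S_INR, rsum_cons, IH; lra.
Qed.

Lemma rsum_nonneg {A} (l : list A) f : (forall x, In x l -> 0 <= f x) -> 0 <= rsum l f.
Proof.
intros H; rewrite <- (rsum_zero l); apply rsum_le; exact H.
Qed.

Lemma rsum_swap {A B} (l : list A) (l' : list B) f :
  rsum l (fun x => rsum l' (f x)) = rsum l' (fun y => rsum l (fun x => f x y)).
Proof.
induction l as [|x l IH]; simpl.
- now rewrite rsum_zero.
- rewrite IH, <- rsum_plus; reflexivity.
Qed.

Lemma rsum_seq_S (K : nat) f : rsum (seq 0 (S K)) f = rsum (seq 0 K) f + f K.
Proof. rewrite seq_S, rsum_app; simpl; lra. Qed.

Lemma rsum_seq_sum_f_R0 (K : nat) f : rsum (seq 0 (S K)) f = sum_f_R0 f K.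
Proof.
induction K as [|K IH]; [simpl; lra|].
rewrite rsum_seq_S, IH; reflexivity.
Qed.

Lemma rsum_seq_shift (K : nat) f :
  rsum (seq 0 (S K)) f = f 0%nat + rsum (seq 0 K) (fun k => f (S k)).
Proof. simpl; rewrite <- seq_shift, rsum_map; reflexivity. Qed.

Lemma rsum_seq_trunc (K D : nat) f : (D <= K)%nat ->
  (forall k, (D <= k)%nat -> f k = 0) -> rsum (seq 0 K) f = rsum (seq 0 D) f.
Proof.
intros HD H; replace K with (D + (K - D))%nat by lia.
rewrite seq_app, rsum_app, (rsum_ext (seq (0 + D) (K - D)) f (fun _ => 0)).
- rewrite rsum_zero; lra.
- intros k Hk; apply in_seq in Hk; apply H; lia.
Qed.

(** Interpolation is applied to Taylor polynomials, where it is pure algebra of coefficients; the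
    truncation order goes to infinity only in [extrapolation]. *)
Definition texp (K : nat) (t : R) : R :=
  rsum (seq 0 K) (fun k => t ^ k / INR (fact k)).

Lemma texp_cv t eta : 0 < eta ->
  exists K0, forall K, (K0 <= K)%nat -> Rabs (exp t - texp K t) < eta.
Proof.
intros Heta.
assert (H : exp_in t (exp t)) by (unfold exp; destruct (exist_exp t); exact e).
destruct (H eta Heta) as [N HN].
exists (S N); intros [|K] HK; [lia|].
unfold texp; rewrite rsum_seq_sum_f_R0, Rabs_minus_sym.
rewrite (sum_eq _ (fun i => / INR (fact i) * t ^ i)).
- apply HN; lia.
- intros i _; unfold Rdiv; ring.
Qed.

Lemma texp_cv_list {A} (l : list A) (t : A -> R) eta : 0 < eta ->
  exists K0, forall K x, (K0 <= K)%nat -> In x l -> Rabs (exp (t x) - texp K (t x)) < eta.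
Proof.
intros Heta; induction l as [|x l [K1 IH]].
- exists 0%nat; intros K x _ [].
- destruct (texp_cv (t x) eta Heta) as [K2 H2].
  exists (max K1 K2); intros K y HK [<-|Hy]; [apply H2; lia|apply IH; [lia|exact Hy]].
Qed.

Lemma texp_le_exp K t : 0 <= t -> texp K t <= exp t.
Proof.
intros Ht; apply Rnot_lt_le; intros Hlt.
destruct (texp_cv t (texp K t - exp t)) as [K0 H0]; [lra|].
assert (Hmono : forall D, texp K t <= texp (K + D) t).
{ induction D as [|D IH]; [rewrite Nat.add_0_r; lra|].
  rewrite Nat.add_succ_r; unfold texp in *; rewrite rsum_seq_S.
  assert (0 <= t ^ (K + D) / INR (fact (K + D))).
  { apply Rmult_le_pos; [apply pow_le; exact Ht|].
    left; apply Rinv_0_lt_compat, INR_fact_lt_0. }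
  lra. }
specialize (H0 (K + K0)%nat ltac:(lia)); specialize (Hmono K0).
apply Rabs_def2 in H0; lra.
Qed.

(** * Divided differences *)

(** The complete homogeneous symmetric polynomial of degree [k] in the entries of [l], by its
    recursion on the first variable. *)
Fixpoint hs (l : list R) : nat -> R :=
  match l with
  | nil => fun k => match k with O => 1 | S _ => 0 end
  | x :: l' =>
      fix g (k : nat) : R := match k with O => 1 | S k' => x * g k' + hs l' (S k') end
  end.

Lemma hs_0 l : hs l 0 = 1.
Proof. destruct l; reflexivity. Qed.

Lemma hs_S x l k : hs (x :: l) (S k) = x * hs (x :: l) k + hs l (S k).
Proof. reflexivity. Qed.

(** Generalizes the division of a^(k+1) - b^(k+1) by a - b. Both the symmetry of [hs] and the
    recursion of divided differences rest on it. *)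
Lemma hs_sub a b l k : (a - b) * hs (a :: b :: l) k = hs (a :: l) (S k) - hs (b :: l) (S k).
Proof.
induction k as [|k IH].
- rewrite !hs_S, !hs_0; ring.
- rewrite (hs_S a (b :: l)), (hs_S a l (S k)), (hs_S b l (S k)).
  transitivity (a * ((a - b) * hs (a :: b :: l) k) + (a - b) * hs (b :: l) (S k)); [ring|].
  rewrite IH, (hs_S a l k), (hs_S b l k); ring.
Qed.

Lemma hs_swap a b l k : hs (a :: b :: l) k = hs (b :: a :: l) k.
Proof.
destruct (Req_dec a b) as [->|Hab]; [reflexivity|].
apply (Rmult_eq_reg_l (a - b)); [|lra].
rewrite hs_sub; generalize (hs_sub b a l k); lra.
Qed.

Lemma hs_perm l l' : Permutation l l' -> forall k, hs l k = hs l' k.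
Proof.
induction 1 as [|x l l' _ IH|x y l|l1 l2 l3 _ IH1 _ IH2]; intros k.
- reflexivity.
- induction k as [|k IHk]; [reflexivity|]; rewrite !hs_S, IHk, IH; reflexivity.
- apply hs_swap.
- now rewrite IH1.
Qed.

(** When all [j + 1] variables are equal, the binomial(k+j, j) monomials of degree [k] coincide.
    This turns a divided difference at a repeated node into a derivative. *)
Lemma hs_repeat x j k :
  hs (repeat x (S j)) k * (INR (fact j) * INR (fact k)) = INR (fact (k + j)) * x ^ k.
Proof.
revert k; induction j as [|j IHj]; intros k.
- rewrite Nat.add_0_r; simpl repeat; induction k as [|k IHk]; [simpl; ring|].
  rewrite hs_S. change (fact (S k)) with (S k * fact k)%nat.
  rewrite mult_INR. simpl (hs [] _). simpl (INR (fact 0)) in *.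
  transitivity (x * INR (S k) * (hs [x] k * (1 * INR (fact k)))); [ring|].
  rewrite IHk; simpl pow; ring.
- induction k as [|k IHk].
  + rewrite hs_0; simpl (0 + S j)%nat; simpl (fact 0); simpl; ring.
  + change (repeat x (S (S j))) with (x :: repeat x (S j)) in *.
    rewrite hs_S, Rmult_plus_distr_r.
    change (fact (S k)) with (S k * fact k)%nat at 1.
    rewrite (mult_INR (S k)).
    replace (x * hs (x :: repeat x (S j)) k * (INR (fact (S j)) * (INR (S k) * INR (fact k))))
      with (x * INR (S k) * (hs (x :: repeat x (S j)) k * (INR (fact (S j)) * INR (fact k)))) by ring.
    rewrite IHk.
    change (fact (S j)) with (S j * fact j)%nat.
    rewrite (mult_INR (S j)).
    replace (hs (repeat x (S j)) (S k) * (INR (S j) * INR (fact j) * INR (fact (S k))))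
      with (INR (S j) * (hs (repeat x (S j)) (S k) * (INR (fact j) * INR (fact (S k))))) by ring.
    rewrite IHj.
    replace (S k + S j)%nat with (S (k + S j)) by lia.
    replace (S k + j)%nat with (k + S j)%nat by lia.
    change (fact (S (k + S j))) with (S (k + S j) * fact (k + S j))%nat.
    rewrite mult_INR, !S_INR, plus_INR, S_INR; simpl pow; ring.
Qed.

Lemma hs_le Z l k : (forall x, In x l -> Rabs x <= Z) ->
  Rabs (hs l k) <= hs (repeat Z (length l)) k.
Proof.
revert k; induction l as [|x l IH]; intros k H.
- simpl; destruct k; [rewrite Rabs_R1|rewrite Rabs_R0]; lra.
- induction k as [|k IHk]; [simpl; rewrite Rabs_R1; lra|].
  simpl length; change (repeat Z (S (length l))) with (Z :: repeat Z (length l)) in *.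
  rewrite !hs_S; eapply Rle_trans; [apply Rabs_triang|].
  apply Rplus_le_compat.
  + rewrite Rabs_mult; apply Rmult_le_compat; try apply Rabs_pos.
    * apply H; left; reflexivity.
    * exact IHk.
  + apply IH; intros y Hy; apply H; right; exact Hy.
Qed.

(* For a polynomial with coefficients [a], this is its divided difference at the
   nodes [l] (in the confluent sense when nodes are repeated). *)
Definition ddiff (a : nat -> R) (K : nat) (l : list R) : R :=
  rsum (seq 0 K) (fun k => a (k + pred (length l))%nat * hs l k).

Lemma ddiff_perm a K l l' : Permutation l l' -> ddiff a K l = ddiff a K l'.
Proof.
intros H; unfold ddiff; rewrite (Permutation_length H).
apply rsum_ext; intros k _; rewrite (hs_perm _ _ H); reflexivity.
Qed.

(** The coefficient index shifts by one between the two sides; since [a] vanishes from [K] on, the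
    top term lost in the shift is zero. *)
Lemma ddiff_sub a K x y l : (forall k, (K <= k)%nat -> a k = 0) ->
  (x - y) * ddiff a K (x :: y :: l) = ddiff a K (x :: l) - ddiff a K (y :: l).
Proof.
intros Ha; unfold ddiff; simpl length; simpl pred.
rewrite <- rsum_scal, <- rsum_minus.
set (g := fun k => a (k + length l)%nat * (hs (x :: l) k - hs (y :: l) k)).
transitivity (rsum (seq 0 (S K)) g).
- rewrite rsum_seq_shift; unfold g at 1; rewrite !hs_0.
  rewrite Rminus_diag, Rmult_0_r, Rplus_0_l.
  apply rsum_ext; intros k _; unfold g; rewrite <- hs_sub.
  rewrite Nat.add_succ_r; simpl plus; ring.
- rewrite rsum_seq_S; unfold g at 2; rewrite Ha by lia.
  rewrite Rmult_0_l, Rplus_0_r; apply rsum_ext; intros k _; unfold g; ring.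
Qed.

(** The dichotomy behind [ddiff_small]: equal nodes are covered by the data, two different nodes
    permit the recursion. *)
Lemma all_same_or_differ (x : nat) l :
  (l = repeat x (length l)) \/ (exists y l', y <> x /\ Permutation l (y :: l')).
Proof.
induction l as [|z l IH]; [left; reflexivity|].
destruct (Nat.eq_dec z x) as [->|Hz].
- destruct IH as [IH|(y & l' & Hy & HP)].
  + left; simpl; f_equal; exact IH.
  + right; exists y, (x :: l'); split; [exact Hy|].
    eapply perm_trans; [apply perm_skip, HP|apply perm_swap].
- right; exists z, l; split; [exact Hz|reflexivity].
Qed.

Section Newton.

Variables (a : nat -> R) (K : nat) (nu : nat -> R) (L J : nat) (eps Z z : R).
Hypothesis a0 : forall k, (K <= k)%nat -> a k = 0.
Hypothesis nu_gap : forall i j, i <> j -> 1 <= Rabs (nu i - nu j).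
Hypothesis nu_Z : forall i, (i < L)%nat -> Rabs (z - nu i) <= Z.
Hypothesis Z1 : 1 <= Z.
Hypothesis eps0 : 0 <= eps.
Hypothesis data : forall i j, (i < L)%nat -> (j < J)%nat ->
  Rabs (ddiff a K (repeat (nu i) (S j))) <= eps.

(** Multiplicity at most [J] matches the derivatives of order below [J] that are controlled at each
    node. *)
Definition admissible (l : list nat) : Prop :=
  forall i, (count_occ Nat.eq_dec l i <= J)%nat /\ (In i l -> (i < L)%nat).

Lemma admissible_perm l l' : Permutation l l' -> admissible l -> admissible l'.
Proof.
intros HP H i; destruct (H i) as [H1 H2]; split.
- rewrite <- (proj1 (Permutation_count_occ Nat.eq_dec l l') HP); exact H1.
- intros Hi; apply H2; apply Permutation_in with l'; [symmetry; exact HP|exact Hi].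
Qed.

Lemma admissible_tail x l : admissible (x :: l) -> admissible l.
Proof.
intros H i; destruct (H i) as [H1 H2]; split; [|intros Hi; apply H2; right; exact Hi].
simpl in H1; destruct (Nat.eq_dec x i); lia.
Qed.

Lemma map_repeat {A B} (f : A -> B) x n : map f (repeat x n) = repeat (f x) n.
Proof. induction n as [|n IH]; simpl; [reflexivity|now rewrite IH]. Qed.

(** Different nodes are at distance at least 1, so the recursion divides by at least 1, and each
    further node at most doubles the bound. *)
Lemma ddiff_small n l : length l = S n -> admissible l ->
  Rabs (ddiff a K (map nu l)) <= 2 ^ n * eps.
Proof.
revert l; induction n as [|n IH]; intros l Hlen Hadm.
- destruct l as [|x [|y l]]; try discriminate Hlen.
  rewrite pow_O, Rmult_1_l; apply (data x 0).
  + apply (Hadm x); left; reflexivity.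
  + destruct (Hadm x) as [H _]; simpl in H; destruct (Nat.eq_dec x x); lia.
- destruct l as [|x l]; [discriminate Hlen|].
  injection Hlen as Hlen.
  destruct (all_same_or_differ x l) as [He|(y & l' & Hy & HP)].
  + rewrite He, Hlen. change (map nu (x :: repeat x (S n))) with (nu x :: map nu (repeat x (S n))).
    rewrite map_repeat; change (nu x :: repeat (nu x) (S n)) with (repeat (nu x) (S (S n))).
    assert (H2 : 1 <= 2 ^ S n) by (apply pow_R1_Rle; lra).
    eapply Rle_trans; [apply data|].
    * apply (Hadm x); left; reflexivity.
    * destruct (Hadm x) as [H _]; rewrite He, Hlen in H.
      change (x :: repeat x (S n)) with (repeat x (S (S n))) in H.
      rewrite (count_occ_repeat_eq Nat.eq_dec) in H by reflexivity; lia.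
    * rewrite <- (Rmult_1_l eps) at 1; apply Rmult_le_compat_r; assumption.
  + assert (HP' : Permutation (x :: l) (x :: y :: l')) by (apply perm_skip; exact HP).
    rewrite (ddiff_perm a K _ _ (Permutation_map nu HP')); simpl map.
    assert (Hadm' := admissible_perm _ _ HP' Hadm).
    assert (Hlen' : length l' = n).
    { apply Permutation_length in HP; simpl in HP; lia. }
    assert (H1 : Rabs (ddiff a K (map nu (x :: l'))) <= 2 ^ n * eps).
    { apply IH; [simpl; lia|]; apply admissible_tail with y.
      apply admissible_perm with (x :: y :: l'); [apply perm_swap|exact Hadm']. }
    assert (H2 : Rabs (ddiff a K (map nu (y :: l'))) <= 2 ^ n * eps).
    { apply IH; [simpl; lia|]; apply admissible_tail with x; exact Hadm'. }
    assert (Hs := ddiff_sub a K (nu x) (nu y) (map nu l') a0).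
    assert (Hg := nu_gap x y ltac:(lia)).
    simpl map in H1, H2.
    apply (f_equal Rabs) in Hs; rewrite Rabs_mult in Hs.
    assert (Ht : Rabs (ddiff a K (nu x :: map nu l') - ddiff a K (nu y :: map nu l'))
      <= 2 ^ n * eps + 2 ^ n * eps).
    { unfold Rminus; eapply Rle_trans; [apply Rabs_triang|]; rewrite Rabs_Ropp; lra. }
    rewrite <- Hs in Ht.
    assert (Hp := Rabs_pos (ddiff a K (nu x :: nu y :: map nu l'))).
    simpl pow; nra.
Qed.

(** Newton's formula, one node at a time: f[z,l] = f[x,l] + (z - x) f[z,x,l]. The last divided
    difference is the remainder. *)
Lemma newton l : admissible l ->
  Rabs (ddiff a K [z]) <=
  INR (length l) * (2 * Z) ^ length l * eps + Z ^ length l * Rabs (ddiff a K (z :: map nu l)).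
Proof.
induction l as [|x l IH]; intros Hadm; [simpl; lra|].
specialize (IH (admissible_tail _ _ Hadm)).
assert (Hs := ddiff_sub a K z (nu x) (map nu l) a0).
assert (H1 := ddiff_small (length l) (x :: l) eq_refl Hadm); simpl map in H1.
assert (Hz : Rabs (z - nu x) <= Z) by (apply nu_Z, (Hadm x); left; reflexivity).
set (D := Rabs (ddiff a K (z :: map nu (x :: l)))).
assert (H2 : Rabs (ddiff a K (z :: map nu l)) <= 2 ^ length l * eps + Z * D).
{ replace (ddiff a K (z :: map nu l)) with
    (ddiff a K (nu x :: map nu l) + (z - nu x) * ddiff a K (z :: nu x :: map nu l)) by lra.
  eapply Rle_trans; [apply Rabs_triang|]; apply Rplus_le_compat; [exact H1|].
  rewrite Rabs_mult; apply Rmult_le_compat_r; [apply Rabs_pos|exact Hz]. }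
simpl length; rewrite S_INR.
eapply Rle_trans; [exact IH|].
set (m := length l) in *.
assert (HZm : 0 <= Z ^ m) by (apply pow_le; lra).
assert (HZ1 : 1 <= Z ^ m) by (apply pow_R1_Rle; lra).
assert (H2m : 1 <= 2 ^ m) by (apply pow_R1_Rle; lra).
apply (Rmult_le_compat_l (Z ^ m)) in H2; [|exact HZm].
assert (HI : 0 <= INR m) by apply pos_INR.
simpl pow; rewrite !Rpow_mult_distr.
set (P := 2 ^ m * Z ^ m * eps).
assert (HP : 0 <= P) by (unfold P; repeat apply Rmult_le_pos; lra).
replace ((INR m + 1) * (2 * Z * (2 ^ m * Z ^ m)) * eps) with ((INR m + 1) * (2 * Z) * P) by (unfold P; ring).
replace (INR m * (2 ^ m * Z ^ m) * eps) with (INR m * P) by (unfold P; ring).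
replace (Z ^ m * (2 ^ m * eps + Z * D)) with (P + Z * Z ^ m * D) in H2 by (unfold P; ring).
assert ((INR m + 1) * P <= (INR m + 1) * (2 * Z) * P).
{ apply Rmult_le_compat_r; [exact HP|]; nra. }
nra.
Qed.

End Newton.

Lemma nodes_admissible L J : admissible L J (concat (repeat (seq 0 L) J)).
Proof.
intros i; induction J as [|J [IH1 IH2]]; [simpl; split; [lia|tauto]|].
simpl repeat; simpl concat; split.
- rewrite count_occ_app.
  assert (count_occ Nat.eq_dec (seq 0 L) i <= 1)%nat; [|lia].
  apply NoDup_count_occ, seq_NoDup.
- intros H; apply in_app_or in H; destruct H as [H|H]; [apply in_seq in H; lia|auto].
Qed.

Lemma nodes_length L J : length (concat (repeat (seq 0 L) J)) = (J * L)%nat.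
Proof.
induction J as [|J IH]; [reflexivity|].
simpl repeat; simpl concat; rewrite length_app, length_seq, IH; lia.
Qed.

(** * Extrapolation of exponential sums *)

Section Extrapolation.

Context {A : Type}.
Variables (P : list A) (c om : A -> R) (Om : R).
Hypothesis om_le : forall x, In x P -> Rabs (om x) <= Om.
Hypothesis Om0 : 0 <= Om.

Definition tcoef (K k : nat) : R :=
  if (k <? K)%nat then rsum P (fun x => c x * om x ^ k / INR (fact k)) else 0.

Lemma tcoef_0 K k : (K <= k)%nat -> tcoef K k = 0.
Proof. intros H; unfold tcoef; destruct (Nat.ltb_spec k K); [lia|reflexivity]. Qed.

(** At [j + 1] equal nodes the divided difference is the [j]-th derivative over j!, and
    differentiating the Taylor polynomial loses [j] terms, hence [K - j]. *)
Lemma ddiff_tcoef_repeat K x j : (j <= K)%nat ->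
  ddiff (tcoef K) K (repeat x (S j)) =
  / INR (fact j) * rsum P (fun y => c y * om y ^ j * texp (K - j) (om y * x)).
Proof.
intros HjK; unfold ddiff; rewrite repeat_length; simpl pred.
rewrite (rsum_seq_trunc K (K - j)); [|lia|].
2:{ intros k Hk; rewrite tcoef_0 by lia; ring. }
transitivity (rsum (seq 0 (K - j)) (fun k => rsum P (fun y =>
  / INR (fact j) * (c y * om y ^ j * ((om y * x) ^ k / INR (fact k)))))).
- apply rsum_ext; intros k Hk; apply in_seq in Hk.
  unfold tcoef; destruct (Nat.ltb_spec (k + j) K); [|lia].
  rewrite Rmult_comm, <- rsum_scal; apply rsum_ext; intros y _.
  assert (Hr := hs_repeat x j k).
  assert (H1 := INR_fact_neq_0 j); assert (H2 := INR_fact_neq_0 k).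
  assert (H3 := INR_fact_neq_0 (k + j)).
  rewrite pow_add, Rpow_mult_distr.
  apply (Rmult_eq_reg_r (INR (fact j) * INR (fact k) * INR (fact (k + j)))).
  2:{ repeat apply Rmult_integral_contrapositive_currified; assumption. }
  transitivity (c y * (om y ^ k * om y ^ j) *
    (hs (repeat x (S j)) k * (INR (fact j) * INR (fact k)))); [field; assumption|].
  rewrite Hr; field; split; assumption.
- rewrite rsum_swap, <- rsum_scal; apply rsum_ext; intros y _.
  rewrite !rsum_scal; unfold texp; ring.
Qed.

(** Replacing every node by [Z] and every frequency by [Om] majorizes the divided difference by a
    partial exponential series. The factor 1/M! is the gain of the whole extrapolation. *)
Lemma ddiff_tcoef_le K Z l : 0 <= Z -> (forall x, In x l -> Rabs x <= Z) ->
  forall M, length l = S M ->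
  Rabs (ddiff (tcoef K) K l) <=
  rsum P (fun x => Rabs (c x)) * (Om ^ M / INR (fact M)) * exp (Om * Z).
Proof.
intros HZ Hl M HM; unfold ddiff; rewrite HM; simpl pred.
set (C := rsum P (fun x => Rabs (c x))).
assert (HC : 0 <= C) by (apply rsum_nonneg; intros; apply Rabs_pos).
assert (HM0 := INR_fact_lt_0 M).
eapply Rle_trans; [apply rsum_abs|].
apply Rle_trans with (rsum (seq 0 K) (fun k => C * (Om ^ M / INR (fact M)) * ((Om * Z) ^ k / INR (fact k)))).
- apply rsum_le; intros k _; rewrite Rabs_mult.
  assert (H1 : Rabs (tcoef K (k + M)) <= C * (Om ^ (k + M) / INR (fact (k + M)))).
  { assert (H0 : 0 <= Om ^ (k + M) / INR (fact (k + M))).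
    { apply Rmult_le_pos; [apply pow_le, Om0|left; apply Rinv_0_lt_compat, INR_fact_lt_0]. }
    unfold tcoef; destruct (Nat.ltb_spec (k + M) K).
    - eapply Rle_trans; [apply rsum_abs|].
      rewrite Rmult_comm; unfold C; rewrite <- rsum_scal.
      apply rsum_le; intros x Hx; unfold Rdiv.
      rewrite !Rabs_mult, <- RPow_abs.
      rewrite (Rabs_right (/ INR (fact (k + M)))).
      2:{ apply Rle_ge; left; apply Rinv_0_lt_compat, INR_fact_lt_0. }
      rewrite Rmult_assoc, (Rmult_comm (Rabs (c x))).
      apply Rmult_le_compat_r; [apply Rabs_pos|].
      apply Rmult_le_compat_r; [left; apply Rinv_0_lt_compat, INR_fact_lt_0|].
      apply pow_incr; split; [apply Rabs_pos|apply om_le, Hx].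
    - rewrite Rabs_R0; apply Rmult_le_pos; assumption. }
  assert (H2 := hs_le Z l k Hl); rewrite HM in H2.
  assert (H3 := hs_repeat Z M k).
  eapply Rle_trans.
  { apply Rmult_le_compat; [apply Rabs_pos|apply Rabs_pos|exact H1|exact H2]. }
  right; rewrite pow_add, Rpow_mult_distr.
  assert (F1 := INR_fact_neq_0 M); assert (F2 := INR_fact_neq_0 k).
  assert (F3 := INR_fact_neq_0 (k + M)).
  apply (Rmult_eq_reg_r (INR (fact M) * INR (fact k) * INR (fact (k + M)))).
  2:{ repeat apply Rmult_integral_contrapositive_currified; assumption. }
  transitivity (C * (Om ^ k * Om ^ M) *
    (hs (repeat Z (S M)) k * (INR (fact M) * INR (fact k)))); [field; assumption|].
  rewrite H3; field; split; assumption.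
- rewrite rsum_scal; apply Rmult_le_compat_l.
  + apply Rmult_le_pos; [exact HC|]; apply Rmult_le_pos; [apply pow_le, Om0|].
    left; apply Rinv_0_lt_compat; exact HM0.
  + apply (texp_le_exp K (Om * Z)); apply Rmult_le_pos; assumption.
Qed.

(** The bound of [newton] for Taylor polynomials, passed to the limit. The first term carries the
    errors in the data, the second is the interpolation remainder; together they do the work of
    Schwarz's lemma. *)
Lemma extrapolation (nu : nat -> R) (L J : nat) (eps Z z : R) :
  (forall i j, i <> j -> 1 <= Rabs (nu i - nu j)) ->
  (forall i, (i < L)%nat -> Rabs (z - nu i) <= Z) ->
  (forall i, (i < L)%nat -> Rabs (nu i) <= Z) ->
  Rabs z <= Z -> 1 <= Z -> 0 <= eps ->
  (forall i j, (i < L)%nat -> (j < J)%nat ->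
     Rabs (rsum P (fun x => c x * om x ^ j * exp (om x * nu i))) <= eps) ->
  Rabs (rsum P (fun x => c x * exp (om x * z))) <=
  INR (J * L) * (2 * Z) ^ (J * L) * eps +
  Z ^ (J * L) * (rsum P (fun x => Rabs (c x)) * (Om ^ (J * L) / INR (fact (J * L))) * exp (Om * Z)).
Proof.
intros Hgap HzZ HnuZ Hz HZ1 Heps Hdata.
set (M := (J * L)%nat).
set (C := rsum P (fun x => Rabs (c x))).
assert (HC : 0 <= C) by (apply rsum_nonneg; intros; apply Rabs_pos).
apply le_epsilon; intros eta Heta.
set (D := INR M * (2 * Z) ^ M).
assert (HD : 0 <= D) by (apply Rmult_le_pos; [apply pos_INR|apply pow_le; lra]).
set (B := C * (1 + Om) ^ J).
assert (HB : C <= B).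
{ unfold B; rewrite <- (Rmult_1_r C) at 1; apply Rmult_le_compat_l; [exact HC|].
  apply pow_R1_Rle; lra. }
(* Truncation error allowed per exponential: after amplification by the coefficients ([B]) and by
   interpolation ([D]), the total loss stays below [eta]. *)
set (e0 := eta / ((D + 1) * (B + 1))).
assert (Hden : 0 < (D + 1) * (B + 1)) by (apply Rmult_lt_0_compat; lra).
assert (He0 : 0 < e0) by (apply Rdiv_lt_0_compat; assumption).
assert (HeB : B * e0 * (D + 1) <= eta).
{ replace (B * e0 * (D + 1)) with (e0 * ((D + 1) * (B + 1)) - e0 * (D + 1)) by ring.
  replace (e0 * ((D + 1) * (B + 1))) with eta by (unfold e0; field; lra).
  assert (0 <= e0 * (D + 1)) by (apply Rmult_le_pos; lra); lra. }
destruct (texp_cv_list (list_prod (seq 0 L) P) (fun q => om (snd q) * nu (fst q)) e0 He0) as [K1 HK1].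
destruct (texp_cv_list P (fun x => om x * z) e0 He0) as [K2 HK2].
set (K := (K1 + K2 + J)%nat).
assert (Hpow : forall y j, In y P -> (j <= J)%nat -> Rabs (om y) ^ j <= (1 + Om) ^ J).
{ intros y j Hy Hj; apply Rle_trans with ((1 + Om) ^ j).
  - apply pow_incr; split; [apply Rabs_pos|]; specialize (om_le y Hy); lra.
  - apply Rle_pow; [lra|exact Hj]. }
assert (Hdd : forall i j, (i < L)%nat -> (j < J)%nat ->
  Rabs (ddiff (tcoef K) K (repeat (nu i) (S j))) <= eps + B * e0).
{ intros i j Hi Hj; rewrite ddiff_tcoef_repeat by (unfold K; lia).
  rewrite Rabs_mult, Rabs_right.
  2:{ apply Rle_ge; left; apply Rinv_0_lt_compat, INR_fact_lt_0. }
  set (V := rsum P _).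
  assert (HV : Rabs V <= eps + B * e0).
  { set (V0 := rsum P (fun x => c x * om x ^ j * exp (om x * nu i))).
    replace V with (V0 + (V - V0)) by ring.
    eapply Rle_trans; [apply Rabs_triang|]; apply Rplus_le_compat; [apply Hdata; assumption|].
    unfold V, V0; rewrite <- rsum_minus; eapply Rle_trans; [apply rsum_abs|].
    unfold B, C; rewrite !Rmult_assoc, Rmult_comm, <- rsum_scal.
    apply rsum_le; intros y Hy.
    replace (c y * om y ^ j * texp (K - j) (om y * nu i) - c y * om y ^ j * exp (om y * nu i))
      with (- (c y * om y ^ j * (exp (om y * nu i) - texp (K - j) (om y * nu i)))) by ring.
    rewrite Rabs_Ropp, !Rabs_mult, <- RPow_abs, Rmult_assoc, Rmult_comm.
    apply Rmult_le_compat_r; [apply Rabs_pos|].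
    apply Rmult_le_compat; [apply pow_le, Rabs_pos|apply Rabs_pos|apply Hpow; [exact Hy|lia]|].
    left; apply (HK1 (K - j)%nat (i, y)); [unfold K; lia|].
    apply in_prod; [apply in_seq; lia|exact Hy]. }
  assert (Hf : / INR (fact j) <= 1).
  { rewrite <- Rinv_1; apply Rinv_le_contravar; [lra|].
    apply (le_INR 1); apply lt_O_fact. }
  rewrite <- (Rmult_1_l (eps + B * e0)); apply Rmult_le_compat; try assumption.
  - left; apply Rinv_0_lt_compat, INR_fact_lt_0.
  - apply Rabs_pos. }
assert (HBe : 0 <= B * e0) by (apply Rmult_le_pos; lra).
assert (HN := newton (tcoef K) K nu L J (eps + B * e0) Z z (tcoef_0 K) Hgap HzZ HZ1
  ltac:(lra) Hdd _ (nodes_admissible L J)).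
rewrite nodes_length in HN; fold M in HN; fold D in HN.
assert (Hrem : Rabs (ddiff (tcoef K) K (z :: map nu (concat (repeat (seq 0 L) J)))) <=
  C * (Om ^ M / INR (fact M)) * exp (Om * Z)).
{ apply ddiff_tcoef_le; [lra| |].
  - intros x [<-|Hx]; [exact Hz|]; apply in_map_iff in Hx; destruct Hx as (i & <- & Hi).
    apply HnuZ, (nodes_admissible L J i), Hi.
  - simpl; rewrite length_map, nodes_length; reflexivity. }
assert (Hz0 : ddiff (tcoef K) K [z] = rsum P (fun y => c y * texp K (om y * z))).
{ change [z] with (repeat z 1); rewrite ddiff_tcoef_repeat by lia.
  simpl; rewrite Nat.sub_0_r, Rinv_1, Rmult_1_l; apply rsum_ext; intros; ring. }
assert (Herr : Rabs (rsum P (fun x => c x * exp (om x * z)) - ddiff (tcoef K) K [z]) <= B * e0).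
{ rewrite Hz0, <- rsum_minus; eapply Rle_trans; [apply rsum_abs|].
  apply Rle_trans with (C * e0); [|apply Rmult_le_compat_r; lra].
  unfold C; rewrite Rmult_comm, <- rsum_scal; apply rsum_le; intros y Hy.
  rewrite <- Rmult_minus_distr_l, Rabs_mult, Rmult_comm.
  apply Rmult_le_compat_r; [apply Rabs_pos|]; left; apply HK2; [unfold K; lia|exact Hy]. }
replace (rsum P (fun x => c x * exp (om x * z))) with
  (ddiff (tcoef K) K [z] + (rsum P (fun x => c x * exp (om x * z)) - ddiff (tcoef K) K [z])) by ring.
eapply Rle_trans; [apply Rabs_triang|].
assert (HZM : 0 <= Z ^ M) by (apply pow_le; lra).
apply (Rmult_le_compat_l (Z ^ M)) in Hrem; [|exact HZM].
fold C; nra.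
Qed.

End Extrapolation.

(** * The ring [Z[alpha]] and its quadratic extensions *)

Definition al : R := (1 + sqrt 5) / 2.
Definition be : R := (1 - sqrt 5) / 2.

Lemma sqrt5_sq : sqrt 5 * sqrt 5 = 5.
Proof. apply sqrt_sqrt; lra. Qed.

Lemma sqrt5_bounds : 2.236 < sqrt 5 < 2.2361.
Proof.
assert (H := sqrt5_sq); assert (0 <= sqrt 5) by apply sqrt_pos.
split; apply Rnot_le_lt; intros Hc; nra.
Qed.

Lemma al_sq : al * al = al + 1.
Proof. unfold al; assert (H := sqrt5_sq); nra. Qed.

Lemma be_sq : be * be = be + 1.
Proof. unfold be; assert (H := sqrt5_sq); nra. Qed.

Lemma al_be : al * be = -1.
Proof. unfold al, be; assert (H := sqrt5_sq); nra. Qed.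

Lemma al_bounds : 1.618 < al < 1.6181.
Proof. unfold al; assert (H := sqrt5_bounds); lra. Qed.

Lemma be_bounds : -0.6181 < be < -0.618.
Proof. unfold be; assert (H := sqrt5_bounds); lra. Qed.

Definition nonsq (k : Z) : Prop := forall p q : Z, (p * p = k * (q * q))%Z -> q = 0%Z.

(** Infinite descent: [p] divides [a], then [b], and division of both by [p] gives a smaller
    solution. *)
Lemma prime_sq_zero (p u a b : Z) : prime p -> ~ (p | u)%Z ->
  (u * (a * a) = p * (b * b))%Z -> b = 0%Z.
Proof.
intros Hp Hu.
assert (Hp2 := prime_ge_2 p Hp).
enough (H : forall n : nat, forall a b, (Z.abs b < Z.of_nat n)%Z ->
  (u * (a * a) = p * (b * b))%Z -> b = 0%Z).
{ intros Heq; apply (H (S (Z.abs_nat b)) a b); [lia|exact Heq]. }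
clear a b; induction n as [|n IH]; intros a b Hb Heq; [lia|].
assert (Ha : (p | a)%Z).
{ assert (H : (p | u * (a * a))%Z) by (rewrite Heq; apply Z.divide_factor_l).
  apply prime_mult in H; [|exact Hp]; destruct H as [H|H]; [contradiction|].
  apply prime_mult in H; [|exact Hp]; tauto. }
destruct Ha as [a' ->].
assert (Heq' : (p * (u * (a' * a')) = b * b)%Z) by nia.
assert (Hb' : (p | b)%Z).
{ assert (H : (p | b * b)%Z) by (rewrite <- Heq'; apply Z.divide_factor_l).
  apply prime_mult in H; [|exact Hp]; tauto. }
destruct Hb' as [b' ->].
destruct (Z.eq_dec b' 0) as [->|Hb0]; [reflexivity|].
exfalso; apply Hb0; apply (IH a' b'); [|nia].
assert (Z.abs (b' * p) = Z.abs b' * p)%Z by (rewrite Z.abs_mul; lia); nia.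
Qed.

Lemma prime_5 : prime 5.
Proof.
apply prime_intro; [lia|]; intros n Hn.
assert (n = 1 \/ n = 2 \/ n = 3 \/ n = 4)%Z as [->|[->|[->| ->]]] by lia;
apply Zgcd_1_rel_prime; reflexivity.
Qed.

Lemma nonsq_5 : nonsq 5.
Proof.
intros p q H; apply (prime_sq_zero 5 1 p q); [exact prime_5| |lia].
intros [k Hk]; lia.
Qed.

Lemma nonsq_neg k : (k < 0)%Z -> nonsq k.
Proof. intros Hk p q H; nia. Qed.

(* [inO v v'] : [v] is an element of [Z[alpha]] with conjugate [v']. *)
Definition inO (v v' : R) : Prop :=
  exists x y : Z, v = IZR x + IZR y * al /\ v' = IZR x + IZR y * be.

Lemma inO_IZR z : inO (IZR z) (IZR z).
Proof. exists z, 0%Z; split; simpl; lra. Qed.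

Lemma inO_al : inO al be.
Proof. exists 0%Z, 1%Z; split; simpl; lra. Qed.

Lemma inO_sqrt5 : inO (sqrt 5) (- sqrt 5).
Proof. exists (-1)%Z, 2%Z; unfold al, be; split; simpl; lra. Qed.

Lemma inO_add v v' w w' : inO v v' -> inO w w' -> inO (v + w) (v' + w').
Proof.
intros (x & y & -> & ->) (x1 & y1 & -> & ->); exists (x + x1)%Z, (y + y1)%Z.
rewrite !plus_IZR; split; ring.
Qed.

Lemma inO_opp v v' : inO v v' -> inO (- v) (- v').
Proof.
intros (x & y & -> & ->); exists (- x)%Z, (- y)%Z; rewrite !opp_IZR; split; ring.
Qed.

Lemma inO_sub v v' w w' : inO v v' -> inO w w' -> inO (v - w) (v' - w').
Proof. intros H1 H2; apply inO_add; [exact H1|apply inO_opp, H2]. Qed.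

Lemma inO_mul v v' w w' : inO v v' -> inO w w' -> inO (v * w) (v' * w').
Proof.
intros (x & y & -> & ->) (x1 & y1 & -> & ->).
exists (x * x1 + y * y1)%Z, (x * y1 + y * x1 + y * y1)%Z.
rewrite !plus_IZR, !mult_IZR; split.
- transitivity (IZR x * IZR x1 + (IZR x * IZR y1 + IZR y * IZR x1) * al
    + IZR y * IZR y1 * (al * al)); [ring|rewrite al_sq; ring].
- transitivity (IZR x * IZR x1 + (IZR x * IZR y1 + IZR y * IZR x1) * be
    + IZR y * IZR y1 * (be * be)); [ring|rewrite be_sq; ring].
Qed.

Lemma inO_pow v v' n : inO v v' -> inO (v ^ n) (v' ^ n).
Proof.
intros H; induction n as [|n IH]; [apply (inO_IZR 1)|simpl; apply inO_mul; assumption].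
Qed.

(** The norm form x^2 + xy - y^2 times 4 is (2x+y)^2 - 5y^2, so a nontrivial zero would make 5 a
    rational square. *)
Lemma inO_norm v v' : inO v v' ->
  exists z : Z, v * v' = IZR z /\ (z = 0%Z -> v = 0 /\ v' = 0).
Proof.
intros (x & y & -> & ->); exists (x * x + x * y - y * y)%Z; split.
- rewrite minus_IZR, plus_IZR, !mult_IZR.
  transitivity (IZR x * IZR x + IZR x * IZR y * (al + be) + IZR y * IZR y * (al * be)); [ring|].
  rewrite al_be; replace (al + be) with 1 by (unfold al, be; lra); ring.
- intros Hz.
  assert (Hy : y = 0%Z).
  { apply (nonsq_5 (2 * x + y)%Z y); nia. }
  subst y; assert (x = 0%Z) by nia; subst x; simpl; lra.
Qed.

Lemma inO_conj_zero v v' : inO v v' -> v = 0 -> v' = 0.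
Proof.
intros H Hv; destruct (inO_norm v v' H) as (z & Hz & H0).
apply H0; apply eq_IZR; rewrite <- Hz, Hv; ring.
Qed.

Lemma inO_liouville v v' : inO v v' -> v <> 0 -> 1 <= Rabs v * Rabs v'.
Proof.
intros H Hv; destruct (inO_norm v v' H) as (z & Hz & H0).
rewrite <- Rabs_mult, Hz, <- abs_IZR; apply IZR_le.
assert (z <> 0%Z) by (intros Hc; apply Hv, H0, Hc); lia.
Qed.

(* A "house predicate" [Q]: [Q v H] means that [v] lies in a certain ring of
   algebraic integers and all its conjugates are at most [H]. *)
Record house (Q : R -> R -> Prop) : Prop := {
  house_abs : forall v H, Q v H -> Rabs v <= H;
  house_mono : forall v H H', Q v H -> H <= H' -> Q v H';
  house_add : forall v H w K, Q v H -> Q w K -> Q (v + w) (H + K);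
  house_opp : forall v H, Q v H -> Q (- v) H;
  house_mul : forall v H w K, Q v H -> Q w K -> Q (v * w) (H * K)
}.

(* [c] is not a square in the fraction field of the ring described by [Q]. *)
Definition NS (Q : R -> R -> Prop) (c : R) : Prop :=
  forall x y Hx Hy, Q x Hx -> Q y Hy -> x * x = c * (y * y) -> y = 0.

Definition liouville (Q : R -> R -> Prop) (e : nat) : Prop :=
  forall v H, Q v H -> v <> 0 -> 1 <= Rabs v * H ^ e.

Lemma house_pos Q : house Q -> forall v H, Q v H -> 0 <= H.
Proof.
intros HQ v H Hv; eapply Rle_trans; [apply Rabs_pos|apply (house_abs Q HQ v H Hv)].
Qed.

Definition Q0 (v H : R) : Prop := exists v', inO v v' /\ Rabs v <= H /\ Rabs v' <= H.

Lemma Q0_house : house Q0.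
Proof.
split.
- intros v H (v' & _ & H1 & _); exact H1.
- intros v H H' (v' & HO & H1 & H2) HH; exists v'; repeat split; [exact HO|lra|lra].
- intros v H w K (v' & HO & H1 & H2) (w' & HO' & H1' & H2'); exists (v' + w').
  split; [apply inO_add; assumption|]; split; (eapply Rle_trans; [apply Rabs_triang|lra]).
- intros v H (v' & HO & H1 & H2); exists (- v'); rewrite !Rabs_Ropp.
  split; [apply inO_opp; exact HO|split; assumption].
- intros v H w K (v' & HO & H1 & H2) (w' & HO' & H1' & H2'); exists (v' * w').
  split; [apply inO_mul; assumption|]; rewrite !Rabs_mult.
  split; apply Rmult_le_compat; try apply Rabs_pos; assumption.
Qed.

Lemma Q0_liouville : liouville Q0 1.
Proof.
intros v H (v' & HO & H1 & H2) Hv; rewrite pow_1.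
eapply Rle_trans; [apply (inO_liouville v v' HO Hv)|].
apply Rmult_le_compat_l; [apply Rabs_pos|exact H2].
Qed.

(** Norms of both sides of x^2 = c y^2 give a similar equation over the integers with [N] in place
    of [c]. *)
Lemma Q0_NS c c' N : inO c c' -> c * c' = IZR N -> nonsq N -> NS Q0 c.
Proof.
intros Hc HN HNs x y Hx Hy (x' & HOx & _) (y' & HOy & _) Heq.
assert (H0 : x' * x' - c' * (y' * y') = 0).
{ apply (inO_conj_zero (x * x - c * (y * y))).
  - apply inO_sub; repeat apply inO_mul; assumption.
  - rewrite Heq; ring. }
destruct (inO_norm x x' HOx) as (p & Hp & _).
destruct (inO_norm y y' HOy) as (q & Hq & Hq0).
apply Hq0, (HNs p q), eq_IZR; rewrite !mult_IZR, <- Hp, <- Hq, <- HN.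
transitivity ((x * x) * (x' * x')); [ring|].
rewrite Heq; replace (x' * x') with (c' * (y' * y')) by lra; ring.
Qed.

(** The ring obtained by adjoining [s], whose square lies in the ring of [Q]. [D] bounds all
    conjugates of [s], so [Hx + D * Hy] bounds those of [x + y * s]. *)
Definition adj (Q : R -> R -> Prop) (s D : R) (v H : R) : Prop :=
  exists x y Hx Hy, v = x + y * s /\ Q x Hx /\ Q y Hy /\ Hx + D * Hy <= H.

Section Adjunction.

Variables (Q : R -> R -> Prop) (s D : R).
Hypothesis HQ : house Q.
Hypothesis D0 : 0 <= D.
Hypothesis sD : Q (s * s) (D * D).

Lemma adj_s_le : Rabs s <= D.
Proof.
assert (H := house_abs Q HQ _ _ sD); rewrite Rabs_mult in H.
assert (H0 := Rabs_pos s); nra.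
Qed.

Lemma adj_house : house (adj Q s D).
Proof.
assert (Hs := adj_s_le).
assert (Hpos := house_pos Q HQ).
split.
- intros v H (x & y & Hx & Hy & -> & Qx & Qy & HH).
  assert (H1 := house_abs Q HQ _ _ Qx); assert (H2 := house_abs Q HQ _ _ Qy).
  eapply Rle_trans; [apply Rabs_triang|]; rewrite Rabs_mult.
  assert (Rabs y * Rabs s <= Hy * D) by (apply Rmult_le_compat; try apply Rabs_pos; assumption).
  lra.
- intros v H H' (x & y & Hx & Hy & E & Qx & Qy & HH) HH'; exists x, y, Hx, Hy.
  repeat split; try assumption; lra.
- intros v H w K (x & y & Hx & Hy & -> & Qx & Qy & HH) (x1 & y1 & Hx1 & Hy1 & -> & Qx1 & Qy1 & HH1).
  exists (x + x1), (y + y1), (Hx + Hx1), (Hy + Hy1); split; [ring|].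
  split; [apply (house_add Q HQ); assumption|].
  split; [apply (house_add Q HQ); assumption|lra].
- intros v H (x & y & Hx & Hy & -> & Qx & Qy & HH); exists (- x), (- y), Hx, Hy.
  split; [ring|]; split; [apply (house_opp Q HQ), Qx|].
  split; [apply (house_opp Q HQ), Qy|exact HH].
- intros v H w K (x & y & Hx & Hy & -> & Qx & Qy & HH) (x1 & y1 & Hx1 & Hy1 & -> & Qx1 & Qy1 & HH1).
  exists (x * x1 + s * s * (y * y1)), (x * y1 + y * x1),
    (Hx * Hx1 + D * D * (Hy * Hy1)), (Hx * Hy1 + Hy * Hx1).
  split; [ring|]; split.
  { apply (house_add Q HQ); [|apply (house_mul Q HQ); [exact sD|]]; apply (house_mul Q HQ); assumption. }
  split; [apply (house_add Q HQ); apply (house_mul Q HQ); assumption|].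
  assert (P1 := Hpos _ _ Qx); assert (P2 := Hpos _ _ Qy).
  assert (P3 := Hpos _ _ Qx1); assert (P4 := Hpos _ _ Qy1).
  assert (0 <= D * Hy) by (apply Rmult_le_pos; assumption).
  assert (0 <= D * Hy1) by (apply Rmult_le_pos; assumption).
  apply Rle_trans with ((Hx + D * Hy) * (Hx1 + D * Hy1)); [right; ring|].
  apply Rmult_le_compat; lra.
Qed.

Hypothesis nss : NS Q (s * s).

Lemma adj_zero x y Hx Hy : Q x Hx -> Q y Hy -> x + y * s = 0 -> x = 0 /\ y = 0.
Proof.
intros Qx Qy H0.
assert (Hy0 : y = 0).
{ apply (nss x y Hx Hy Qx Qy); replace x with (- (y * s)) by lra; ring. }
split; [rewrite Hy0 in H0; lra|exact Hy0].
Qed.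

(** The product with the conjugate [x - y * s] lies in the base ring and has house at most H^2; the
    conjugate itself costs one more [H], which gives the exponent 2e + 1. *)
Lemma adj_liouville e : liouville Q e -> liouville (adj Q s D) (2 * e + 1).
Proof.
intros HL v H (x & y & Hx & Hy & -> & Qx & Qy & HH) Hv.
assert (Hs := adj_s_le).
assert (P1 := house_pos Q HQ _ _ Qx); assert (P2 := house_pos Q HQ _ _ Qy).
assert (P3 : 0 <= D * Hy) by (apply Rmult_le_pos; assumption).
set (N := x * x + - (s * s * (y * y))).
assert (QN : Q N (H * H)).
{ apply (house_mono Q HQ) with (Hx * Hx + D * D * (Hy * Hy)).
  - apply (house_add Q HQ); [apply (house_mul Q HQ); assumption|].
    apply (house_opp Q HQ), (house_mul Q HQ); [exact sD|apply (house_mul Q HQ); assumption].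
  - apply Rle_trans with ((Hx + D * Hy) * (Hx + D * Hy)); [nra|].
    apply Rmult_le_compat; lra. }
assert (N0 : N <> 0).
{ intros HN; apply Hv.
  assert (Hy0 : y = 0) by (apply (nss x y Hx Hy Qx Qy); unfold N in HN; lra).
  unfold N in HN; rewrite Hy0 in *; assert (x = 0) by nra; lra. }
assert (HLN := HL N (H * H) QN N0).
replace N with ((x + y * s) * (x - y * s)) in HLN by (unfold N; ring).
rewrite Rabs_mult in HLN.
assert (Hc : Rabs (x - y * s) <= H).
{ unfold Rminus; eapply Rle_trans; [apply Rabs_triang|]; rewrite Rabs_Ropp, Rabs_mult.
  assert (A1 := house_abs Q HQ _ _ Qx); assert (A2 := house_abs Q HQ _ _ Qy).
  assert (Rabs y * Rabs s <= Hy * D) by (apply Rmult_le_compat; try apply Rabs_pos; assumption).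
  lra. }
eapply Rle_trans; [exact HLN|].
replace (H ^ (2 * e + 1)) with (H * (H * H) ^ e).
2:{ rewrite Rpow_mult_distr; replace (2 * e + 1)%nat with (S (e + e)) by lia.
    simpl; rewrite pow_add; ring. }
rewrite Rmult_assoc; apply Rmult_le_compat_l; [apply Rabs_pos|].
apply Rmult_le_compat_r; [apply pow_le; nra|exact Hc].
Qed.

(** Multiplying X^2 = c Y^2 by the squared conjugate of Y gives (u + v s)^2 = c t^2 with [t] in the
    base ring. Then u v = 0, so either [c] (if v = 0) or [s * s * c] (if u = 0) is a square
    below. *)
Lemma adj_NS c K : Q c K -> NS Q c -> NS Q (s * s * c) -> NS (adj Q s D) c.
Proof.
intros Qc Hc Hdc X Y HX HY (x0 & x1 & Hx0 & Hx1 & -> & Qx0 & Qx1 & _)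
  (y0 & y1 & Hy0 & Hy1 & -> & Qy0 & Qy1 & _) Heq.
set (t := y0 * y0 + - (s * s * (y1 * y1))).
set (u := x0 * y0 + - (s * s * (x1 * y1))).
set (v := x1 * y0 + - (x0 * y1)).
assert (Qt : Q t (Hy0 * Hy0 + D * D * (Hy1 * Hy1))).
{ apply (house_add Q HQ); [|apply (house_opp Q HQ), (house_mul Q HQ); [exact sD|]];
  apply (house_mul Q HQ); assumption. }
assert (Qu : Q u (Hx0 * Hy0 + D * D * (Hx1 * Hy1))).
{ apply (house_add Q HQ); [|apply (house_opp Q HQ), (house_mul Q HQ); [exact sD|]];
  apply (house_mul Q HQ); assumption. }
assert (Qv : Q v (Hx1 * Hy0 + Hx0 * Hy1)).
{ apply (house_add Q HQ); [|apply (house_opp Q HQ)]; apply (house_mul Q HQ); assumption. }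
assert (E : (u * u + s * s * (v * v) - c * (t * t)) + (2 * (u * v)) * s = 0).
{ replace ((u * u + s * s * (v * v) - c * (t * t)) + (2 * (u * v)) * s)
    with ((y0 - y1 * s) * (y0 - y1 * s) *
      ((x0 + x1 * s) * (x0 + x1 * s) - c * ((y0 + y1 * s) * (y0 + y1 * s))))
    by (unfold u, v, t; ring).
  rewrite Heq; ring. }
destruct (Req_dec t 0) as [Ht|Ht].
{ assert (Hy10 : y1 = 0) by (apply (nss y0 y1 Hy0 Hy1 Qy0 Qy1); unfold t in Ht; lra).
  unfold t in Ht; rewrite Hy10 in *; assert (y0 = 0) by nra; lra. }
exfalso.
assert (Q1 := house_add Q HQ _ _ _ _
  (house_add Q HQ _ _ _ _ (house_mul Q HQ _ _ _ _ Qu Qu)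
     (house_mul Q HQ _ _ _ _ sD (house_mul Q HQ _ _ _ _ Qv Qv)))
  (house_opp Q HQ _ _ (house_mul Q HQ _ _ _ _ Qc (house_mul Q HQ _ _ _ _ Qt Qt)))).
assert (Q2 := house_mul Q HQ _ _ _ _ Qu Qv).
destruct (adj_zero _ _ _ _ Q1 (house_add Q HQ _ _ _ _ Q2 Q2)) as [E1 E2]; [lra|].
destruct (Rmult_integral u v) as [H0|H0]; [lra| |]; rewrite H0 in E1.
- apply Ht, (Hdc (s * s * v) t _ _ (house_mul Q HQ _ _ _ _ sD Qv) Qt).
  assert (E3 : s * s * (v * v) = c * (t * t)) by lra.
  transitivity (s * s * (s * s * (v * v))); [ring|rewrite E3; ring].
- apply Ht, (Hc u t _ _ Qu Qt); lra.
Qed.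

End Adjunction.

Lemma house_sum {A} Q (l : list A) (f g : A -> R) : house Q -> Q 0 0 ->
  (forall a, In a l -> Q (f a) (g a)) -> Q (rsum l f) (rsum l g).
Proof.
intros HQ H0; induction l as [|a l IH]; intros H; [exact H0|].
rewrite !rsum_cons; apply (house_add Q HQ); [apply H; left; reflexivity|].
apply IH; intros b Hb; apply H; right; exact Hb.
Qed.

Lemma house_pow Q v H n : house Q -> Q 1 1 -> Q v H -> Q (v ^ n) (H ^ n).
Proof.
intros HQ H1 Hv; induction n as [|n IH]; [exact H1|simpl; apply (house_mul Q HQ); assumption].
Qed.

Lemma rsum_filter {A} (b : A -> bool) (l : list A) f :
  rsum l (fun a => if b a then f a else 0) = rsum (filter b l) f.
Proof.
induction l as [|a l IH]; [reflexivity|]; simpl; destruct (b a); simpl; rewrite IH; lra.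
Qed.

(** The terms with and without [s] group into X + Y s, and [adj_zero] makes both parts vanish. *)
Lemma adj_sum_zero {A} Q s (l : list A) (b : A -> bool) (f g : A -> R) :
  house Q -> Q 0 0 -> NS Q (s * s) ->
  (forall a, In a l -> Q (f a) (g a)) ->
  rsum l (fun a => f a * (if b a then s else 1)) = 0 ->
  forall v, rsum (filter (fun a => Bool.eqb (b a) v) l) f = 0.
Proof.
intros HQ H0 Hns Hf Hs v.
set (fe := fun v a => if Bool.eqb (b a) v then f a else 0).
set (ge := fun v a => if Bool.eqb (b a) v then g a else 0).
assert (HQe : forall v, Q (rsum l (fe v)) (rsum l (ge v))).
{ intros u; apply house_sum; [exact HQ|exact H0|].
  intros a Ha; unfold fe, ge; destruct (Bool.eqb (b a) u); [apply Hf, Ha|exact H0]. }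
destruct (adj_zero Q s Hns _ _ _ _ (HQe false) (HQe true)) as [E0 E1].
- rewrite <- Hs, (Rmult_comm _ s), <- rsum_scal, <- rsum_plus.
  apply rsum_ext; intros a _; unfold fe; destruct (b a); simpl; ring.
- rewrite <- rsum_filter; destruct v; assumption.
Qed.

Lemma Q0_zero : Q0 0 0.
Proof. exists 0; split; [apply (inO_IZR 0)|rewrite Rabs_R0; split; lra]. Qed.

Lemma Q0_one : Q0 1 1.
Proof. exists 1; split; [apply (inO_IZR 1)|rewrite Rabs_R1; split; lra]. Qed.

Lemma adj_base Q s D v H : Q 0 0 -> Q v H -> adj Q s D v H.
Proof.
intros H0 Hv; exists v, 0, H, 0; split; [ring|]; split; [exact Hv|split; [exact H0|lra]].
Qed.

Lemma adj_root Q s D : Q 0 0 -> Q 1 1 -> adj Q s D s D.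
Proof.
intros H0 H1; exists 0, 1, 0, 1; split; [ring|]; split; [exact H0|split; [exact H1|lra]].
Qed.

(** * The tower generated by the square roots of al, 3 and c *)

Section Tower.

Variables (c c' D1 D2 D3 : R).
Hypothesis c0 : 0 <= c.
Hypothesis Oc : inO c c'.
Hypotheses (D1p : 0 <= D1) (D2p : 0 <= D2) (D3p : 0 <= D3).
Hypothesis HD1 : al <= D1 * D1.
Hypothesis HD2 : 3 <= D2 * D2.
Hypothesis HD3 : Rabs c <= D3 * D3.
Hypothesis HD3' : Rabs c' <= D3 * D3.
Hypothesis nsc : NS Q0 c.
Hypothesis nsc3 : NS Q0 (3 * c).
Hypothesis nsca : NS Q0 (al * c).
Hypothesis nsc3a : NS Q0 (al * (3 * c)).

Let s1 := sqrt al.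
Let s2 := sqrt 3.
Let s3 := sqrt c.

Let al0 : 0 <= al.
Proof. assert (H := al_bounds); lra. Qed.

Let s1_sq : s1 * s1 = al.
Proof. apply sqrt_sqrt, al0. Qed.

Let s2_sq : s2 * s2 = 3.
Proof. apply sqrt_sqrt; lra. Qed.

Let s3_sq : s3 * s3 = c.
Proof. apply sqrt_sqrt, c0. Qed.

Lemma ns_al : NS Q0 al.
Proof.
apply (Q0_NS al be (-1) inO_al).
- rewrite al_be; reflexivity.
- apply nonsq_neg; lia.
Qed.

Lemma nonsq_sq_prime p u v x y : Znumtheory.prime p -> ~ (p | u)%Z -> v <> 0%Z ->
  (u * (x * x) = v * v * p * (y * y))%Z -> y = 0%Z.
Proof.
intros Hp Hu Hv H.
assert (v * y = 0)%Z; [|nia].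
apply (prime_sq_zero p u x (v * y) Hp Hu); nia.
Qed.

(** The norm 9 of 3 is a square, so [Q0_NS] says nothing. Multiplying [x] by the conjugate of [y]
    makes the right side 3t^2 with an integer [t]; comparing coefficients of [al] leaves p^2 = 3t^2
    or 5p^2 = 3t^2. *)
Lemma ns_3 : NS Q0 3.
Proof.
intros x y Hx Hy (x' & Ox & _) (y' & Oy & _) Heq.
destruct (inO_norm y y' Oy) as (t & Ht & Ht0).
assert (Oz : inO (x * y') (x' * y)).
{ apply inO_mul; [exact Ox|]; destruct Oy as (p & q & -> & ->).
  exists (p + q)%Z, (- q)%Z; rewrite plus_IZR, opp_IZR.
  replace be with (1 - al) by (unfold al, be; lra); split; ring. }
destruct Oz as (p & q & Ez & _).
assert (H0 : inO (IZR (p * p + q * q - 3 * t * t) + IZR (2 * p * q + q * q) * al)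
              (IZR (p * p + q * q - 3 * t * t) + IZR (2 * p * q + q * q) * be)).
{ eexists; eexists; split; reflexivity. }
assert (V0 : IZR (p * p + q * q - 3 * t * t) + IZR (2 * p * q + q * q) * al = 0).
{ rewrite minus_IZR, !plus_IZR, !mult_IZR, <- Ht.
  transitivity ((IZR p + IZR q * al) * (IZR p + IZR q * al) - 3 * (y * y') * (y * y')
     - IZR q * IZR q * (al * al - al - 1)); [ring|].
  rewrite al_sq, <- Ez.
  transitivity ((x * x - 3 * (y * y)) * (y' * y')); [ring|rewrite Heq; ring]. }
assert (V1 := inO_conj_zero _ _ H0 V0).
assert (Hab : al - be <> 0) by (assert (B1 := al_bounds); assert (B2 := be_bounds); lra).
assert (Hq : IZR (2 * p * q + q * q) = 0) by (apply (Rmult_eq_reg_r (al - be)); [lra|exact Hab]).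
rewrite Hq in V0.
assert (Hp : IZR (p * p + q * q - 3 * t * t) = 0) by lra.
apply eq_IZR in Hq; apply eq_IZR in Hp.
assert (P3 : Znumtheory.prime 3) by exact Znumtheory.prime_3.
apply Ht0.
assert (q = 0 \/ q = -2 * p)%Z as [->| ->] by nia.
- apply (nonsq_sq_prime 3 1 1 p t P3); [intros [k Hk]; lia|lia|lia].
- apply (nonsq_sq_prime 3 5 1 p t P3); [intros [k Hk]; lia|lia|lia].
Qed.

Lemma ns_3al : NS Q0 (al * 3).
Proof.
apply (Q0_NS (al * 3) (be * 3) (-9)).
- apply inO_mul; [exact inO_al|apply (inO_IZR 3)].
- transitivity (9 * (al * be)); [ring|rewrite al_be; simpl; lra].
- apply nonsq_neg; lia.
Qed.

Let Q1 := adj Q0 s1 D1.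
Let Q2 := adj Q1 s2 D2.
Definition Q3 := adj Q2 s3 D3.

Let Qal : Q0 (s1 * s1) (D1 * D1).
Proof.
assert (B1 := al_bounds); assert (B2 := be_bounds).
rewrite s1_sq; exists be; split; [exact inO_al|].
rewrite (Rabs_right al), (Rabs_left be) by lra; lra.
Qed.

Let H1 : house Q1.
Proof. apply adj_house; [exact Q0_house|exact D1p|exact Qal]. Qed.

Let Q1_zero : Q1 0 0.
Proof. apply adj_base; exact Q0_zero. Qed.

Let Q1_one : Q1 1 1.
Proof. apply adj_base; [exact Q0_zero|exact Q0_one]. Qed.

Let ns1 : NS Q0 (s1 * s1).
Proof. rewrite s1_sq; exact ns_al. Qed.

Let Q3_1 : Q1 (s2 * s2) (D2 * D2).
Proof.
rewrite s2_sq; apply adj_base; [exact Q0_zero|]; exists 3; split; [apply (inO_IZR 3)|].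
rewrite Rabs_right by lra; lra.
Qed.

Let H2 : house Q2.
Proof. apply adj_house; [exact H1|exact D2p|exact Q3_1]. Qed.

Let ns2 : NS Q1 (s2 * s2).
Proof.
rewrite s2_sq; apply adj_NS with 3; [exact Q0_house|exact Qal|exact ns1| |exact ns_3|].
- exists 3; split; [apply (inO_IZR 3)|rewrite Rabs_right by lra; lra].
- rewrite s1_sq; exact ns_3al.
Qed.

Let Qc : Q0 c (D3 * D3).
Proof. exists c'; repeat split; assumption. Qed.

Let Q3_2 : Q2 (s3 * s3) (D3 * D3).
Proof. rewrite s3_sq; apply adj_base; [exact Q1_zero|]; apply adj_base; [exact Q0_zero|exact Qc]. Qed.

Let nsq1 : NS Q1 c.
Proof.
apply adj_NS with (D3 * D3); [exact Q0_house|exact Qal|exact ns1|exact Qc|exact nsc|].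
rewrite s1_sq; exact nsca.
Qed.

Let nsq13 : NS Q1 (3 * c).
Proof.
apply adj_NS with (3 * (D3 * D3)); [exact Q0_house|exact Qal|exact ns1| |exact nsc3|].
- apply (house_mul Q0 Q0_house); [|exact Qc].
  exists 3; split; [apply (inO_IZR 3)|rewrite Rabs_right by lra; lra].
- rewrite s1_sq; exact nsc3a.
Qed.

Let ns3 : NS Q2 (s3 * s3).
Proof.
rewrite s3_sq; apply adj_NS with (D3 * D3);
  [exact H1|exact Q3_1|exact ns2|apply adj_base; [exact Q0_zero|exact Qc]|exact nsq1|].
rewrite s2_sq; exact nsq13.
Qed.

Lemma Q3_house : house Q3.
Proof. apply adj_house; [exact H2|exact D3p|exact Q3_2]. Qed.

(** The field has degree 16 over the rationals, which leaves 15 further conjugates; along the tower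
    the exponent runs through 1, 3, 7, 15. *)
Lemma Q3_liouville : liouville Q3 15.
Proof.
apply (adj_liouville Q2 s3 D3 H2 D3p Q3_2 ns3 7).
apply (adj_liouville Q1 s2 D2 H1 D2p Q3_1 ns2 3).
apply (adj_liouville Q0 s1 D1 Q0_house D1p Qal ns1 1).
exact Q0_liouville.
Qed.

Lemma Q3_base v H : Q0 v H -> Q3 v H.
Proof.
intros Hv; apply adj_base; [apply adj_base; exact Q1_zero|].
apply adj_base; [exact Q1_zero|]; apply adj_base; [exact Q0_zero|exact Hv].
Qed.

Definition rt (s : R) (b : bool) : R := if b then s else 1.

Lemma Q3_term v H b1 b2 b3 : Q0 v H ->
  Q3 (v * rt s1 b1 * rt s2 b2 * rt s3 b3) (H * rt D1 b1 * rt D2 b2 * rt D3 b3).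
Proof.
intros Hv.
assert (HQ := Q3_house).
assert (Q2_zero : Q2 0 0) by (apply adj_base; exact Q1_zero).
assert (Q2_one : Q2 1 1) by (apply adj_base; [exact Q1_zero|exact Q1_one]).
assert (Q31 : Q3 1 1) by (apply adj_base; [exact Q2_zero|exact Q2_one]).
repeat apply (house_mul Q3 HQ).
- apply Q3_base, Hv.
- destruct b1; [|exact Q31].
  apply adj_base; [exact Q2_zero|]; apply adj_base; [exact Q1_zero|].
  apply adj_root; [exact Q0_zero|exact Q0_one].
- destruct b2; [|exact Q31].
  apply adj_base; [exact Q2_zero|]; apply adj_root; [exact Q1_zero|exact Q1_one].
- destruct b3; [|exact Q31]; apply adj_root; [exact Q2_zero|exact Q2_one].
Qed.

Lemma Q3_sum_zero {A} (l : list A) (x hx : A -> R) (b1 b2 b3 : A -> bool) :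
  (forall a, In a l -> Q0 (x a) (hx a)) ->
  rsum l (fun a => x a * rt s1 (b1 a) * rt s2 (b2 a) * rt s3 (b3 a)) = 0 ->
  forall v1 v2 v3,
  rsum (filter (fun a => Bool.eqb (b1 a) v1)
         (filter (fun a => Bool.eqb (b2 a) v2)
            (filter (fun a => Bool.eqb (b3 a) v3) l))) x = 0.
Proof.
intros Hx H0 v1 v2 v3.
assert (Q2_zero : Q2 0 0) by (apply adj_base; exact Q1_zero).
assert (T1 : forall a, In a l -> Q1 (x a * rt s1 (b1 a)) (hx a * rt D1 (b1 a))).
{ intros a Ha; apply (house_mul Q1 H1); [apply adj_base; [exact Q0_zero|apply Hx, Ha]|].
  destruct (b1 a); [apply adj_root; [exact Q0_zero|exact Q0_one]|exact Q1_one]. }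
assert (T2 : forall a, In a l ->
  Q2 (x a * rt s1 (b1 a) * rt s2 (b2 a)) (hx a * rt D1 (b1 a) * rt D2 (b2 a))).
{ intros a Ha; apply (house_mul Q2 H2); [apply adj_base; [exact Q1_zero|apply T1, Ha]|].
  destruct (b2 a); [apply adj_root; [exact Q1_zero|exact Q1_one]|].
  apply adj_base; [exact Q1_zero|exact Q1_one]. }
assert (E3 := adj_sum_zero Q2 s3 l b3 _ _ H2 Q2_zero ns3 T2 H0 v3).
assert (E2 := adj_sum_zero Q1 s2 _ b2 _ _ H1 Q1_zero ns2
  (fun a Ha => T1 a (proj1 (proj1 (filter_In _ _ _) Ha))) E3 v2).
apply (adj_sum_zero Q0 s1 _ b1 _ hx Q0_house Q0_zero ns1); [|exact E2].
intros a Ha; apply filter_In in Ha; destruct Ha as [Ha _].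
apply filter_In in Ha; apply Hx, Ha.
Qed.

End Tower.

Open Scope Z_scope.

(** * Siegel's lemma *)

Fixpoint words {A} (vals : list A) (n : nat) : list (list A) :=
  match n with
  | O => [[]]
  | S n' => map (fun q => fst q :: snd q) (list_prod vals (words vals n'))
  end.

Lemma length_words {A} (vals : list A) n : length (words vals n) = (length vals ^ n)%nat.
Proof.
induction n as [|n IH]; [reflexivity|].
simpl words; rewrite length_map, length_prod, IH; reflexivity.
Qed.

Lemma in_words {A} (vals : list A) n l :
  In l (words vals n) <-> length l = n /\ (forall x, In x l -> In x vals).
Proof.
revert l; induction n as [|n IH]; intros l.
- simpl; split.
  + intros [<-|[]]; split; [reflexivity|intros x []].
  + intros [H _]; left; symmetry; apply length_zero_iff_nil, H.
- simpl words; rewrite in_map_iff; split.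
  + intros ([x w] & <- & H); apply in_prod_iff in H; destruct H as [Hx Hw].
    apply IH in Hw; destruct Hw as [Hl Hw]; simpl; split; [now rewrite Hl|].
    intros y [<-|Hy]; auto.
  + intros [Hl H]; destruct l as [|x l]; [discriminate Hl|].
    exists (x, l); split; [reflexivity|]; apply in_prod_iff; split; [apply H; left; reflexivity|].
    apply IH; split; [now injection Hl|intros y Hy; apply H; right; exact Hy].
Qed.

Lemma NoDup_list_prod_full {A B} (l : list A) (l' : list B) :
  NoDup l -> NoDup l' -> NoDup (list_prod l l').
Proof.
intros Hl Hl'; induction Hl as [|x l Hx _ IH]; simpl; [constructor|].
apply NoDup_app; [|exact IH|].
- apply Injective_map_NoDup; [intros a b [= H]; exact H|exact Hl'].
- intros [a b] H1 H2; apply in_map_iff in H1; destruct H1 as (c & [= <- <-] & _).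
  apply in_prod_iff in H2; apply Hx, H2.
Qed.

Lemma NoDup_words {A} (vals : list A) n : NoDup vals -> NoDup (words vals n).
Proof.
intros Hv; induction n as [|n IH]; [repeat constructor; intros []|].
simpl words; apply Injective_map_NoDup; [|apply NoDup_list_prod_full; assumption].
intros [a b] [c d] [= -> ->]; reflexivity.
Qed.

Lemma collision {A B} (f : A -> B) (l : list A) (l' : list B) :
  NoDup l -> (forall x, In x l -> In (f x) l') -> (length l' < length l)%nat ->
  exists x y, In x l /\ In y l /\ x <> y /\ f x = f y.
Proof.
intros Hl Hf Hlen; apply NNPP; intros Hno.
assert (Hinj : NoDup (map f l)).
{ apply NoDup_map_NoDup_ForallPairs; [|exact Hl].
  intros x y Hx Hy Hxy; apply NNPP; intros Hne; apply Hno; exists x, y; auto. }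
assert (H : (length (map f l) <= length l')%nat).
{ apply NoDup_incl_length; [exact Hinj|].
  intros y Hy; apply in_map_iff in Hy; destruct Hy as (x & <- & Hx); apply Hf, Hx. }
rewrite length_map in H; lia.
Qed.

Fixpoint dot (r v : list Z) : Z :=
  match r, v with
  | a :: r', b :: v' => a * b + dot r' v'
  | _, _ => 0
  end.

Definition zrange (lo : Z) (n : nat) : list Z := map (fun k => lo + Z.of_nat k) (seq 0 n).

Lemma in_zrange lo n z : lo <= z < lo + Z.of_nat n -> In z (zrange lo n).
Proof.
intros H; apply in_map_iff; exists (Z.to_nat (z - lo)); split; [lia|apply in_seq; lia].
Qed.

Lemma zrange_in lo n z : In z (zrange lo n) -> lo <= z < lo + Z.of_nat n.
Proof. intros H; apply in_map_iff in H; destruct H as (k & <- & Hk); apply in_seq in Hk; lia. Qed.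

Lemma NoDup_zrange lo n : NoDup (zrange lo n).
Proof. apply Injective_map_NoDup; [intros a b H; lia|apply seq_NoDup]. Qed.

Lemma length_zrange lo n : length (zrange lo n) = n.
Proof. unfold zrange; rewrite length_map, length_seq; reflexivity. Qed.

Lemma dot_bound B X r v : 0 <= B -> 0 <= X ->
  (forall a, In a r -> Z.abs a <= B) -> (forall b, In b v -> 0 <= b <= X) ->
  Z.abs (dot r v) <= Z.of_nat (length v) * (B * X).
Proof.
intros HB HX; revert v; induction r as [|a r IH]; intros v Hr Hv; [|destruct v as [|b v]]; simpl dot.
- apply Z.mul_nonneg_nonneg; [lia|apply Z.mul_nonneg_nonneg; lia].
- reflexivity.
- assert (H1 : Z.abs (dot r v) <= Z.of_nat (length v) * (B * X)).
  { apply IH; intros z Hz; [apply Hr|apply Hv]; right; exact Hz. }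
  assert (H2 : Z.abs a <= B) by (apply Hr; left; reflexivity).
  assert (H3 : 0 <= b <= X) by (apply Hv; left; reflexivity).
  assert (H4 : Z.abs (a * b) <= B * X).
  { rewrite Z.abs_mul, (Z.abs_eq b) by lia; apply Z.mul_le_mono_nonneg; lia. }
  simpl length; rewrite Nat2Z.inj_succ; lia.
Qed.

Fixpoint vsub (v w : list Z) : list Z :=
  match v, w with a :: v', b :: w' => (a - b) :: vsub v' w' | _, _ => [] end.

Lemma dot_vsub r v w : length v = length w -> dot r (vsub v w) = dot r v - dot r w.
Proof.
revert v w; induction r as [|a r IH]; intros [|b v] [|c w] H; try discriminate H; simpl; try lia.
rewrite IH by (simpl in H; lia); ring.
Qed.

Lemma length_vsub v w : length v = length w -> length (vsub v w) = length v.
Proof.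
revert w; induction v as [|b v IH]; intros [|c w] H; try discriminate H; simpl; [reflexivity|].
rewrite IH; simpl in H; lia.
Qed.

Lemma vsub_neq v w : length v = length w -> v <> w -> exists p, In p (vsub v w) /\ p <> 0.
Proof.
revert w; induction v as [|b v IH]; intros [|c w] H Hne; try discriminate H; [congruence|].
destruct (Z.eq_dec b c) as [->|Hbc].
- destruct (IH w) as (p & Hp & Hp0); [simpl in H; lia|congruence|].
  exists p; split; [right; exact Hp|exact Hp0].
- exists (b - c); split; [left; reflexivity|lia].
Qed.

Lemma vsub_bound X v w : (forall b, In b v -> 0 <= b <= X) -> (forall b, In b w -> 0 <= b <= X) ->
  forall p, In p (vsub v w) -> Z.abs p <= X.
Proof.
revert w; induction v as [|b v IH]; intros [|c w] Hv Hw p Hp; try (destruct Hp; fail).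
destruct Hp as [<-|Hp].
- assert (0 <= b <= X) by (apply Hv; left; reflexivity).
  assert (0 <= c <= X) by (apply Hw; left; reflexivity); lia.
- apply (IH w); [| |exact Hp]; intros z Hz; [apply Hv|apply Hw]; right; exact Hz.
Qed.

(** Pigeonhole. For coordinates in 0..X each dot product lies in an interval of 2Y + 1 integers; [X]
    is chosen so that 2Y = X^2, and X^2 + 1 < (X+1)^2. With two unknowns per equation there are more
    vectors than values. *)
Lemma siegel (rows : list (list Z)) (U : nat) (B : Z) :
  1 <= B -> (0 < U)%nat -> (2 * length rows <= U)%nat ->
  (forall r, In r rows -> forall a, In a r -> Z.abs a <= B) ->
  exists ps : list Z, length ps = U /\ (exists p, In p ps /\ p <> 0) /\
    (forall p, In p ps -> Z.abs p <= 2 * Z.of_nat U * B) /\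
    (forall r, In r rows -> dot r ps = 0).
Proof.
intros HB HU Hrows Hent.
set (X := 2 * Z.of_nat U * B).
assert (HX : 0 < X) by (unfold X; apply Z.mul_pos_pos; lia).
set (Y := Z.of_nat U * (B * X)).
assert (HY : 0 <= Y) by (unfold Y; apply Z.mul_nonneg_nonneg; [lia|apply Z.mul_nonneg_nonneg; lia]).
set (V := words (zrange 0 (Z.to_nat (X + 1))) U).
set (Im := words (zrange (- Y) (Z.to_nat (2 * Y + 1))) (length rows)).
assert (HV : forall v, In v V -> length v = U /\ forall b, In b v -> 0 <= b <= X).
{ intros v Hv; apply in_words in Hv; destruct Hv as [Hl Hv]; split; [exact Hl|].
  intros b Hb; apply Hv, zrange_in in Hb; lia. }
destruct (collision (fun v => map (fun r => dot r v) rows) V Im) as (v & w & Hv & Hw & Hne & Heq).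
- apply NoDup_words, NoDup_zrange.
- intros v Hv; destruct (HV v Hv) as [Hl Hb]; apply in_words; split; [apply length_map|].
  intros y Hy; apply in_map_iff in Hy; destruct Hy as (r & <- & Hr).
  apply in_zrange; assert (H := dot_bound B X r v ltac:(lia) ltac:(lia) (Hent r Hr) Hb).
  rewrite Hl in H; fold Y in H; lia.
- unfold V, Im; rewrite !length_words, !length_zrange.
  set (R := length rows) in *.
  assert (H1 : (Z.to_nat (2 * Y + 1) < Z.to_nat (X + 1) * Z.to_nat (X + 1))%nat).
  { rewrite <- Z2Nat.inj_mul by lia; apply Z2Nat.inj_lt; [lia|lia|].
    assert (2 * Y = X * X) by (unfold Y, X; ring); lia. }
  assert (H2 : (Z.to_nat (X + 1) ^ (2 * R) <= Z.to_nat (X + 1) ^ U)%nat).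
  { apply Nat.pow_le_mono_r; lia. }
  destruct R as [|R'].
  + rewrite Nat.pow_0_r.
    apply Nat.lt_le_trans with (Z.to_nat (X + 1) ^ 1)%nat; [rewrite Nat.pow_1_r; lia|].
    apply Nat.pow_le_mono_r; lia.
  + eapply Nat.lt_le_trans; [|exact H2].
    rewrite Nat.pow_mul_r; apply Nat.pow_lt_mono_l; [lia|].
    rewrite Nat.pow_2_r; exact H1.
- destruct (HV v Hv) as [Lv Bv]; destruct (HV w Hw) as [Lw Bw].
  exists (vsub v w); split; [rewrite length_vsub; lia|].
  split; [apply vsub_neq; [lia|exact Hne]|].
  split; [apply vsub_bound; assumption|].
  intros r Hr; rewrite dot_vsub by lia.
  assert (dot r v = dot r w); [|lia].
  assert (H := proj1 (@map_ext_in_iff _ _ (fun r => dot r v) (fun r => dot r w) rows)).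
  apply H; assumption.
Qed.

Open Scope R_scope.

(** * Baker's method with Kummer descent *)

(** The derivatives of order below [S] of an exponential sum are, up to transcendental constants,
    combinations of these sums, whose terms are algebraic in the application. *)
Definition vanish {A} (P : list A) (p u1 u2 e : A -> R) (S : nat) : Prop :=
  forall s1 s2, (s1 + s2 < S)%nat -> rsum P (fun a => p a * u1 a ^ s1 * u2 a ^ s2 * e a) = 0.

Lemma vanish_comb {A} (P : list A) p u1 u2 e S a b : vanish P p u1 u2 e S ->
  forall j s1 s2, (s1 + s2 + j < S)%nat ->
  rsum P (fun x => p x * u1 x ^ s1 * u2 x ^ s2 * (u1 x * a + u2 x * b) ^ j * e x) = 0.
Proof.
intros H j; induction j as [|j IH]; intros s1 s2 Hs.
- rewrite <- (H s1 s2) by lia; apply rsum_ext; intros x _; simpl; ring.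
- transitivity (a * 0 + b * 0); [|ring].
  rewrite <- (IH (Datatypes.S s1) s2) at 1 by lia; rewrite <- (IH s1 (Datatypes.S s2)) by lia.
  rewrite <- !rsum_scal, <- rsum_plus; apply rsum_ext; intros x _; simpl; ring.
Qed.

(** The affine change of variables is invertible and keeps the total degree. The powers are
    exchanged one variable at a time. *)
Lemma vanish_affine {A} (P : list A) p u1 u2 v1 v2 r1 r2 e S :
  (forall x, In x P -> u1 x = 2 * v1 x + r1) -> (forall x, In x P -> u2 x = 2 * v2 x + r2) ->
  vanish P p u1 u2 e S -> vanish P p v1 v2 e S.
Proof.
intros H1 H2 Hu.
assert (G1 : forall t1 s1 s2, (t1 + s1 + s2 < S)%nat ->
  rsum P (fun x => p x * v1 x ^ t1 * u1 x ^ s1 * u2 x ^ s2 * e x) = 0).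
{ induction t1 as [|t1 IH]; intros s1 s2 Hs.
  - rewrite <- (Hu s1 s2) by lia; apply rsum_ext; intros x _; simpl; ring.
  - transitivity (/ 2 * 0 + - (r1 / 2) * 0); [|ring].
    rewrite <- (IH (Datatypes.S s1) s2) at 1 by lia; rewrite <- (IH s1 s2) by lia.
    rewrite <- !rsum_scal, <- rsum_plus; apply rsum_ext; intros x Hx; simpl.
    rewrite (H1 x Hx) at 2; field. }
assert (G2 : forall t2 t1 s2, (t1 + t2 + s2 < S)%nat ->
  rsum P (fun x => p x * v1 x ^ t1 * v2 x ^ t2 * u2 x ^ s2 * e x) = 0).
{ induction t2 as [|t2 IH]; intros t1 s2 Hs.
  - rewrite <- (G1 t1 0%nat s2) by lia; apply rsum_ext; intros x _; simpl; ring.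
  - transitivity (/ 2 * 0 + - (r2 / 2) * 0); [|ring].
    rewrite <- (IH t1 (Datatypes.S s2)) at 1 by lia; rewrite <- (IH t1 s2) by lia.
    rewrite <- !rsum_scal, <- rsum_plus; apply rsum_ext; intros x Hx; simpl.
    rewrite (H2 x Hx) at 2; field. }
intros t1 t2 Ht; rewrite <- (G2 t2 t1 0%nat) by lia.
apply rsum_ext; intros x _; simpl; ring.
Qed.

Lemma exp_INR_mul x k : exp (INR k * x) = exp x ^ k.
Proof.
induction k as [|k IH]; [simpl; rewrite Rmult_0_l, exp_0; reflexivity|].
rewrite S_INR, Rmult_plus_distr_r, exp_plus, IH, Rmult_1_l; simpl; ring.
Qed.

Lemma sqrt_exp_ln x : 0 < x -> sqrt x = exp (ln x / 2).
Proof.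
intros Hx; apply Rsqr_inj; [apply sqrt_pos|left; apply exp_pos|].
unfold Rsqr; rewrite sqrt_sqrt by lra.
rewrite <- exp_plus; replace (ln x / 2 + ln x / 2) with (ln x) by field.
symmetry; apply exp_ln, Hx.
Qed.

Lemma exp_bound1 : 1.64 < exp (/ 2) /\ 3.00 < exp (11 / 10).
Proof.
assert (H : forall K t, 0 <= t -> texp K t <= exp t) by exact texp_le_exp.
split.
- assert (H1 := H 5%nat (/ 2) ltac:(lra)); unfold texp in H1; simpl in H1; lra.
- assert (H1 := H 8%nat (11 / 10) ltac:(lra)); unfold texp in H1; simpl in H1; lra.
Qed.

Lemma Q0_IZR z : Q0 (IZR z) (Rabs (IZR z)).
Proof. exists (IZR z); split; [apply inO_IZR|lra]. Qed.

Definition b2R (b : bool) : R := if b then 1 else 0.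

Definition tri : Type := (nat * nat * nat)%type.
Definition k1 (q : tri) : nat := fst (fst q).
Definition k2 (q : tri) : nat := snd (fst q).
Definition k3 (q : tri) : nat := snd q.
Definition half (q : tri) : tri := (Nat.div2 (k1 q), Nat.div2 (k2 q), Nat.div2 (k3 q)).

(** For odd [k] the parity of [a * k] is that of [a]: the half-integral part of the exponent is the
    same at all half-odd points. *)
Lemma odd_mul_half a k : Nat.odd k = true ->
  (INR (a * k) / 2 = INR (Nat.div2 (a * k)) + b2R (Nat.odd a) / 2)%R.
Proof.
intros Hk; assert (H := Nat.div2_odd (a * k)); rewrite Nat.odd_mul, Hk, Bool.andb_true_r in H.
rewrite H at 1; rewrite plus_INR, mult_INR; destruct (Nat.odd a); simpl; field.
Qed.

Lemma NoDup_map_filter {A B} (g : A -> B) (b : A -> bool) (l : list A) :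
  NoDup (map g l) -> NoDup (map g (filter b l)).
Proof.
induction l as [|a l IH]; simpl; intros H; [constructor|].
inversion H as [|x y Hx Hl]; subst.
destruct (b a); [|apply IH, Hl]; simpl; constructor; [|apply IH, Hl].
intros Hin; apply Hx; apply in_map_iff in Hin; destruct Hin as (z & Hz & Hz').
apply filter_In in Hz'; apply in_map_iff; exists z; split; [exact Hz|apply Hz'].
Qed.

Lemma div2_lt_pow x r : (x < 2 ^ S r)%nat -> (Nat.div2 x < 2 ^ r)%nat.
Proof.
intros H; assert (E := Nat.div2_odd x); simpl in H; destruct (Nat.odd x); simpl in E; lia.
Qed.

Lemma div2_le_self x : (Nat.div2 x <= x)%nat.
Proof. assert (E := Nat.div2_odd x); lia. Qed.

Fixpoint triangle (S : nat) : list (nat * nat) :=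
  match S with
  | O => []
  | Datatypes.S S' => triangle S' ++ map (fun t => (t, S' - t)%nat) (seq 0 (Datatypes.S S'))
  end.

Lemma length_triangle S : (2 * length (triangle S) = S * (S + 1))%nat.
Proof.
induction S as [|S IH]; [reflexivity|].
change (triangle (Datatypes.S S)) with (triangle S ++ map (fun t => (t, S - t)%nat) (seq 0 (Datatypes.S S))).
rewrite length_app, length_map, length_seq; lia.
Qed.

Lemma in_triangle S s1 s2 : (s1 + s2 < S)%nat -> In (s1, s2) (triangle S).
Proof.
induction S as [|S IH]; intros H; [lia|].
change (triangle (Datatypes.S S)) with (triangle S ++ map (fun t => (t, S - t)%nat) (seq 0 (Datatypes.S S))); apply in_or_app.
destruct (Nat.eq_dec (s1 + s2) S) as [E|E]; [right|left; apply IH; lia].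
apply in_map_iff; exists s1; split; [f_equal; lia|apply in_seq; lia].
Qed.

Lemma triangle_in S s1 s2 : In (s1, s2) (triangle S) -> (s1 + s2 < S)%nat.
Proof.
induction S as [|S IH]; [intros []|].
change (triangle (Datatypes.S S)) with (triangle S ++ map (fun t => (t, S - t)%nat) (seq 0 (Datatypes.S S))).
intros H; apply in_app_or in H; destruct H as [H|H].
- apply IH in H; lia.
- apply in_map_iff in H; destruct H as (t & [= <- <-] & Ht); apply in_seq in Ht; lia.
Qed.

(** Membership in [Q0] only asserts that integer coordinates exist, so choice picks them. The factor
    3 comes from sqrt 5 |y| = |v - v'| <= 2H and |x| <= H + al |y|. *)
Definition coords (v H : R) : Z * Z :=
  epsilon (inhabits (0%Z, 0%Z)) (fun p => v = IZR (fst p) + IZR (snd p) * al /\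
     Rabs (IZR (fst p)) <= 3 * H /\ Rabs (IZR (snd p)) <= 3 * H).

Lemma Rabs_le_inv x a : Rabs x <= a -> - a <= x <= a.
Proof. unfold Rabs; destruct (Rcase_abs x); lra. Qed.

Lemma coords_spec v H : Q0 v H ->
  v = IZR (fst (coords v H)) + IZR (snd (coords v H)) * al /\
  Rabs (IZR (fst (coords v H))) <= 3 * H /\ Rabs (IZR (snd (coords v H))) <= 3 * H.
Proof.
intros (v' & (x & y & Ev & Ev') & Hv & Hv'); unfold coords; apply epsilon_spec.
exists (x, y); simpl; split; [exact Ev|].
assert (A := al_bounds); assert (B := be_bounds).
apply Rabs_le_inv in Hv; apply Rabs_le_inv in Hv'.
assert (Hy : Rabs (IZR y) <= H).
{ assert (E : IZR y * (al - be) = v - v') by (rewrite Ev, Ev'; ring).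
  apply Rabs_le; split; nra. }
split; [|assert (0 <= H) by lra; lra].
apply Rabs_le_inv in Hy; apply Rabs_le; split; nra.
Qed.

Lemma dot_rsum {A} (f : A -> Z) (l : list A) (ps : list Z) : length l = length ps ->
  IZR (dot (map f l) ps) = rsum (combine l ps) (fun a => IZR (snd a) * IZR (f (fst a))).
Proof.
revert ps; induction l as [|x l IH]; intros [|p ps] H; try discriminate H; [reflexivity|].
simpl; rewrite plus_IZR, mult_IZR, IH by (simpl in H; lia); ring.
Qed.

Lemma map_fst_combine {A B} (l : list A) (l' : list B) : length l = length l' ->
  map fst (combine l l') = l.
Proof.
revert l'; induction l as [|x l IH]; intros [|y l'] H; try discriminate H; [reflexivity|].
simpl; rewrite IH by (simpl in H; lia); reflexivity.
Qed.

Lemma in_combine_ex {A B} (l : list A) (l' : list B) y : length l = length l' -> In y l' ->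
  exists x, In (x, y) (combine l l').
Proof.
revert l'; induction l as [|x l IH]; intros [|z l'] H Hy; try discriminate H; [destruct Hy|].
destruct Hy as [<-|Hy]; [exists x; left; reflexivity|].
destruct (IH l' ltac:(simpl in H; lia) Hy) as [x' Hx']; exists x'; right; exact Hx'.
Qed.

Lemma exp_le x y : x <= y -> exp x <= exp y.
Proof. intros [H|H]; [left; apply exp_increasing, H|rewrite H; lra]. Qed.

(** * The auxiliary sum and its descent *)

Section Baker.

Variables (g1 g1' g2 g2' : R) (n m c h T' L J S0 U : nat) (W Pm Om eta : R).
Hypotheses (g1p : 0 < g1) (g2p : 0 < g2).
Hypotheses (Og1 : inO g1 g1') (Og2 : inO g2 g2').
Hypothesis g1h : g1 <= exp (INR h).
Hypothesis g1h' : Rabs g1' <= exp (INR h).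
Hypothesis g2h : g2 <= exp (INR h).
Hypothesis g2h' : Rabs g2' <= exp (INR h).
Hypothesis cpos : (0 < c)%nat.
Hypothesis ns0 : NS Q0 (g1 * g2).
Hypothesis ns1 : NS Q0 (3 * (g1 * g2)).
Hypothesis ns2 : NS Q0 (al * (g1 * g2)).
Hypothesis ns3 : NS Q0 (al * (3 * (g1 * g2))).

Definition la : R := ln al.
Definition l3 : R := ln 3.
Let lg : R := ln g1 - ln g2.
Let T : nat := (2 * T')%nat.
Let H1 : nat := (h * T)%nat.

Definition om (q : tri) : R := INR (k1 q) * la + INR (k2 q) * l3 + INR (k3 q) * lg.
Definition w1 (q : tri) : R :=
  IZR (Z.of_nat c * Z.of_nat (k1 q) + Z.of_nat n * Z.of_nat (k3 q)).
Definition w2 (q : tri) : R :=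
  IZR (Z.of_nat c * Z.of_nat (k2 q) - Z.of_nat m * Z.of_nat (k3 q)).
(* [om' q - om q] is a multiple of the linear form, so it is tiny if the form is; the
   derivatives of [exp (om' q * z)] are polynomials in [w1 q] and [w2 q] with common
   transcendental coefficients. *)
Definition om' (q : tri) : R := w1 q * (la / INR c) + w2 q * (l3 / INR c).

(** Each side of the box is inverse to the height of its base: bounded height for [al] and 3, about
    [h] for the third number. *)
Definition inbox (q : tri) : Prop := (k1 q < H1)%nat /\ (k2 q < H1)%nat /\ (k3 q < T)%nat.

Hypothesis W1 : 1 <= W.
Hypothesis w1W : forall q, inbox q -> Rabs (w1 q) <= W.
Hypothesis w2W : forall q, inbox q -> Rabs (w2 q) <= W.
Hypothesis Om1 : 1 <= Om.
Hypothesis omOm : forall q, inbox q -> Rabs (om' q) <= Om.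
Hypothesis eta0 : 0 <= eta.
Hypothesis om_eta : forall q z, inbox q -> 0 <= z <= 2 * INR L ->
  Rabs (exp (om' q * z) - exp (om q * z)) <= eta.
Hypothesis Pm1 : 1 <= Pm.
Hypothesis L1 : (0 < L)%nat.

Let c12 : R := g1 * g2.
(** [D1], [D2], [D3] bound the conjugates of the three square roots, through e^(1/2) > al and
    e^(11/10) > 3. As exponentials they make all house estimates additive. *)
Let D1 : R := exp (/ 4).
Let D2 : R := exp (11 / 20).
Let D3 : R := exp (INR h).

Let al_pos : 0 < al.
Proof. assert (H := al_bounds); lra. Qed.

Lemma D1_al : al <= D1 * D1.
Proof.
unfold D1; rewrite <- exp_plus; replace (/ 4 + / 4) with (/ 2) by field.
assert (H := exp_bound1); assert (H' := al_bounds); lra.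
Qed.

Lemma D2_3 : 3 <= D2 * D2.
Proof.
unfold D2; rewrite <- exp_plus; replace (11 / 20 + 11 / 20) with (11 / 10) by field.
assert (H := exp_bound1); lra.
Qed.

Let Hc12 : 0 <= c12.
Proof. unfold c12; apply Rmult_le_pos; lra. Qed.

Let Oc12 : inO c12 (g1' * g2').
Proof. apply inO_mul; assumption. Qed.

Let Hc12D : Rabs c12 <= D3 * D3.
Proof.
unfold c12, D3; rewrite Rabs_mult, !Rabs_right by lra.
apply Rmult_le_compat; lra.
Qed.

Let Hc12D' : Rabs (g1' * g2') <= D3 * D3.
Proof.
rewrite Rabs_mult; apply Rmult_le_compat; try apply Rabs_pos; assumption.
Qed.

Let D1p : 0 <= D1. Proof. left; apply exp_pos. Qed.
Let D2p : 0 <= D2. Proof. left; apply exp_pos. Qed.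
Let D3p : 0 <= D3. Proof. left; apply exp_pos. Qed.

Let QQ := Q3 c12 D1 D2 D3.

Let QQ_house : house QQ.
Proof. exact (Q3_house c12 _ D1 D2 D3 Hc12 Oc12 D1p D2p D3p D1_al D2_3 Hc12D Hc12D'). Qed.

Let QQ_liouville : liouville QQ 15.
Proof.
exact (Q3_liouville c12 _ D1 D2 D3 Hc12 Oc12 D1p D2p D3p D1_al D2_3 Hc12D Hc12D' ns0 ns1 ns2 ns3).
Qed.

(* [g2 ^ (T' k) exp (om q * k / 2)] is [xx k q] times square roots of [al], [3]
   and [g1 g2] determined by the parities of [q]. *)
Definition xx (k : nat) (q : tri) : R :=
  al ^ Nat.div2 (k1 q * k) * 3 ^ Nat.div2 (k2 q * k) *
  (g1 ^ Nat.div2 (k3 q * k) *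
   g2 ^ (T' * k - Nat.div2 (k3 q * k) - (if Nat.odd (k3 q) then 1 else 0))).

Definition hxx (k : nat) (q : tri) : R :=
  exp (/ 2) ^ Nat.div2 (k1 q * k) * exp (11 / 10) ^ Nat.div2 (k2 q * k) *
  (exp (INR h) ^ Nat.div2 (k3 q * k) *
   exp (INR h) ^ (T' * k - Nat.div2 (k3 q * k) - (if Nat.odd (k3 q) then 1 else 0))).

Definition par (q : tri) : R :=
  rt (sqrt al) (Nat.odd (k1 q)) * rt (sqrt 3) (Nat.odd (k2 q)) * rt (sqrt c12) (Nat.odd (k3 q)).

(** Keeps the truncated subtractions in [xx] exact: [k3 q < 2 * T'] leaves just enough room for the
    extra factor spent when [k3 q] is odd. *)
Lemma k3_half k q : inbox q -> (0 < k)%nat -> Nat.odd k = true ->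
  (Nat.div2 (k3 q * k) + (if Nat.odd (k3 q) then 1 else 0) <= T' * k)%nat.
Proof.
intros (_ & _ & H3) Hk Hodd.
assert (E := Nat.div2_odd (k3 q * k)); rewrite Nat.odd_mul, Hodd, Bool.andb_true_r in E.
unfold T in H3.
assert (k3 q * k <= (2 * T' - 1) * k)%nat by (apply Nat.mul_le_mono_r; lia).
destruct (Nat.odd (k3 q)); simpl Nat.b2n in E; nia.
Qed.

(** Since sqrt(g1/g2) = sqrt(g1 g2) / g2, an odd [k3 q] costs one more factor [g2], and only the
    root of the product enters the field. *)
Lemma xx_spec k q : inbox q -> (0 < k)%nat -> Nat.odd k = true ->
  g2 ^ (T' * k) * exp (om q * (INR k / 2)) = xx k q * par q.
Proof.
intros Hq Hk Hodd; assert (H3 := k3_half k q Hq Hk Hodd).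
unfold xx, par.
assert (E : forall x s, s = sqrt x -> 0 < x -> forall a, rt s (Nat.odd a) * x ^ Nat.div2 (a * k) =
   exp (INR a * ln x * (INR k / 2))).
{ intros x s -> Hx a.
  replace (INR a * ln x * (INR k / 2)) with (INR (a * k) / 2 * ln x) by (rewrite mult_INR; field).
  rewrite (odd_mul_half a k Hodd), Rmult_plus_distr_r, exp_plus, exp_INR_mul, exp_ln by exact Hx.
  rewrite Rmult_comm; f_equal.
  destruct (Nat.odd a); simpl.
  - rewrite sqrt_exp_ln by exact Hx; f_equal; field.
  - replace (0 / 2 * ln x) with 0 by field; symmetry; apply exp_0. }
assert (E1 := E al _ eq_refl al_pos (k1 q)); assert (E2 := E 3 _ eq_refl ltac:(lra) (k2 q)).
assert (E3 : g2 ^ (T' * k) * exp (INR (k3 q) * lg * (INR k / 2)) =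
   rt (sqrt c12) (Nat.odd (k3 q)) * (g1 ^ Nat.div2 (k3 q * k) *
   g2 ^ (T' * k - Nat.div2 (k3 q * k) - (if Nat.odd (k3 q) then 1 else 0)))).
{ unfold lg.
  replace (INR (k3 q) * (ln g1 - ln g2) * (INR k / 2)) with
    (INR (k3 q * k) / 2 * ln g1 + - (INR (k3 q * k) / 2) * ln g2) by (rewrite mult_INR; field).
  rewrite (odd_mul_half (k3 q) k Hodd).
  set (f := Nat.div2 (k3 q * k)) in *.
  assert (P : forall g k', 0 < g -> g ^ k' = exp (INR k' * ln g)).
  { intros g k' Hg; rewrite exp_INR_mul, exp_ln by exact Hg; reflexivity. }
  rewrite !P by assumption.
  assert (Hs : rt (sqrt c12) (Nat.odd (k3 q)) = exp (b2R (Nat.odd (k3 q)) / 2 * (ln g1 + ln g2))).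
  { destruct (Nat.odd (k3 q)); simpl.
    - unfold c12; rewrite sqrt_exp_ln by (apply Rmult_lt_0_compat; assumption).
      rewrite ln_mult by assumption; f_equal; field.
    - rewrite <- exp_0; f_equal; field. }
  rewrite Hs, <- !exp_plus; f_equal.
  rewrite !minus_INR by lia.
  destruct (Nat.odd (k3 q)); simpl; field. }
unfold om.
replace ((INR (k1 q) * la + INR (k2 q) * l3 + INR (k3 q) * lg) * (INR k / 2)) with
  (INR (k1 q) * ln al * (INR k / 2) + INR (k2 q) * ln 3 * (INR k / 2) + INR (k3 q) * lg * (INR k / 2))
  by (unfold la, l3; ring).
rewrite !exp_plus, <- E1, <- E2.
match goal with |- ?a * (?b * ?d) = _ => transitivity (b * (a * d)); [ring|] end.
rewrite E3; ring.
Qed.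

Lemma xx_Q0 k q : Q0 (xx k q) (hxx k q).
Proof.
assert (HQ := Q0_house).
assert (P : forall v H k', Q0 v H -> Q0 (v ^ k') (H ^ k')).
{ intros v H k' Hv; apply house_pow; [exact HQ|exact Q0_one|exact Hv]. }
assert (B := al_bounds); assert (B' := be_bounds); assert (B1 := exp_bound1).
unfold xx, hxx; repeat apply (house_mul Q0 HQ); apply P.
- exists be; split; [exact inO_al|]; rewrite Rabs_right, Rabs_left by lra; lra.
- exists 3; split; [apply (inO_IZR 3)|]; rewrite Rabs_right by lra; lra.
- exists g1'; split; [exact Og1|]; rewrite Rabs_right by lra; split; assumption.
- exists g2'; split; [exact Og2|]; rewrite Rabs_right by lra; split; assumption.
Qed.

(** As k <= 2L, the powers of [al], of 3 and of the third number contribute at most 1/2, 11/10 and 1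
    times [H1 * L] to the exponent. *)
Lemma hxx_le k q : inbox q -> (0 < k)%nat -> Nat.odd k = true -> (k <= 2 * L)%nat ->
  hxx k q * rt D1 (Nat.odd (k1 q)) * rt D2 (Nat.odd (k2 q)) * rt D3 (Nat.odd (k3 q)) <=
  exp (3 * INR H1 * INR L).
Proof.
intros Hq Hk Hodd HkL; assert (H3 := k3_half k q Hq Hk Hodd).
destruct Hq as (Hq1 & Hq2 & Hq3).
unfold hxx; rewrite <- !exp_INR_mul.
assert (R1 : forall x b, rt (exp x) b = exp (b2R b * x)).
{ intros x [|]; simpl; [f_equal; ring|rewrite Rmult_0_l, exp_0; reflexivity]. }
unfold D1, D2, D3; rewrite !R1, <- !exp_plus.
assert (F1 := odd_mul_half (k1 q) k Hodd); assert (F2 := odd_mul_half (k2 q) k Hodd).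
rewrite !minus_INR by lia.
set (f := INR (Nat.div2 (k3 q * k))).
assert (Hb : INR (if Nat.odd (k3 q) then 1 else 0) = b2R (Nat.odd (k3 q))) by (destruct (Nat.odd (k3 q)); reflexivity).
rewrite Hb.
match goal with |- exp ?x <= _ => replace x with
  (INR (k1 q * k) / 2 / 2 + INR (k2 q * k) / 2 * (11 / 10) + INR (T' * k) * INR h) end.
2:{ rewrite F1, F2; unfold f; field. }
assert (Hexp : forall x y, x <= y -> exp x <= exp y).
{ intros x y [H|H]; [left; apply exp_increasing, H|rewrite H; lra]. }
apply Hexp.
assert (A1 : INR (k1 q * k) <= 2 * (INR H1 * INR L)).
{ replace (2 * (INR H1 * INR L)) with (INR (H1 * (2 * L))) by (rewrite !mult_INR; simpl; ring).
  apply le_INR, Nat.mul_le_mono; lia. }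
assert (A2 : INR (k2 q * k) <= 2 * (INR H1 * INR L)).
{ replace (2 * (INR H1 * INR L)) with (INR (H1 * (2 * L))) by (rewrite !mult_INR; simpl; ring).
  apply le_INR, Nat.mul_le_mono; lia. }
assert (A3 : INR (T' * k) * INR h <= INR H1 * INR L).
{ rewrite <- !mult_INR; apply le_INR; unfold H1, T.
  replace (T' * k * h)%nat with (h * T' * k)%nat by ring.
  replace (h * (2 * T') * L)%nat with (h * T' * (2 * L))%nat by ring.
  apply Nat.mul_le_mono_l, HkL. }
assert (0 <= INR H1 * INR L) by (apply Rmult_le_pos; apply pos_INR).
lra.
Qed.

(** The invariant of the descent. Distinct exponents and one nonzero coefficient keep the sum
    nontrivial; [r] counts the binary digits left in the exponents, [S] the order of vanishing left
    at the odd integers. *)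
Definition state (r S : nat) (P : list (tri * Z)) : Prop :=
  NoDup (map fst P) /\ (exists a, In a P /\ snd a <> 0%Z) /\
  (forall a, In a P -> Rabs (IZR (snd a)) <= Pm /\ inbox (fst a) /\
     (k1 (fst a) < 2 ^ r)%nat /\ (k2 (fst a) < 2 ^ r)%nat /\ (k3 (fst a) < 2 ^ r)%nat) /\
  (length P <= U)%nat /\
  (forall i, (i < L)%nat ->
     vanish P (fun a => IZR (snd a)) (fun a => w1 (fst a)) (fun a => w2 (fst a))
       (fun a => exp (om (fst a) * INR (2 * i + 1))) S).

Let Z0 : R := 2 * INR L.
Let A0 : R := INR U * (Pm * W ^ S0).
Let M : nat := (J * L)%nat.
Let rhs : R := INR M * (2 * Z0) ^ M * (A0 * Om ^ J * eta) +
  Z0 ^ M * (A0 * (Om ^ M / INR (fact M)) * exp (Om * Z0)).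

(** The numerical heart: the power of [g2] that clears denominators, times the size at half-odd
    points, times the house to the Liouville exponent, is below 1. *)
Hypothesis key : exp (INR H1 * INR L) * (rhs + A0 * eta) * (A0 * exp (3 * INR H1 * INR L)) ^ 15 < 1.

Lemma coef_sum (P : list (tri * Z)) s1 s2 : (length P <= U)%nat -> (s1 + s2 <= S0)%nat ->
  (forall a, In a P -> Rabs (IZR (snd a)) <= Pm /\ inbox (fst a)) ->
  rsum P (fun a => Rabs (IZR (snd a) * w1 (fst a) ^ s1 * w2 (fst a) ^ s2)) <= A0.
Proof.
intros HP Hs Ha.
apply Rle_trans with (rsum P (fun _ => Pm * W ^ S0)).
- apply rsum_le; intros a Hin; destruct (Ha a Hin) as [H Hb].
  rewrite !Rabs_mult, <- !RPow_abs, Rmult_assoc.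
  apply Rmult_le_compat; [apply Rabs_pos| |exact H|].
  + apply Rmult_le_pos; apply pow_le, Rabs_pos.
  + apply Rle_trans with (W ^ s1 * W ^ s2).
    * apply Rmult_le_compat; try (apply pow_le, Rabs_pos).
      -- apply pow_incr; split; [apply Rabs_pos|apply w1W, Hb].
      -- apply pow_incr; split; [apply Rabs_pos|apply w2W, Hb].
    * rewrite <- pow_add; apply Rle_pow; [exact W1|exact Hs].
- rewrite rsum_const; unfold A0; apply Rmult_le_compat_r.
  + apply Rmult_le_pos; [lra|apply pow_le; lra].
  + apply le_INR, HP.
Qed.

Lemma A0_pos : 0 <= A0.
Proof.
unfold A0; apply Rmult_le_pos; [apply pos_INR|apply Rmult_le_pos; [lra|apply pow_le; lra]].
Qed.

Definition yy (k : nat) (q : tri) : R :=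
  al ^ (k1 q * k) * 3 ^ (k2 q * k) * (g1 ^ (k3 q * k) * g2 ^ ((T - k3 q) * k)).

Definition hyy (k : nat) (q : tri) : R :=
  exp (/ 2) ^ (k1 q * k) * exp (11 / 10) ^ (k2 q * k) *
  (exp (INR h) ^ (k3 q * k) * exp (INR h) ^ ((T - k3 q) * k)).

Lemma yy_Q0 k q : Q0 (yy k q) (hyy k q).
Proof.
assert (HQ := Q0_house).
assert (P : forall v H k', Q0 v H -> Q0 (v ^ k') (H ^ k')).
{ intros v H k' Hv; apply house_pow; [exact HQ|exact Q0_one|exact Hv]. }
assert (B := al_bounds); assert (B' := be_bounds); assert (B1 := exp_bound1).
unfold yy, hyy; repeat apply (house_mul Q0 HQ); apply P.
- exists be; split; [exact inO_al|]; rewrite Rabs_right, Rabs_left by lra; lra.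
- exists 3; split; [apply (inO_IZR 3)|]; rewrite Rabs_right by lra; lra.
- exists g1'; split; [exact Og1|]; rewrite Rabs_right by lra; split; assumption.
- exists g2'; split; [exact Og2|]; rewrite Rabs_right by lra; split; assumption.
Qed.

Lemma yy_spec k q : inbox q -> yy k q = g2 ^ (T * k) * exp (om q * INR k).
Proof.
intros (_ & _ & Hq).
assert (P : forall g k', 0 < g -> g ^ k' = exp (INR k' * ln g)).
{ intros g k' Hg; rewrite exp_INR_mul, exp_ln by exact Hg; reflexivity. }
unfold yy; rewrite !P by (assumption || lra).
rewrite <- !exp_plus; f_equal; unfold om, la, l3, lg.
rewrite !mult_INR, minus_INR by lia; ring.
Qed.

Lemma hyy_le k q : inbox q -> (k <= 2 * L)%nat -> hyy k q <= exp (6 * INR H1 * INR L).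
Proof.
intros (Hq1 & Hq2 & Hq3) HkL; unfold hyy; rewrite <- !exp_INR_mul, <- !exp_plus; apply exp_le.
rewrite !mult_INR, minus_INR by lia.
assert (A1 : INR (k1 q) * INR k <= 2 * (INR H1 * INR L)).
{ replace (2 * (INR H1 * INR L)) with (INR (H1 * (2 * L))) by (rewrite !mult_INR; simpl; ring).
  rewrite <- mult_INR; apply le_INR, Nat.mul_le_mono; lia. }
assert (A2 : INR (k2 q) * INR k <= 2 * (INR H1 * INR L)).
{ replace (2 * (INR H1 * INR L)) with (INR (H1 * (2 * L))) by (rewrite !mult_INR; simpl; ring).
  rewrite <- mult_INR; apply le_INR, Nat.mul_le_mono; lia. }
assert (A3 : INR T * INR k * INR h <= 2 * (INR H1 * INR L)).
{ replace (2 * (INR H1 * INR L)) with (INR (H1 * (2 * L))) by (rewrite !mult_INR; simpl; ring).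
  rewrite <- !mult_INR; apply le_INR; unfold H1.
  replace (T * k * h)%nat with (h * T * k)%nat by ring; apply Nat.mul_le_mono_l, HkL. }
assert (0 <= INR H1 * INR L) by (apply Rmult_le_pos; apply pos_INR).
lra.
Qed.

(** At odd integers no square roots occur, and [g2 ^ (T * k)] clears the denominators. Each
    condition is then an equation over Z[al], that is two integer equations by [coords], and
    [siegel] applies; [Pm] absorbs its bound 2UB, where B <= 4E. *)
Lemma initial_state r : U = (H1 * H1 * T)%nat -> (0 < U)%nat ->
  (2 * (L * (S0 * (S0 + 1))) <= U)%nat -> (H1 <= 2 ^ r)%nat -> (T <= 2 ^ r)%nat ->
  8 * INR U * (W ^ S0 * exp (6 * INR H1 * INR L)) <= Pm ->
  exists P, state r S0 P.
Proof.
intros HU HU0 HUS Hr1 Hr2 HPm.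
set (I := list_prod (list_prod (seq 0 H1) (seq 0 H1)) (seq 0 T)).
assert (HI : forall q, In q I -> inbox q).
{ intros [[x1 x2] x3] Hq; apply in_prod_iff in Hq; destruct Hq as [Hq Hq3].
  apply in_prod_iff in Hq; destruct Hq as [Hq1 Hq2]; rewrite in_seq in *.
  unfold inbox, k1, k2, k3; simpl; lia. }
assert (HIl : length I = U).
{ unfold I; rewrite !length_prod, !length_seq; lia. }
assert (HIn : NoDup I) by (repeat apply NoDup_list_prod_full; apply seq_NoDup).
set (E := W ^ S0 * exp (6 * INR H1 * INR L)).
assert (HE1 : 1 <= E).
{ unfold E; rewrite <- (Rmult_1_l 1); apply Rmult_le_compat; try lra.
  - apply pow_R1_Rle, W1.
  - rewrite <- exp_0; apply exp_le; repeat apply Rmult_le_pos; try apply pos_INR; lra. }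
set (B := up (3 * E)).
assert (HB : 3 * E <= IZR B <= 4 * E) by (unfold B; destruct (archimed (3 * E)); lra).
set (vv := fun (ks : nat * (nat * nat)) q =>
  w1 q ^ fst (snd ks) * w2 q ^ snd (snd ks) * yy (2 * fst ks + 1) q).
set (eqs := list_prod (seq 0 L) (triangle S0)).
assert (Hvv : forall ks q, In ks eqs -> In q I -> Q0 (vv ks q) E).
{ intros [i [s1 s2]] q Hks Hq; apply in_prod_iff in Hks; destruct Hks as [Hi Hs].
  apply in_seq in Hi; apply triangle_in in Hs; assert (Hb := HI q Hq).
  assert (HQ0 := Q0_house); unfold vv; simpl fst; simpl snd.
  apply (house_mono Q0 HQ0) with (W ^ s1 * W ^ s2 * hyy (2 * i + 1) q).
  - apply (house_mul Q0 HQ0); [|apply yy_Q0]; apply (house_mul Q0 HQ0);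
    (apply house_pow; [exact HQ0|exact Q0_one|]).
    + apply (house_mono Q0 HQ0) with (1 := Q0_IZR _) (2 := w1W _ Hb).
    + apply (house_mono Q0 HQ0) with (1 := Q0_IZR _) (2 := w2W _ Hb).
  - rewrite <- pow_add; unfold E; apply Rmult_le_compat.
    + apply pow_le; lra.
    + eapply house_pos; [exact HQ0|apply yy_Q0].
    + apply Rle_pow; [exact W1|lia].
    + apply hyy_le; [exact Hb|lia]. }
set (rows := map (fun ks => map (fun q => fst (coords (vv ks q) E)) I) eqs ++
             map (fun ks => map (fun q => snd (coords (vv ks q) E)) I) eqs).
destruct (siegel rows U B) as (ps & Hps & (p0 & Hp0 & Hp0') & Hbd & Hdot).
- assert (1 < B)%Z by (apply lt_IZR; simpl; lra); lia.
- exact HU0.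
- unfold rows; rewrite length_app, !length_map; unfold eqs; rewrite length_prod, length_seq.
  assert (Ht := length_triangle S0); nia.
- intros r0 Hr0 a Ha; apply le_IZR; rewrite abs_IZR.
  unfold rows in Hr0; apply in_app_or in Hr0; rewrite !in_map_iff in Hr0.
  destruct Hr0 as [(ks & <- & Hks)|(ks & <- & Hks)];
  apply in_map_iff in Ha; destruct Ha as (q & <- & Hq);
  destruct (coords_spec _ _ (Hvv ks q Hks Hq)) as (_ & C1 & C2); lra.
- assert (Hl : length I = length ps) by lia.
  exists (combine I ps); split; [rewrite map_fst_combine by exact Hl; exact HIn|].
  split.
  { destruct (in_combine_ex I ps p0 Hl Hp0) as [q Hq]; exists (q, p0); split; assumption. }
  split.
  { intros [q p] Hqp; simpl.
    assert (Hq := HI q (in_combine_l _ _ _ _ Hqp)); assert (Hp := in_combine_r _ _ _ _ Hqp).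
    split; [|split; [exact Hq|unfold inbox in Hq; lia]].
    apply Hbd, IZR_le in Hp; rewrite abs_IZR, !mult_IZR, <- INR_IZR_INZ in Hp.
    eapply Rle_trans; [exact Hp|]; eapply Rle_trans; [|exact HPm].
    assert (0 <= INR U) by apply pos_INR.
    replace (8 * INR U * (W ^ S0 * exp (6 * INR H1 * INR L))) with (2 * INR U * (4 * E)) by (unfold E; ring).
    apply Rmult_le_compat_l; lra. }
  split; [rewrite length_combine; lia|].
  intros i Hi s1 s2 Hs.
  set (ks := (i, (s1, s2))).
  assert (Hks : In ks eqs).
  { apply in_prod_iff; split; [apply in_seq; lia|apply in_triangle, Hs]. }
  assert (D1' := Hdot (map (fun q => fst (coords (vv ks q) E)) I)
    ltac:(unfold rows; apply in_or_app; left; apply in_map_iff; exists ks; auto)).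
  assert (D2' := Hdot (map (fun q => snd (coords (vv ks q) E)) I)
    ltac:(unfold rows; apply in_or_app; right; apply in_map_iff; exists ks; auto)).
  apply (f_equal IZR) in D1'; apply (f_equal IZR) in D2'.
  rewrite dot_rsum in D1', D2' by exact Hl.
  set (C := g2 ^ (T * (2 * i + 1))).
  assert (HC : C <> 0) by (apply Rgt_not_eq, pow_lt, g2p).
  apply (Rmult_eq_reg_l C); [|exact HC].
  transitivity (0 + al * 0); [|ring].
  rewrite <- D1' at 1; rewrite <- D2'.
  rewrite <- !rsum_scal, <- rsum_plus; apply rsum_ext; intros [q p] Hqp; simpl fst; simpl snd.
  assert (Hq := in_combine_l _ _ _ _ Hqp).
  destruct (coords_spec _ _ (Hvv ks q Hks Hq)) as (Ec & _ & _).
  transitivity (IZR p * vv ks q).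
  + unfold vv, ks; simpl fst; simpl snd; rewrite (yy_spec _ q (HI q Hq)); unfold C; ring.
  + rewrite Ec at 1; ring.
Qed.

(** Of the order of vanishing, [s1 + s2] is kept for the conclusion and [J] is spent on
    interpolation. The sums vanish for the true frequencies [om], while the derivatives are those of
    [om']; passing between the two costs [eta]. *)
Lemma small_half r S P : (J <= S)%nat -> (S <= S0)%nat -> state r S P ->
  forall i s1 s2, (i < L)%nat -> (s1 + s2 + J <= S)%nat ->
  Rabs (rsum P (fun a => IZR (snd a) * w1 (fst a) ^ s1 * w2 (fst a) ^ s2 *
          exp (om (fst a) * (INR (2 * i + 1) / 2)))) <= rhs + A0 * eta.
Proof.
intros HJ HS (_ & _ & Hbox & Hlen & Hv) i s1 s2 Hi Hs.
set (cf := fun a : tri * Z => IZR (snd a) * w1 (fst a) ^ s1 * w2 (fst a) ^ s2).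
set (z := INR (2 * i + 1) / 2).
assert (Hbox' : forall a, In a P -> Rabs (IZR (snd a)) <= Pm /\ inbox (fst a)).
{ intros a Ha; destruct (Hbox a Ha) as (B1 & B2 & _); split; assumption. }
assert (HA := coef_sum P s1 s2 Hlen ltac:(lia) Hbox').
fold cf in HA.
assert (Hodd : forall i', INR (2 * i' + 1) = 2 * INR i' + 1).
{ intros i'; rewrite plus_INR, mult_INR; simpl; ring. }
assert (HLi : forall i', (i' < L)%nat -> INR i' + 1 <= INR L).
{ intros i' Hi'; rewrite <- S_INR; apply le_INR; lia. }
assert (Hi0 : forall i', 0 <= INR i') by (intros; apply pos_INR).
assert (Hz : 0 <= z <= Z0).
{ unfold z, Z0; rewrite Hodd; specialize (HLi i Hi); specialize (Hi0 i); lra. }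
assert (HZ0 : 1 <= Z0).
{ unfold Z0; specialize (HLi i Hi); specialize (Hi0 i); lra. }
assert (Herr : forall t f, 0 <= t <= Z0 -> (forall a, In a P -> Rabs (f a) <= Om ^ J) ->
  Rabs (rsum P (fun a => cf a * f a * (exp (om' (fst a) * t) - exp (om (fst a) * t))))
  <= A0 * Om ^ J * eta).
{ intros t f Ht Hf; eapply Rle_trans; [apply rsum_abs|].
  apply Rle_trans with (rsum P (fun a => (Om ^ J * eta) * Rabs (cf a))).
  - apply rsum_le; intros a Ha; rewrite !Rabs_mult.
    assert (E := om_eta (fst a) t (proj2 (Hbox' a Ha)) Ht).
    specialize (Hf a Ha).
    rewrite Rmult_assoc, Rmult_comm; apply Rmult_le_compat_r; [apply Rabs_pos|].
    apply Rmult_le_compat; try apply Rabs_pos; assumption.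
  - rewrite rsum_scal; replace (A0 * Om ^ J * eta) with (Om ^ J * eta * A0) by ring.
    apply Rmult_le_compat_l; [|exact HA].
    apply Rmult_le_pos; [apply pow_le; lra|exact eta0]. }
assert (HOJ : forall j, (j <= J)%nat -> Om ^ j <= Om ^ J) by (intros; apply Rle_pow; assumption).
assert (HX := extrapolation P cf (fun a => om' (fst a)) Om
  (fun a Ha => omOm (fst a) (proj2 (Hbox' a Ha))) ltac:(lra)
  (fun i => INR (2 * i + 1)) L J (A0 * Om ^ J * eta) Z0 z).
assert (HX' : Rabs (rsum P (fun a => cf a * exp (om' (fst a) * z))) <= rhs).
{ eapply Rle_trans; [apply HX|].
  - intros i1 i2 Hne; rewrite !Hodd.
    replace (2 * INR i1 + 1 - (2 * INR i2 + 1)) with (2 * (INR i1 - INR i2)) by ring.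
    rewrite !INR_IZR_INZ, <- minus_IZR, <- mult_IZR, <- abs_IZR; apply IZR_le; lia.
  - intros i' Hi'; rewrite Hodd; unfold z; rewrite Hodd.
    assert (B1 := HLi i Hi); assert (B2 := HLi i' Hi'); assert (B3 := Hi0 i); assert (B4 := Hi0 i').
    unfold Z0; apply Rabs_le; lra.
  - intros i' Hi'; rewrite Hodd.
    assert (B2 := HLi i' Hi'); assert (B4 := Hi0 i'); rewrite Rabs_right by lra; unfold Z0; lra.
  - rewrite Rabs_right by lra; lra.
  - exact HZ0.
  - apply Rmult_le_pos; [|exact eta0]; apply Rmult_le_pos; [apply A0_pos|apply pow_le; lra].
  - intros i' j Hi' Hj.
    assert (Hj0 := vanish_comb _ _ _ _ _ _ (la / INR c) (l3 / INR c) (Hv i' Hi') j s1 s2 ltac:(lia)).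
    set (t := INR (2 * i' + 1)) in *.
    replace (rsum P (fun x => cf x * om' (fst x) ^ j * exp (om' (fst x) * t))) with
      (rsum P (fun a => cf a * om' (fst a) ^ j * (exp (om' (fst a) * t) - exp (om (fst a) * t)))).
    + apply Herr.
      * unfold t, Z0; rewrite Hodd; assert (B2 := HLi i' Hi'); assert (B4 := Hi0 i'); lra.
      * intros a Ha; rewrite <- RPow_abs; apply Rle_trans with (Om ^ j); [|apply HOJ; lia].
        apply pow_incr; split; [apply Rabs_pos|apply omOm, (Hbox' a Ha)].
    + rewrite <- (Rminus_0_r (rsum P (fun y => cf y * om' (fst y) ^ j * exp (om' (fst y) * t)))), <- Hj0.
      rewrite <- rsum_minus; apply rsum_ext; intros a _; unfold cf, om'; ring.
  - fold M; unfold rhs; apply Rplus_le_compat_l.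
    assert (HM : 0 < INR (fact M)) by apply INR_fact_lt_0.
    apply Rmult_le_compat_l; [apply pow_le; lra|].
    apply Rmult_le_compat_r; [left; apply exp_pos|].
    apply Rmult_le_compat_r; [|exact HA].
    apply Rmult_le_pos; [apply pow_le; lra|left; apply Rinv_0_lt_compat, HM]. }
change (Rabs (rsum P (fun a => cf a * exp (om (fst a) * z))) <= rhs + A0 * eta).
replace (rsum P (fun a => cf a * exp (om (fst a) * z))) with
  (rsum P (fun a => cf a * exp (om' (fst a) * z)) -
   rsum P (fun a => cf a * (exp (om' (fst a) * z) - exp (om (fst a) * z)))).
2:{ rewrite <- rsum_minus; apply rsum_ext; intros a _; ring. }
unfold Rminus at 1; eapply Rle_trans; [apply Rabs_triang|]; rewrite Rabs_Ropp.
apply Rplus_le_compat; [exact HX'|].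
eapply Rle_trans; [apply rsum_abs|].
apply Rle_trans with (rsum P (fun a => eta * Rabs (cf a))).
- apply rsum_le; intros a Ha; rewrite Rabs_mult, Rmult_comm.
  apply Rmult_le_compat_r; [apply Rabs_pos|apply om_eta; [apply (Hbox' a Ha)|exact Hz]].
- rewrite rsum_scal, Rmult_comm; apply Rmult_le_compat_r; [exact eta0|exact HA].
Qed.

(** After clearing denominators the value is an integer of the tower whose house is at most
    [A0 * exp (3 * H1 * L)]; by [key] it is too small to be nonzero. *)
Lemma zero_half r S P : (J <= S)%nat -> (S <= S0)%nat -> state r S P ->
  forall i s1 s2, (i < L)%nat -> (s1 + s2 + J <= S)%nat ->
  rsum P (fun a => IZR (snd a) * w1 (fst a) ^ s1 * w2 (fst a) ^ s2 *
     xx (2 * i + 1) (fst a) * par (fst a)) = 0.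
Proof.
intros HJ HS Hst i s1 s2 Hi Hs.
assert (Hsm := small_half r S P HJ HS Hst i s1 s2 Hi Hs).
destruct Hst as (_ & _ & Hbox & Hlen & _).
set (k := (2 * i + 1)%nat) in *.
assert (Hk : (0 < k)%nat) by (unfold k; lia).
assert (Hodd : Nat.odd k = true) by (unfold k; apply Nat.odd_spec; exists i; reflexivity).
assert (HkL : (k <= 2 * L)%nat) by (unfold k; lia).
assert (HV : rsum P (fun a => IZR (snd a) * w1 (fst a) ^ s1 * w2 (fst a) ^ s2 *
     xx k (fst a) * par (fst a)) =
  g2 ^ (T' * k) * rsum P (fun a => IZR (snd a) * w1 (fst a) ^ s1 * w2 (fst a) ^ s2 *
          exp (om (fst a) * (INR k / 2)))).
{ rewrite <- rsum_scal; apply rsum_ext; intros a Ha.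
  destruct (Hbox a Ha) as (_ & Hb & _).
  rewrite Rmult_assoc, <- (xx_spec k (fst a) Hb Hk Hodd); ring. }
set (V := rsum P (fun a => IZR (snd a) * w1 (fst a) ^ s1 * w2 (fst a) ^ s2 * xx k (fst a) * par (fst a))) in *.
assert (HQ0 := Q0_house).
assert (Hterm : forall a, In a P -> Q0 (IZR (snd a) * w1 (fst a) ^ s1 * w2 (fst a) ^ s2 * xx k (fst a))
   (Pm * W ^ S0 * hxx k (fst a))).
{ intros a Ha; destruct (Hbox a Ha) as (Hp & Hb & _).
  apply (house_mul Q0 HQ0); [|apply xx_Q0].
  apply (house_mono Q0 HQ0) with (Pm * W ^ s1 * W ^ s2).
  - apply (house_mul Q0 HQ0); [apply (house_mul Q0 HQ0)|].
    + apply (house_mono Q0 HQ0) with (1 := Q0_IZR _) (2 := Hp).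
    + apply house_pow; [exact HQ0|exact Q0_one|].
      apply (house_mono Q0 HQ0) with (1 := Q0_IZR _) (2 := w1W _ Hb).
    + apply house_pow; [exact HQ0|exact Q0_one|].
      apply (house_mono Q0 HQ0) with (1 := Q0_IZR _) (2 := w2W _ Hb).
  - rewrite Rmult_assoc, <- pow_add; apply Rmult_le_compat_l; [lra|].
    apply Rle_pow; [exact W1|lia]. }
assert (HQV : QQ V (A0 * exp (3 * INR H1 * INR L))).
{ apply (house_mono QQ QQ_house) with (rsum P (fun _ => Pm * W ^ S0 * exp (3 * INR H1 * INR L))).
  - apply house_sum; [exact QQ_house| |].
    + apply Q3_base, Q0_zero.
    + intros a Ha; destruct (Hbox a Ha) as (_ & Hb & _).
      eapply (house_mono QQ QQ_house).
      * unfold par; rewrite <- !Rmult_assoc.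
        refine (Q3_term c12 _ D1 D2 D3 Hc12 Oc12 D1p D2p D3p D1_al D2_3 Hc12D Hc12D' _ _ _ _ _ (Hterm a Ha)).
      * rewrite !Rmult_assoc; apply Rmult_le_compat_l; [lra|].
        apply Rmult_le_compat_l; [apply pow_le; lra|].
        assert (Hle := hxx_le k (fst a) Hb Hk Hodd HkL); rewrite !Rmult_assoc in Hle; exact Hle.
  - rewrite rsum_const; unfold A0; rewrite <- !Rmult_assoc.
    repeat (apply Rmult_le_compat_r; [first [left; apply exp_pos|apply pow_le; lra|lra]|]).
    apply le_INR, Hlen. }
destruct (Req_dec V 0) as [H0|H0]; [exact H0|exfalso].
assert (HL := QQ_liouville V _ HQV H0).
assert (HVs : Rabs V <= exp (INR H1 * INR L) * (rhs + A0 * eta)).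
{ rewrite HV, Rabs_mult; apply Rmult_le_compat; try apply Rabs_pos; [|exact Hsm].
  rewrite Rabs_right by (apply Rle_ge, pow_le; lra).
  apply Rle_trans with (exp (INR h) ^ (T' * k)); [apply pow_incr; lra|].
  rewrite <- exp_INR_mul.
  assert (Hle : INR (T' * k) * INR h <= INR H1 * INR L).
  { rewrite <- !mult_INR; apply le_INR; unfold H1, T.
    replace (T' * k * h)%nat with (h * T' * k)%nat by ring.
    replace (h * (2 * T') * L)%nat with (h * T' * (2 * L))%nat by ring.
    apply Nat.mul_le_mono_l, HkL. }
  destruct Hle as [Hle|Hle]; [left; apply exp_increasing, Hle|rewrite Hle; lra]. }
apply (Rlt_irrefl 1); eapply Rle_lt_trans; [exact HL|].
eapply Rle_lt_trans; [|exact key].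
apply Rmult_le_compat_r; [|exact HVs].
apply pow_le, Rmult_le_pos; [apply A0_pos|left; apply exp_pos].
Qed.

Lemma par_neq_0 q : par q <> 0.
Proof.
assert (H : forall x b, 0 < x -> 0 < rt (sqrt x) b).
{ intros x [|] Hx; simpl; [apply sqrt_lt_R0, Hx|lra]. }
apply Rgt_not_eq; unfold par; repeat apply Rmult_lt_0_compat; apply H; [exact al_pos|lra|].
apply Rmult_lt_0_compat; assumption.
Qed.

(* The square roots of [al], [3] and [g1 g2] are independent over the base field, so the
   vanishing sums split by the parities of the exponents; on one parity class the exponents
   can be halved. *)
Lemma kummer_step r S P : (J <= S)%nat -> (S <= S0)%nat -> state (Datatypes.S r) S P ->
  exists P', state r (S - J) P'.
Proof.
intros HJ HS Hst.
assert (Hz := zero_half _ S P HJ HS Hst).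
destruct Hst as (Hnd & (a0 & Ha0 & Hp0) & Hbox & Hlen & _).
set (b1 := fun a : tri * Z => Nat.odd (k1 (fst a))).
set (b2 := fun a : tri * Z => Nat.odd (k2 (fst a))).
set (b3 := fun a : tri * Z => Nat.odd (k3 (fst a))).
set (F := filter (fun a => Bool.eqb (b1 a) (b1 a0))
         (filter (fun a => Bool.eqb (b2 a) (b2 a0))
            (filter (fun a => Bool.eqb (b3 a) (b3 a0)) P))).
assert (HF : forall a, In a F -> In a P /\ b1 a = b1 a0 /\ b2 a = b2 a0 /\ b3 a = b3 a0).
{ intros a Ha; unfold F in Ha; rewrite !filter_In, !Bool.eqb_true_iff in Ha; tauto. }
assert (Ha0F : In a0 F).
{ unfold F; rewrite !filter_In, !Bool.eqb_true_iff; tauto. }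
exists (map (fun a => (half (fst a), snd a)) F).
assert (HndF : NoDup (map fst F)) by (unfold F; do 3 apply NoDup_map_filter; exact Hnd).
assert (Hdec : forall a, In a F ->
  k1 (fst a) = (2 * k1 (half (fst a)) + Nat.b2n (b1 a0))%nat /\
  k2 (fst a) = (2 * k2 (half (fst a)) + Nat.b2n (b2 a0))%nat /\
  k3 (fst a) = (2 * k3 (half (fst a)) + Nat.b2n (b3 a0))%nat).
{ intros a Ha; destruct (HF a Ha) as (_ & <- & <- & <-); unfold b1, b2, b3.
  repeat split; apply Nat.div2_odd. }
repeat split.
- rewrite map_map; simpl.
  replace (map (fun x => half (fst x)) F) with (map half (map fst F)) by apply map_map.
  apply Injective_map_NoDup_in; [|exact HndF].
  intros q q' Hq Hq' Hqq; apply in_map_iff in Hq; destruct Hq as (a & <- & Ha).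
  apply in_map_iff in Hq'; destruct Hq' as (a' & <- & Ha').
  destruct (Hdec a Ha) as (E1 & E2 & E3); destruct (Hdec a' Ha') as (E1' & E2' & E3').
  rewrite <- Hqq in E1', E2', E3'.
  destruct (fst a) as [[x1 x2] x3]; destruct (fst a') as [[y1 y2] y3].
  unfold k1, k2, k3 in *; simpl in *; congruence.
- exists (half (fst a0), snd a0); split; [|exact Hp0].
  apply in_map_iff; exists a0; split; [reflexivity|exact Ha0F].
- apply in_map_iff in H; destruct H as (b & <- & Hb).
  apply (Hbox b), HF, Hb.
- apply in_map_iff in H; destruct H as (b & <- & Hb).
  destruct (Hbox b) as (_ & (B1 & _) & _); [apply HF, Hb|].
  eapply Nat.le_lt_trans; [apply div2_le_self|exact B1].
- apply in_map_iff in H; destruct H as (b & <- & Hb).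
  destruct (Hbox b) as (_ & (_ & B1 & _) & _); [apply HF, Hb|].
  eapply Nat.le_lt_trans; [apply div2_le_self|exact B1].
- apply in_map_iff in H; destruct H as (b & <- & Hb).
  destruct (Hbox b) as (_ & (_ & _ & B1) & _); [apply HF, Hb|].
  eapply Nat.le_lt_trans; [apply div2_le_self|exact B1].
- apply in_map_iff in H; destruct H as (b & <- & Hb); apply div2_lt_pow.
  apply (Hbox b), HF, Hb.
- apply in_map_iff in H; destruct H as (b & <- & Hb); apply div2_lt_pow.
  apply (Hbox b), HF, Hb.
- apply in_map_iff in H; destruct H as (b & <- & Hb); apply div2_lt_pow.
  apply (Hbox b), HF, Hb.
- rewrite length_map; unfold F.
  do 3 (eapply Nat.le_trans; [apply filter_length_le|]); exact Hlen.
- intros i Hi.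
  set (k := (2 * i + 1)%nat).
  assert (Hk : (0 < k)%nat) by (unfold k; lia).
  assert (Hodd : Nat.odd k = true) by (unfold k; apply Nat.odd_spec; exists i; reflexivity).
  set (eps := (Nat.b2n (b1 a0), Nat.b2n (b2 a0), Nat.b2n (b3 a0)) : tri).
  assert (Hom : forall a, In a F -> om (fst a) = 2 * om (half (fst a)) + om eps).
  { intros a Ha; destruct (Hdec a Ha) as (E1 & E2 & E3).
    change (om eps) with (INR (Nat.b2n (b1 a0)) * la + INR (Nat.b2n (b2 a0)) * l3 + INR (Nat.b2n (b3 a0)) * lg).
    unfold om; rewrite E1, E2, E3, !plus_INR, !mult_INR; simpl (INR 2); ring. }
  assert (Hw1 : forall a, In a F -> w1 (fst a) = 2 * w1 (half (fst a)) + w1 eps).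
  { intros a Ha; destruct (Hdec a Ha) as (E1 & E2 & E3).
    change (w1 eps) with (IZR (Z.of_nat c * Z.of_nat (Nat.b2n (b1 a0)) + Z.of_nat n * Z.of_nat (Nat.b2n (b3 a0)))).
    unfold w1; rewrite E1, E3, <- mult_IZR, <- plus_IZR; f_equal; lia. }
  assert (Hw2 : forall a, In a F -> w2 (fst a) = 2 * w2 (half (fst a)) + w2 eps).
  { intros a Ha; destruct (Hdec a Ha) as (E1 & E2 & E3).
    change (w2 eps) with (IZR (Z.of_nat c * Z.of_nat (Nat.b2n (b2 a0)) - Z.of_nat m * Z.of_nat (Nat.b2n (b3 a0)))).
    unfold w2; rewrite E2, E3, <- mult_IZR, <- plus_IZR; f_equal; lia. }
  assert (HvF : vanish F (fun a => IZR (snd a)) (fun a => w1 (fst a)) (fun a => w2 (fst a))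
     (fun a => exp (om (half (fst a)) * INR k)) (S - J)).
  { intros s1 s2 Hs.
    assert (Hz' := Hz i s1 s2 Hi ltac:(lia)); fold k in Hz'.
    assert (HQ0 := Q0_house).
    assert (E := Q3_sum_zero c12 _ D1 D2 D3 Hc12 Oc12 D1p D2p D1_al D2_3 Hc12D Hc12D'
       ns0 ns1 ns2 ns3 P
       (fun a => IZR (snd a) * w1 (fst a) ^ s1 * w2 (fst a) ^ s2 * xx k (fst a))
       (fun a => Rabs (IZR (snd a)) * Rabs (w1 (fst a)) ^ s1 * Rabs (w2 (fst a)) ^ s2 * hxx k (fst a))
       b1 b2 b3).
    assert (Hx : forall a, In a P ->
      Q0 (IZR (snd a) * w1 (fst a) ^ s1 * w2 (fst a) ^ s2 * xx k (fst a))
       (Rabs (IZR (snd a)) * Rabs (w1 (fst a)) ^ s1 * Rabs (w2 (fst a)) ^ s2 * hxx k (fst a))).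
    { intros a _; apply (house_mul Q0 HQ0); [|apply xx_Q0].
      apply (house_mul Q0 HQ0); [apply (house_mul Q0 HQ0); [apply Q0_IZR|]|];
      (apply house_pow; [exact HQ0|exact Q0_one|apply Q0_IZR]). }
    specialize (E Hx); clear Hx.
    specialize (E ltac:(rewrite <- Hz'; apply rsum_ext; intros a Ha; unfold par, b1, b2, b3; ring)).
    specialize (E (b1 a0) (b2 a0) (b3 a0)); fold F in E.
    (* On a parity class the value at [k / 2] is the value of the halved exponents at the odd
       integer [k], up to this common nonzero factor. *)
    set (C := g2 ^ (T' * k) * exp (om eps * (INR k / 2)) / par (fst a0)).
    assert (HC : C <> 0).
    { unfold C; apply Rmult_integral_contrapositive_currified.
      - apply Rmult_integral_contrapositive_currified; apply Rgt_not_eq;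
        [apply pow_lt, g2p|apply exp_pos].
      - apply Rinv_neq_0_compat, par_neq_0. }
    apply (Rmult_eq_reg_l C); [|exact HC].
    rewrite Rmult_0_r, <- E, <- rsum_scal; apply rsum_ext; intros a Ha.
    destruct (HF a Ha) as (HaP & P1 & P2 & P3).
    assert (Hx := xx_spec k (fst a) (proj1 (proj2 (Hbox a HaP))) Hk Hodd).
    assert (Hpar : par (fst a) = par (fst a0)).
    { unfold par; unfold b1, b2, b3 in P1, P2, P3; rewrite P1, P2, P3; reflexivity. }
    rewrite (Hom a Ha), Hpar in Hx.
    replace ((2 * om (half (fst a)) + om eps) * (INR k / 2)) with
      (om (half (fst a)) * INR k + om eps * (INR k / 2)) in Hx by field.
    rewrite exp_plus in Hx.
    assert (Hxx : xx k (fst a) = C * exp (om (half (fst a)) * INR k)).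
    { unfold C; apply (Rmult_eq_reg_r (par (fst a0))); [|apply par_neq_0].
      rewrite <- Hx; field; apply par_neq_0. }
    rewrite Hxx; ring. }
  assert (Hv' := vanish_affine F _ _ _ (fun a => w1 (half (fst a))) (fun a => w2 (half (fst a)))
    (w1 eps) (w2 eps) _ _ Hw1 Hw2 HvF).
  intros s1 s2 Hs; rewrite rsum_map; exact (Hv' s1 s2 Hs).
Qed.

(** Each halving costs [J] orders of vanishing. When no binary digit is left, all exponents are
    zero, and being distinct they leave one term, whose nonzero coefficient would have to vanish. *)
Lemma no_state r S P : (r * J + 1 <= S)%nat -> (S <= S0)%nat -> ~ state r S P.
Proof.
revert S P; induction r as [|r IH]; intros S P HS HS0 Hst.
- destruct Hst as (Hnd & (a0 & Ha0 & Hp0) & Hbox & _ & Hv).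
  assert (Hfst : forall a, In a P -> fst a = (0, 0, 0)%nat).
  { intros a Ha; destruct (Hbox a Ha) as (_ & _ & B1 & B2 & B3).
    destruct (fst a) as [[x1 x2] x3]; unfold k1, k2, k3 in *; simpl in *.
    repeat f_equal; lia. }
  assert (HP : P = [a0]).
  { destruct P as [|a [|b P]]; [destruct Ha0| |].
    - destruct Ha0 as [<-|[]]; reflexivity.
    - exfalso; simpl in Hnd; inversion Hnd as [|x y Hx _]; apply Hx; left.
      rewrite (Hfst a), (Hfst b); [reflexivity|right; left; reflexivity|left; reflexivity]. }
  assert (H0 := Hv 0%nat L1 0%nat 0%nat ltac:(lia)); rewrite HP in H0; simpl in H0.
  apply Hp0, eq_IZR.
  assert (He := exp_pos (om (fst a0) * 1)); simpl in H0.
  apply (Rmult_eq_reg_r (exp (om (fst a0) * 1))); lra.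
- destruct (kummer_step r S P) as [P' HP']; [nia|exact HS0|exact Hst|].
  apply (IH (S - J)%nat P'); [simpl in HS; lia|lia|exact HP'].
Qed.

End Baker.

(** * Choice of the parameters *)

Lemma exp_ge_term x k : 0 <= x -> x ^ k / INR (fact k) <= exp x.
Proof.
intros Hx; eapply Rle_trans; [|apply (texp_le_exp (S k) x Hx)].
unfold texp; rewrite rsum_seq_S.
assert (0 <= rsum (seq 0 k) (fun j => x ^ j / INR (fact j))); [|lra].
apply rsum_nonneg; intros j _; apply Rmult_le_pos; [apply pow_le, Hx|].
left; apply Rinv_0_lt_compat, INR_fact_lt_0.
Qed.

Lemma exp_3_lt_24 : exp 3 < 24.
Proof.
assert (H : 1 - / 32 <= exp (- / 32)) by (generalize (exp_ineq1_le (- / 32)); lra).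
assert (H2 : exp 3 * exp (- / 32) ^ 96 = 1).
{ rewrite <- exp_INR_mul, <- exp_plus, <- exp_0; f_equal; simpl; field. }
assert (H3 : (1 - / 32) ^ 96 <= exp (- / 32) ^ 96) by (apply pow_incr; lra).
assert (H4 : / 24 < (1 - / 32) ^ 96) by lra.
assert (0 < exp 3) by apply exp_pos; nra.
Qed.

Lemma pow2_le_exp l : 2 ^ l <= exp (INR l).
Proof.
rewrite <- (Rmult_1_r (INR l)), exp_INR_mul; apply pow_incr; split; [lra|].
generalize (exp_ineq1_le 1); lra.
Qed.

(** M^M / M! <= e^M with M = 24 y, and 24 > e^3 leaves the gain e^(-2M). *)
Lemma pow_fact_le (y : R) (M : nat) : 0 <= y -> INR M = 24 * y ->
  y ^ M / INR (fact M) <= exp (- (2 * INR M)).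
Proof.
intros Hy HM.
assert (H := exp_ge_term (INR M) M (pos_INR M)).
rewrite HM in H at 1; rewrite Rpow_mult_distr in H.
assert (H24 : exp (3 * INR M) <= 24 ^ M).
{ rewrite Rmult_comm, exp_INR_mul; apply pow_incr; split; [left; apply exp_pos|].
  left; apply exp_3_lt_24. }
assert (Hp : 0 <= y ^ M / INR (fact M)).
{ apply Rmult_le_pos; [apply pow_le, Hy|left; apply Rinv_0_lt_compat, INR_fact_lt_0]. }
apply Rmult_le_reg_l with (exp (3 * INR M)); [apply exp_pos|].
rewrite <- exp_plus; replace (3 * INR M + - (2 * INR M)) with (INR M) by ring.
eapply Rle_trans; [|exact H].
unfold Rdiv in *; rewrite Rmult_assoc; apply Rmult_le_compat_r; assumption.
Qed.

Lemma pow_le_exp x y k : 0 <= x -> x <= exp y -> x ^ k <= exp (INR k * y).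
Proof. intros H0 H; rewrite exp_INR_mul; apply pow_incr; split; assumption. Qed.

Lemma sq_le_exp l : 300 <= l -> 160 * l ^ 2 <= exp (l / 14).
Proof.
intros Hl; set (x := l / 14).
assert (Hx : 300 / 14 <= x) by (unfold x; lra).
assert (H := exp_ge_term x 12 ltac:(lra)).
eapply Rle_trans; [|exact H].
replace (INR (fact 12)) with 479001600.
2:{ do 12 (rewrite fact_simpl, mult_INR); change (fact 0) with 1%nat.
    rewrite !INR_IZR_INZ; simpl Z.of_nat; lra. }
replace (160 * l ^ 2) with (31360 * x ^ 2) by (unfold x; field).
assert (H10 : (300 / 14) ^ 10 <= x ^ 10) by (apply pow_incr; lra).
replace (x ^ 12) with (x ^ 2 * x ^ 10) by ring.
assert (0 <= x ^ 2) by (apply pow_le; lra).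
assert (Hn : 31360 * 479001600 <= (300 / 14) ^ 10) by lra.
apply Rmult_le_reg_r with 479001600; [lra|].
unfold Rdiv at 1; rewrite (Rmult_assoc (x ^ 2 * x ^ 10)), Rinv_l, Rmult_1_r by lra.
nra.
Qed.

(** In units of [Q]: [J * L] is 24 times [Om * (2 * L)], so the remainder gains 384. The
    coefficients cost 15.7 and the exponential 8, which leaves 360. Liouville costs 15 (15.7 + 3) <=
    281 and the cleared denominator 1, so 78 remains. The condition on [X] makes the part with [eta]
    as small. *)
Lemma key_ineq (J L : nat) (Hr l A0 Om eta X : R) :
  1 <= Hr -> 300 <= l -> INR L = 40 * l ^ 2 -> INR J = 192 * Hr -> Om = 4 * Hr ->
  Om <= exp (2 * l) -> 0 <= A0 -> A0 <= exp (157 / 10 * (Hr * INR L)) ->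
  0 <= eta -> eta <= exp (9 * (Hr * INR L) - X) -> 20 * (Hr * INR L) * l <= X ->
  exp (Hr * INR L) *
  (INR (J * L) * (2 * (2 * INR L)) ^ (J * L) * (A0 * Om ^ J * eta) +
   (2 * INR L) ^ (J * L) * (A0 * (Om ^ (J * L) / INR (fact (J * L))) * exp (Om * (2 * INR L))) +
   A0 * eta) * (A0 * exp (3 * Hr * INR L)) ^ 15 < 1.
Proof.
intros HHr Hl HL HJ HOm HOml HA0 HA0' Heta Heta' HX.
set (Q := Hr * INR L) in *.
set (M := (J * L)%nat).
assert (HM : INR M = 192 * Q) by (unfold M, Q; rewrite mult_INR, HJ; ring).
assert (HL1 : 3600000 <= INR L) by (rewrite HL; nra).
assert (HQ : 3600000 <= Q) by (unfold Q; nra).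
assert (HQL : INR L <= Q) by (unfold Q; nra).
assert (T1 : INR M <= exp (8 * Q)).
{ rewrite HM; assert (E := exp_ge_term (8 * Q) 2 ltac:(lra)); simpl in E; nra. }
assert (T2 : (2 * (2 * INR L)) ^ M <= exp (Q * l * (192 / 14))).
{ replace (Q * l * (192 / 14)) with (INR M * (l / 14)) by (rewrite HM; field).
  apply pow_le_exp; [lra|].
  replace (2 * (2 * INR L)) with (160 * l ^ 2) by (rewrite HL; ring).
  apply sq_le_exp, Hl. }
assert (T3 : Om ^ J <= exp Q).
{ apply Rle_trans with (exp (INR J * (2 * l))); [apply pow_le_exp; [lra|exact HOml]|].
  apply exp_le; rewrite HJ; unfold Q; rewrite HL.
  replace (192 * Hr * (2 * l)) with (Hr * (l * 384)) by ring.
  apply Rmult_le_compat_l; [lra|]; nra. }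
assert (T4 : (2 * INR L) ^ M * (Om ^ M / INR (fact M)) <= exp (- (384 * Q))).
{ replace ((2 * INR L) ^ M * (Om ^ M / INR (fact M))) with ((2 * INR L * Om) ^ M / INR (fact M)).
  2:{ rewrite Rpow_mult_distr; unfold Rdiv; ring. }
  replace (- (384 * Q)) with (- (2 * INR M)) by (rewrite HM; ring).
  apply pow_fact_le; [rewrite HOm; apply Rmult_le_pos; lra|].
  rewrite HM, HOm; unfold Q; ring. }
assert (Hpe : forall x, 0 <= exp x) by (intros; left; apply exp_pos).
assert (Hm : forall a b x y, 0 <= a -> 0 <= b -> a <= exp x -> b <= exp y -> a * b <= exp (x + y)).
{ intros a b x y Ha Hb Hx Hy; rewrite exp_plus; apply Rmult_le_compat; assumption. }
assert (P1 : 0 <= INR M) by apply pos_INR.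
assert (P2 : 0 <= (2 * (2 * INR L)) ^ M) by (apply pow_le; lra).
assert (P3 : 0 <= Om ^ J) by (apply pow_le; lra).
assert (P4 : 0 <= (2 * INR L) ^ M * (Om ^ M / INR (fact M))).
{ apply Rmult_le_pos; [apply pow_le; lra|]; apply Rmult_le_pos; [apply pow_le; lra|].
  left; apply Rinv_0_lt_compat, INR_fact_lt_0. }
assert (HQl : 300 * Q <= Q * l) by nra.
assert (F1 : INR M * (2 * (2 * INR L)) ^ M * (A0 * Om ^ J * eta) <= exp (- (360 * Q))).
{ eapply Rle_trans.
  - apply Hm; [apply Rmult_le_pos; assumption| |apply Hm; eassumption|].
    + repeat apply Rmult_le_pos; assumption.
    + apply Hm; [apply Rmult_le_pos; assumption|exact Heta|apply Hm; eassumption|exact Heta'].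
  - apply exp_le; lra. }
assert (F2 : (2 * INR L) ^ M * (A0 * (Om ^ M / INR (fact M)) * exp (Om * (2 * INR L))) <= exp (- (360 * Q))).
{ replace ((2 * INR L) ^ M * (A0 * (Om ^ M / INR (fact M)) * exp (Om * (2 * INR L)))) with
    (((2 * INR L) ^ M * (Om ^ M / INR (fact M)) * A0) * exp (Om * (2 * INR L))) by ring.
  eapply Rle_trans.
  - apply Hm; [apply Rmult_le_pos; assumption|apply Hpe|apply Hm; eassumption|apply Rle_refl].
  - apply exp_le; rewrite HOm; unfold Q in *; lra. }
assert (F3 : A0 * eta <= exp (- (360 * Q))).
{ eapply Rle_trans; [apply Hm; eassumption|]; apply exp_le; lra. }
assert (F4 : (A0 * exp (3 * Hr * INR L)) ^ 15 <= exp (281 * Q)).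
{ apply Rle_trans with (exp (INR 15 * (187 / 10 * Q))).
  - apply pow_le_exp; [apply Rmult_le_pos; [exact HA0|apply Hpe]|].
    replace (187 / 10 * Q) with (157 / 10 * Q + 3 * Hr * INR L) by (unfold Q; field).
    apply Hm; [exact HA0|apply Hpe|exact HA0'|apply Rle_refl].
  - apply exp_le; simpl; lra. }
set (Sm := INR M * (2 * (2 * INR L)) ^ M * (A0 * Om ^ J * eta) + _ + _).
assert (HS : Sm <= 3 * exp (- (360 * Q))) by (unfold Sm; lra).
assert (Hfin : exp Q * (3 * exp (- (360 * Q))) * exp (281 * Q) < 1).
{ replace (exp Q * (3 * exp (- (360 * Q))) * exp (281 * Q)) with (3 * exp (- (78 * Q))).
  - replace (- (78 * Q)) with (- (78 * Q)) by ring; rewrite exp_Ropp.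
    assert (E := exp_ineq1_le (78 * Q)).
    apply Rmult_lt_reg_r with (exp (78 * Q)); [apply exp_pos|].
    rewrite Rmult_assoc, Rinv_l by (apply Rgt_not_eq, exp_pos); lra.
  - rewrite <- Rmult_assoc, (Rmult_comm (exp Q) 3), !Rmult_assoc, <- !exp_plus.
    do 2 f_equal; ring. }
eapply Rle_lt_trans; [|exact Hfin].
apply Rmult_le_compat.
- apply Rmult_le_pos; [apply Hpe|]; unfold Sm.
  repeat apply Rplus_le_le_0_compat; repeat apply Rmult_le_pos; try assumption; try apply Hpe.
  + apply pow_le; lra.
  + apply pow_le; lra.
  + left; apply Rinv_0_lt_compat, INR_fact_lt_0.
- apply pow_le, Rmult_le_pos; [exact HA0|apply Hpe].
- apply Rmult_le_compat_l; [apply Hpe|exact HS].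
- exact F4.
Qed.

(** The lower estimate of [ln g] is Liouville's: g |g'| >= 1 and |g'| <= e^h. *)
Lemma ln_house g g' h : 0 < g -> inO g g' -> g <= exp h -> Rabs g' <= exp h -> Rabs (ln g) <= h.
Proof.
intros Hg HO H1 H2.
assert (H := inO_liouville g g' HO ltac:(lra)); rewrite (Rabs_right g) in H by lra.
apply Rabs_le; split.
- assert (Hi : exp (- h) <= g).
  { rewrite exp_Ropp; apply Rmult_le_reg_r with (exp h); [apply exp_pos|].
    rewrite Rinv_l by (apply Rgt_not_eq, exp_pos); nra. }
  rewrite <- (ln_exp (- h)); destruct Hi as [Hi|Hi]; [left; apply ln_increasing; [apply exp_pos|exact Hi]|rewrite Hi; lra].
- rewrite <- (ln_exp h); destruct H1 as [Hi|Hi]; [left; apply ln_increasing; assumption|rewrite Hi; lra].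
Qed.

Lemma ln_le_of_exp x y : 0 < x -> x <= exp y -> ln x <= y.
Proof.
intros Hx [H|H]; [left; rewrite <- (ln_exp y); apply ln_increasing; assumption|].
rewrite H, ln_exp; lra.
Qed.

Lemma la_bounds : 0 <= la <= / 2.
Proof.
assert (B := al_bounds); assert (B1 := exp_bound1); unfold la; split.
- rewrite <- ln_1; left; apply ln_increasing; lra.
- apply ln_le_of_exp; lra.
Qed.

Lemma l3_bounds : 0 <= l3 <= 11 / 10.
Proof.
assert (B1 := exp_bound1); unfold l3; split.
- rewrite <- ln_1; left; apply ln_increasing; lra.
- apply ln_le_of_exp; lra.
Qed.

Lemma exp_sub_1_le x : Rabs x <= / 2 -> Rabs (exp x - 1) <= 2 * Rabs x.
Proof.
intros H; apply Rabs_le_inv in H.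
assert (H1 := exp_ineq1_le x); assert (H2 := exp_ineq1_le (- x)).
assert (Hp := exp_pos x).
destruct (Rle_dec 0 x) as [Hx|Hx].
- rewrite (Rabs_right x), Rabs_right by lra.
  assert (exp x * exp (- x) = 1) by (rewrite <- exp_plus, <- exp_0; f_equal; ring); nra.
- rewrite (Rabs_left x), (Rabs_left1 (exp x - 1)); [lra| |lra].
  rewrite <- exp_0; assert (exp x < exp 0) by (apply exp_increasing; lra); lra.
Qed.

(** A smaller linear form would permit [initial_state] with [l - 1] binary digits and order [l * J],
    against [no_state]. The last hypothesis makes [l - 1] digits enough for the exponents and e^l
    enough for [w1] and [w2]. *)
Theorem baker (g1 g1' g2 g2' : R) (n m c h l T' : nat) :
  0 < g1 -> 0 < g2 -> inO g1 g1' -> inO g2 g2' ->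
  g1 <= exp (INR h) -> Rabs g1' <= exp (INR h) ->
  g2 <= exp (INR h) -> Rabs g2' <= exp (INR h) ->
  NS Q0 (g1 * g2) -> NS Q0 (3 * (g1 * g2)) ->
  NS Q0 (al * (g1 * g2)) -> NS Q0 (al * (3 * (g1 * g2))) ->
  (0 < c)%nat -> (0 < h)%nat -> 300 <= INR l -> INR T' = 2097152 * INR l ^ 4 ->
  (h * (2 * T') * (c + n + m) <= 2 ^ (l - 1))%nat ->
  exp (- (4294967296 * INR h * INR l ^ 7)) <
  Rabs (INR n * ln al - INR m * ln 3 - INR c * (ln g1 - ln g2)).
Proof.
intros Hg1 Hg2 Og1 Og2 B1 B1' B2 B2' N0 N1 N2 N3 Hc Hh Hl HT Hbig.
set (X := 4294967296 * INR h * INR l ^ 7).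
set (Lam := INR n * ln al - INR m * ln 3 - INR c * (ln g1 - ln g2)).
apply Rnot_le_lt; intros HLam.
set (T := (2 * T')%nat).
set (H1 := (h * T)%nat).
(* [S0 = l * J] pays for [l - 1] halvings; [L] of order l^2 keeps [W ^ S0] at e^(4.8 Q). Siegel then
   asks for about 80 * 192^2 l^4 H1^2 unknowns, which the constant 2^22 in [T] provides. *)
set (L := (40 * (l * l))%nat).
set (J := (192 * H1)%nat).
set (S0 := (l * J)%nat).
set (U := (H1 * H1 * T)%nat).
set (W := exp (INR l)).
set (Hr := INR H1).
set (Q := Hr * INR L).
set (Pm := 8 * INR U * (W ^ S0 * exp (6 * INR H1 * INR L))).
set (Om := 4 * Hr).
set (eta := exp (9 * Q - X)).
assert (Hc1 : 1 <= INR c) by (apply (le_INR 1); lia).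
assert (Hh1 : 1 <= INR h) by (apply (le_INR 1); lia).
assert (HTr : INR T = 4194304 * INR l ^ 4) by (unfold T; rewrite mult_INR, HT; simpl; ring).
assert (Hl4 : 1 <= INR l ^ 4) by (apply pow_R1_Rle; lra).
assert (HT1 : 1000000 <= INR T) by (rewrite HTr; lra).
assert (HHr : Hr = INR h * INR T) by (unfold Hr, H1; apply mult_INR).
assert (HHT : INR T <= Hr) by (rewrite HHr; nra).
assert (HH1 : 1 <= Hr) by lra.
assert (HHh : INR h <= Hr) by (rewrite HHr; nra).
assert (HL : INR L = 40 * INR l ^ 2).
{ unfold L; rewrite !mult_INR; replace (INR 40) with 40 by (simpl; lra); ring. }
assert (HJ : INR J = 192 * Hr).
{ unfold J; rewrite mult_INR; replace (INR 192) with 192 by (rewrite INR_IZR_INZ; reflexivity); reflexivity. }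
assert (HL1 : 3600000 <= INR L) by (rewrite HL; nra).
assert (HQ : 3600000 <= Q) by (unfold Q; nra).
assert (HHQ : Hr <= Q) by (unfold Q; nra).
assert (Hpe : forall x, 0 <= exp x) by (intros; left; apply exp_pos).
assert (HX : 20 * Q * INR l <= X).
{ unfold X, Q; rewrite HHr, HTr, HL.
  replace (20 * (INR h * (4194304 * INR l ^ 4) * (40 * INR l ^ 2)) * INR l) with
    (3355443200 * (INR h * INR l ^ 7)) by ring.
  rewrite (Rmult_assoc 4294967296); apply Rmult_le_compat_r; [|lra].
  apply Rmult_le_pos; [lra|apply pow_le; lra]. }
assert (Hlpos : (1 <= l)%nat) by (apply INR_le; simpl; lra).
assert (H2l : 2 * INR (2 ^ (l - 1)) = 2 ^ l).
{ rewrite pow_INR; replace (INR 2) with 2 by (simpl; lra); rewrite tech_pow_Rmult.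
  f_equal; lia. }
assert (Hbox : (H1 * (c + n + m) <= 2 ^ (l - 1))%nat) by exact Hbig.
assert (Hbr : Hr * (INR c + INR n + INR m) <= INR (2 ^ (l - 1))).
{ apply le_INR in Hbox; rewrite mult_INR, !plus_INR in Hbox; exact Hbox. }
assert (H2le := pow2_le_exp l); fold W in H2le.
assert (Hn0 := pos_INR n); assert (Hm0 := pos_INR m).
assert (Hpw := pos_INR (2 ^ (l - 1))).
assert (HW : Hr * (INR c + INR n + INR m) <= W) by lra.
assert (HrW : 2 * Hr <= W).
{ assert (Hr * 1 <= Hr * (INR c + INR n + INR m)) by (apply Rmult_le_compat_l; lra); lra. }
assert (Hlg : Rabs (ln g1 - ln g2) <= 2 * INR h).
{ assert (E1 := ln_house g1 g1' _ Hg1 Og1 B1 B1'); assert (E2 := ln_house g2 g2' _ Hg2 Og2 B2 B2').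
  unfold Rminus; eapply Rle_trans; [apply Rabs_triang|]; rewrite Rabs_Ropp; lra. }
assert (Bla := la_bounds); assert (Bl3 := l3_bounds).
assert (Hbx : forall q, inbox h T' q -> INR (k1 q) <= Hr /\ INR (k2 q) <= Hr /\ INR (k3 q) <= INR T).
{ intros q (Q1 & Q2 & Q3); repeat split; apply le_INR; unfold H1, T; lia. }
assert (Hw1 : forall q, inbox h T' q -> Rabs (w1 n c q) <= W).
{ intros q Hq; destruct (Hbx q Hq) as (E1 & E2 & E3).
  assert (P1 := pos_INR (k1 q)); assert (P3 := pos_INR (k3 q)).
  unfold w1; rewrite plus_IZR, !mult_IZR, <- !INR_IZR_INZ.
  rewrite Rabs_right; nra. }
assert (Hw2 : forall q, inbox h T' q -> Rabs (w2 m c q) <= W).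
{ intros q Hq; destruct (Hbx q Hq) as (E1 & E2 & E3).
  assert (P2 := pos_INR (k2 q)); assert (P3 := pos_INR (k3 q)).
  unfold w2; rewrite minus_IZR, !mult_IZR, <- !INR_IZR_INZ.
  apply Rabs_le; split; nra. }
assert (Hdiff : forall q, inbox h T' q -> Rabs (om' n m c q - om g1 g2 q) <= INR T * exp (- X)).
{ intros q Hq; destruct (Hbx q Hq) as (E1 & E2 & E3).
  replace (om' n m c q - om g1 g2 q) with (INR (k3 q) * (Lam / INR c)).
  2:{ unfold om', om, w1, w2, Lam, la, l3; rewrite plus_IZR, minus_IZR, !mult_IZR, <- !INR_IZR_INZ.
      field; lra. }
  rewrite Rabs_mult, (Rabs_right (INR (k3 q))) by (apply Rle_ge, pos_INR).
  apply Rmult_le_compat; [apply pos_INR|apply Rabs_pos|exact E3|].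
  unfold Rdiv; rewrite Rabs_mult, Rabs_inv, (Rabs_right (INR c)) by lra.
  assert (Hi : / INR c <= 1) by (rewrite <- Rinv_1; apply Rinv_le_contravar; lra).
  assert (0 < / INR c) by (apply Rinv_0_lt_compat; lra).
  assert (0 <= Rabs Lam) by apply Rabs_pos.
  apply Rle_trans with (Rabs Lam * 1); [apply Rmult_le_compat_l; assumption|lra]. }
assert (HXb : 3 * Q <= X) by nra.
assert (Hsmall : INR T * exp (- X) * (2 * INR L) <= exp (Q - X) /\ 2 * exp (Q - X) <= / 2).
{ split.
  - apply Rle_trans with (2 * Q * exp (- X)).
    + replace (INR T * exp (- X) * (2 * INR L)) with (2 * (INR T * INR L) * exp (- X)) by ring.
      apply Rmult_le_compat_r; [apply Hpe|]; unfold Q; nra.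
    + unfold Rminus; rewrite exp_plus; apply Rmult_le_compat_r; [apply Hpe|].
      assert (E := exp_ge_term Q 2 ltac:(lra)); simpl in E; nra.
  - apply Rle_trans with (2 * exp (- (2 * Q))).
    + apply Rmult_le_compat_l; [lra|]; apply exp_le; lra.
    + rewrite exp_Ropp; assert (E := exp_ineq1_le (2 * Q)).
      apply Rmult_le_reg_r with (exp (2 * Q)); [apply exp_pos|].
      rewrite Rmult_assoc, Rinv_l by (apply Rgt_not_eq, exp_pos); lra. }
assert (Hom : forall q, inbox h T' q -> Rabs (om g1 g2 q) <= 37 / 10 * Hr).
{ intros q Hq; destruct (Hbx q Hq) as (E1 & E2 & E3).
  assert (P1 := pos_INR (k1 q)); assert (P2 := pos_INR (k2 q)); assert (P3 := pos_INR (k3 q)).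
  unfold om; eapply Rle_trans; [apply Rabs_triang|].
  assert (F1 : Rabs (INR (k1 q) * la + INR (k2 q) * l3) <= 16 / 10 * Hr).
  { rewrite Rabs_right; nra. }
  assert (F2 : Rabs (INR (k3 q) * (ln g1 - ln g2)) <= 2 * Hr).
  { rewrite Rabs_mult, Rabs_right by lra; rewrite HHr.
    replace (2 * (INR h * INR T)) with (INR T * (2 * INR h)) by ring.
    apply Rmult_le_compat; [lra|apply Rabs_pos|exact E3|exact Hlg]. }
  lra. }
assert (Hom' : forall q, inbox h T' q -> Rabs (om' n m c q) <= Om).
{ intros q Hq; assert (E1 := Hom q Hq); assert (E2 := Hdiff q Hq).
  replace (om' n m c q) with (om g1 g2 q + (om' n m c q - om g1 g2 q)) by ring.
  eapply Rle_trans; [apply Rabs_triang|]; unfold Om.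
  assert (E3 : INR T * exp (- X) <= / 4).
  { destruct Hsmall as [A1 A2]; assert (0 <= INR T * exp (- X)) by (apply Rmult_le_pos; [lra|apply Hpe]); nra. }
  lra. }
assert (Heta : forall q z, inbox h T' q -> 0 <= z <= 2 * INR L ->
  Rabs (exp (om' n m c q * z) - exp (om g1 g2 q * z)) <= eta).
{ intros q z Hq Hz; assert (E1 := Hom q Hq); assert (E2 := Hdiff q Hq).
  replace (om' n m c q * z) with (om g1 g2 q * z + (om' n m c q - om g1 g2 q) * z) by ring.
  rewrite exp_plus.
  set (d := (om' n m c q - om g1 g2 q) * z).
  assert (Hd : Rabs d <= exp (Q - X)).
  { unfold d; rewrite Rabs_mult, (Rabs_right z) by lra.
    eapply Rle_trans; [|apply (proj1 Hsmall)].
    apply Rmult_le_compat; [apply Rabs_pos|lra|exact E2|lra]. }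
  assert (E3 := exp_sub_1_le d ltac:(lra)).
  replace (exp (om g1 g2 q * z) * exp d - exp (om g1 g2 q * z)) with (exp (om g1 g2 q * z) * (exp d - 1)) by ring.
  rewrite Rabs_mult, (Rabs_right (exp _)) by (apply Rle_ge, Hpe).
  unfold eta; replace (9 * Q - X) with (37 / 10 * 2 * Q + (6 / 10 * Q + (Q - X))) by field.
  rewrite exp_plus; apply Rmult_le_compat; [apply Hpe|apply Rabs_pos| |].
  - apply exp_le; apply Rabs_le_inv in E1.
    apply Rle_trans with (37 / 10 * Hr * z); [apply Rmult_le_compat_r; lra|].
    unfold Q; replace (37 / 10 * 2 * (Hr * INR L)) with (37 / 10 * Hr * (2 * INR L)) by ring.
    apply Rmult_le_compat_l; lra.
  - rewrite exp_plus.
    assert (E4 := exp_ineq1_le (6 / 10 * Q)).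
    apply Rle_trans with (2 * exp (Q - X)); [lra|].
    apply Rmult_le_compat_r; [apply Hpe|lra]. }
assert (W1 : 1 <= W) by (unfold W; generalize (exp_ineq1_le (INR l)); lra).
assert (HWS : W ^ S0 = exp (48 / 10 * Q)).
{ unfold W, S0; rewrite <- exp_INR_mul; f_equal; rewrite mult_INR, HJ; unfold Q; rewrite HL; field. }
assert (HUr : INR U = Hr * Hr * INR T) by (unfold U; rewrite !mult_INR; reflexivity).
assert (HU1 : 1 <= INR U).
{ rewrite HUr; assert (1 <= Hr * Hr) by nra; nra. }
assert (HUW : INR U <= exp (3 * INR l)).
{ rewrite HUr; replace (3 * INR l) with (INR l + INR l + INR l) by ring.
  rewrite !exp_plus; fold W.
  apply Rmult_le_compat; [nra|lra| |lra]; apply Rmult_le_compat; lra. }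
assert (HPm : Pm = 8 * INR U * exp (108 / 10 * Q)).
{ unfold Pm; rewrite HWS, <- exp_plus; do 2 f_equal; unfold Q, Hr; field. }
assert (HPm1 : 1 <= Pm).
{ rewrite HPm; assert (E := exp_ineq1_le (108 / 10 * Q)); nra. }
set (A0 := INR U * (Pm * W ^ S0)).
assert (HA0 : A0 = 8 * (INR U * INR U) * exp (156 / 10 * Q)).
{ unfold A0; rewrite HPm, HWS; replace (156 / 10 * Q) with (108 / 10 * Q + 48 / 10 * Q) by field.
  rewrite exp_plus; ring. }
assert (HA0p : 0 <= A0).
{ rewrite HA0; repeat apply Rmult_le_pos; try lra; apply Hpe. }
assert (HA0le : A0 <= exp (157 / 10 * Q)).
{ rewrite HA0; replace (157 / 10 * Q) with (1 / 10 * Q + 156 / 10 * Q) by field.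
  rewrite exp_plus; apply Rmult_le_compat_r; [apply Hpe|].
  apply Rle_trans with (exp 7 * (exp (3 * INR l) * exp (3 * INR l))).
  - apply Rmult_le_compat; [lra|nra|generalize (exp_ineq1_le 7); lra|].
    apply Rmult_le_compat; lra.
  - rewrite <- !exp_plus; apply exp_le; unfold Q; rewrite HL; nra. }
assert (HOml : Om <= exp (2 * INR l)).
{ unfold Om; replace (2 * INR l) with (INR l + INR l) by ring; rewrite exp_plus; fold W; nra. }
assert (Hkey := key_ineq J L Hr (INR l) A0 Om eta X HH1 Hl HL HJ eq_refl HOml HA0p HA0le
  (Hpe _) (Rle_refl _) HX).
assert (HL0 : (0 < L)%nat) by (apply INR_lt; simpl; lra).
assert (Hr1 : (H1 <= 2 ^ (l - 1))%nat).
{ apply Nat.le_trans with (H1 * (c + n + m))%nat; [nia|exact Hbox]. }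
destruct (initial_state g1 g1' g2 g2' n m c h T' L J S0 U W Pm Hg1 Hg2 Og1 Og2
  B1 B1' B2 B2' Hc W1 Hw1 Hw2 HL0 (l - 1)) as [P HP].
- reflexivity.
- apply INR_lt; simpl; lra.
- apply INR_le; rewrite !mult_INR, plus_INR; fold U; rewrite HUr.
  unfold S0; rewrite mult_INR, HJ, HL, HHr, HTr; replace (INR 2) with 2 by (simpl; lra); replace (INR 1) with 1 by reflexivity.
  set (a := INR l) in *; set (b := INR h) in *.
  assert (Ha2 : 90000 <= a ^ 2) by nra.
  assert (Hb4 : 1 <= a ^ 4) by exact Hl4.
  set (y := a * (192 * (b * (4194304 * a ^ 4)))).
  assert (Hy : 1000000 <= y).
  { unfold y; replace (a * (192 * (b * (4194304 * a ^ 4)))) with (805306368 * (a * (b * a ^ 4))) by ring.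
    assert (1 <= b * a ^ 4) by nra. nra. }
  assert (Hy2 : y * (y + 1) <= 1000001 / 1000000 * (y * y)) by nra.
  assert (0 <= 80 * a ^ 2) by lra.
  apply Rle_trans with (80 * a ^ 2 * (1000001 / 1000000 * (y * y))).
  + replace (2 * (40 * a ^ 2 * (y * (y + 1)))) with (80 * a ^ 2 * (y * (y + 1))) by ring.
    apply Rmult_le_compat_l; assumption.
  + unfold y.
    replace (80 * a ^ 2 * (1000001 / 1000000 * (a * (192 * (b * (4194304 * a ^ 4))) * (a * (192 * (b * (4194304 * a ^ 4)))))))
      with (80 * 192 * 192 * (1000001 / 1000000) * (4194304 * 4194304) * (b * b * a ^ 12)) by field.
    replace (b * (4194304 * a ^ 4) * (b * (4194304 * a ^ 4)) * (4194304 * a ^ 4))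
      with (4194304 * (4194304 * 4194304) * (b * b * a ^ 12)) by ring.
    apply Rmult_le_compat_r; [|lra].
    apply Rmult_le_pos; [nra|apply pow_le; lra].
- exact Hr1.
- eapply Nat.le_trans; [|exact Hr1]; unfold H1; fold T; nia.
- apply Rle_refl.
- refine (no_state g1 g1' g2 g2' n m c h T' L J S0 U W Pm Om eta Hg1 Hg2 Og1 Og2
    B1 B1' B2 B2' Hc N0 N1 N2 N3 W1 Hw1 Hw2 _ Hom' (Hpe _) Heta HPm1 HL0 Hkey
    (l - 1) S0 P _ (Nat.le_refl _) HP).
  + unfold Om; lra.
  + unfold S0.
    assert (1 <= J)%nat by (apply INR_le; rewrite HJ; simpl; lra).
    nia.
Qed.

(** * Fibonacci and Lucas numbers *)

(** The Lucas numbers F_(n-1) + F_(n+1), written so that no predecessor occurs. *)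
Definition luc (n : nat) : Z := (2 * fib (S n) - fib n)%Z.

Lemma fib_SS n : fib (S (S n)) = (fib (S n) + fib n)%Z.
Proof. reflexivity. Qed.

Lemma luc_SS n : luc (S (S n)) = (luc (S n) + luc n)%Z.
Proof. unfold luc; rewrite !fib_SS; ring. Qed.

Lemma nat_ind2 (P : nat -> Prop) : P 0%nat -> P 1%nat ->
  (forall n, P n -> P (S n) -> P (S (S n))) -> forall n, P n.
Proof.
intros H0 H1 HS n; enough (P n /\ P (S n)) by tauto.
induction n as [|n [IH1 IH2]]; split; auto.
Qed.

Lemma binet n : sqrt 5 * IZR (fib n) = al ^ n - be ^ n.
Proof.
induction n as [| |n IH1 IH2] using nat_ind2.
- simpl; ring.
- simpl; unfold al, be; field.
- rewrite fib_SS, plus_IZR, Rmult_plus_distr_l, IH1, IH2.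
  transitivity (al ^ n * (al + 1) - be ^ n * (be + 1)); [simpl; ring|].
  rewrite <- al_sq, <- be_sq; simpl; ring.
Qed.

Lemma luc_binet n : IZR (luc n) = al ^ n + be ^ n.
Proof.
induction n as [| |n IH1 IH2] using nat_ind2.
- change (luc 0) with 2%Z; simpl; lra.
- change (luc 1) with 1%Z; simpl; unfold al, be; lra.
- rewrite luc_SS, plus_IZR, IH1, IH2.
  transitivity (al ^ n * (al + 1) + be ^ n * (be + 1)); [simpl; ring|].
  rewrite <- al_sq, <- be_sq; simpl; ring.
Qed.

Lemma al_be_pow n : al ^ n * be ^ n = (-1) ^ n.
Proof. rewrite <- Rpow_mult_distr, al_be; reflexivity. Qed.

Lemma fib_pos n : (0 < fib (S n))%Z.
Proof.
enough (0 < fib (S n) /\ 0 < fib (S (S n)))%Z by tauto.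
induction n as [|n [IH1 IH2]]; [simpl; lia|].
split; [exact IH2|]; rewrite fib_SS; lia.
Qed.

Lemma fib_nonneg n : (0 <= fib n)%Z.
Proof. destruct n as [|n]; [reflexivity|]; generalize (fib_pos n); lia. Qed.

Lemma fib_lt n k : (2 <= n)%nat -> (n < k)%nat -> (fib n < fib k)%Z.
Proof.
intros Hn H; induction H as [|k H IH].
- destruct n as [|n]; [lia|]; rewrite fib_SS; destruct n as [|n]; [lia|].
  generalize (fib_pos n); lia.
- destruct k as [|k]; [lia|]; rewrite fib_SS; generalize (fib_nonneg k); lia.
Qed.

Lemma fib_le n k : (n <= k)%nat -> (fib n <= fib k)%Z.
Proof.
intros H; induction H as [|k H IH]; [lia|].
destruct k as [|k]; [simpl in *; generalize (fib_nonneg n); destruct n; [simpl; lia|lia]|].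
rewrite fib_SS; generalize (fib_nonneg k); lia.
Qed.

Lemma luc_pos n : (0 < luc n)%Z.
Proof.
unfold luc; destruct n as [|n]; [simpl; lia|].
rewrite fib_SS; generalize (fib_pos n) (fib_nonneg n); lia.
Qed.

Lemma al_gt_1 : 1 < al.
Proof. generalize al_bounds; lra. Qed.

Lemma al_pow_ge_1 n : 1 <= al ^ n.
Proof. apply pow_R1_Rle; generalize al_gt_1; lra. Qed.

Lemma fib_le_al n : IZR (fib (S n)) <= al ^ n.
Proof.
induction n as [| |n IH1 IH2] using nat_ind2.
- simpl; lra.
- simpl; generalize al_gt_1; lra.
- rewrite fib_SS, plus_IZR.
  replace (al ^ S (S n)) with (al ^ S n + al ^ n); [lra|].
  transitivity (al ^ n * (al + 1)); [simpl; ring|rewrite <- al_sq; simpl; ring].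
Qed.

Lemma fib_ge_al n : al ^ n <= al * IZR (fib (S n)).
Proof.
induction n as [| |n IH1 IH2] using nat_ind2.
- simpl; generalize al_gt_1; lra.
- simpl; lra.
- rewrite fib_SS, plus_IZR, Rmult_plus_distr_l.
  replace (al ^ S (S n)) with (al ^ S n + al ^ n); [lra|].
  transitivity (al ^ n * (al + 1)); [simpl; ring|rewrite <- al_sq; simpl; ring].
Qed.

Lemma be_pow_le n : Rabs (be ^ n) <= 1.
Proof.
rewrite <- RPow_abs, <- (pow1 n); apply pow_incr; split; [apply Rabs_pos|].
rewrite Rabs_left; generalize be_bounds; lra.
Qed.

Lemma luc_mod5 n : (luc n mod 5 = nth (n mod 4) [2; 1; 3; 4] 0)%Z.
Proof.
assert (H : forall k, (luc (4 * k) mod 5 = 2 /\ luc (S (4 * k)) mod 5 = 1)%Z).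
{ induction k as [|k [IH1 IH2]]; [split; reflexivity|].
  replace (4 * S k)%nat with (S (S (S (S (4 * k))))) by lia.
  rewrite !luc_SS; split; Z.div_mod_to_equations; lia. }
rewrite (Nat.div_mod_eq n 4) at 1; set (k := (n / 4)%nat).
assert (Hr := Nat.mod_upper_bound n 4 ltac:(lia)).
destruct (H k) as [H1 H2].
destruct (n mod 4)%nat as [|[|[|[|r]]]]; [| | | |lia].
- rewrite Nat.add_0_r; exact H1.
- replace (4 * k + 1)%nat with (S (4 * k)) by lia; exact H2.
- replace (4 * k + 2)%nat with (S (S (4 * k))) by lia; rewrite luc_SS; simpl nth; Z.div_mod_to_equations; lia.
- replace (4 * k + 3)%nat with (S (S (S (4 * k)))) by lia; rewrite !luc_SS; simpl nth; Z.div_mod_to_equations; lia.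
Qed.

Definition nma (a : nat) : Z := ((-1) ^ Z.of_nat a + 1 - luc a)%Z.

Lemma nma_spec a : (al ^ a - 1) * (be ^ a - 1) = IZR (nma a).
Proof.
unfold nma; rewrite minus_IZR, plus_IZR, luc_binet, <- pow_IZR.
transitivity (al ^ a * be ^ a + 1 - (al ^ a + be ^ a)); [ring|rewrite al_be_pow; reflexivity].
Qed.

(** Modulo 5 the Lucas numbers have period 2, 1, 3, 4, which makes the norm of [al^a - 1] prime to 5
    here. Five times that norm then contains 5 exactly once and is not a square. *)
Lemma nma_mod5 a : (a mod 4 <> 0)%nat -> ~ (5 | nma a)%Z.
Proof.
intros Ha Hd; apply Znumtheory.Zdivide_mod in Hd.
assert (Hl := luc_mod5 a); unfold nma in Hd.
assert (Hr := Nat.mod_upper_bound a 4 ltac:(lia)).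
assert (Hs : ((-1) ^ Z.of_nat a = if Nat.even a then 1 else -1)%Z).
{ clear; induction a as [|a IH]; [reflexivity|].
  rewrite Nat2Z.inj_succ, Z.pow_succ_r, IH, Nat.even_succ, <- Nat.negb_even by lia.
  destruct (Nat.even a); reflexivity. }
rewrite Hs in Hd.
assert (He : Nat.even a = Nat.even (a mod 4)).
{ rewrite (Nat.div_mod_eq a 4) at 1; rewrite Nat.even_add, Nat.even_mul; simpl Nat.even at 1.
  destruct (Nat.even (a mod 4)); reflexivity. }
rewrite He in Hd.
destruct (a mod 4)%nat as [|[|[|[|r]]]]; [lia| | | |lia]; simpl nth in Hl; simpl Nat.even in Hd; cbv iota in Hd.
all: Z.div_mod_to_equations; lia.
Qed.

Lemma nonsq_mul_sq K k : k <> 0%Z -> nonsq K -> nonsq (K * (k * k)).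
Proof.
intros Hk HK p q H; assert (k * q = 0)%Z; [|nia].
apply (HK p (k * q)%Z); rewrite H; ring.
Qed.

Lemma nonsq_5mul k : ~ (5 | k)%Z -> nonsq (5 * k).
Proof.
intros Hk p q H.
assert (Hp : (5 | p)%Z).
{ assert (Hpp : (5 | p * p)%Z) by (rewrite H, <- Z.mul_assoc; apply Z.divide_factor_l).
  apply prime_mult in Hpp; [tauto|exact prime_5]. }
destruct Hp as [p' ->].
assert (p' = 0)%Z by (apply (prime_sq_zero 5 k q p' prime_5 Hk); nia).
subst p'; assert (k <> 0)%Z by (intros ->; apply Hk; exists 0%Z; reflexivity); nia.
Qed.

(** The factor 3 multiplies the norm by 9 and the factor [al] by -1, so two tests on [N] settle the
    four conditions. *)
Lemma NS4 c c' N : inO c c' -> c * c' = IZR N -> nonsq N -> nonsq (- N) ->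
  NS Q0 c /\ NS Q0 (3 * c) /\ NS Q0 (al * c) /\ NS Q0 (al * (3 * c)).
Proof.
intros Hc HN N1 N2.
assert (O3 : inO (3 * c) (3 * c')) by (apply inO_mul; [apply (inO_IZR 3)|exact Hc]).
repeat split.
- apply (Q0_NS c c' N Hc HN N1).
- apply (Q0_NS _ _ (N * (3 * 3)) O3); [rewrite !mult_IZR, <- HN; ring|].
  apply nonsq_mul_sq; [lia|exact N1].
- apply (Q0_NS _ (be * c') (- N)); [apply inO_mul; [exact inO_al|exact Hc]| |exact N2].
  rewrite opp_IZR, <- HN; transitivity (al * be * (c * c')); [ring|rewrite al_be; ring].
- apply (Q0_NS _ (be * (3 * c')) (- N * (3 * 3))); [apply inO_mul; [exact inO_al|exact O3]| |].
  + rewrite !mult_IZR, opp_IZR, <- HN.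
    transitivity (al * be * (9 * (c * c'))); [ring|rewrite al_be; ring].
  + apply nonsq_mul_sq; [lia|exact N2].
Qed.

(** * The linear forms *)

(** Apply ln t <= t - 1 to X/Y and to Y/X; the latter is at most 1 + 2d because d <= 1/2. *)
Lemma ln_near X Y d : 0 < Y -> d <= / 2 -> Rabs (X - Y) <= d * Y -> Rabs (ln X - ln Y) <= 2 * d.
Proof.
intros HY Hd H; apply Rabs_le_inv in H.
assert (HX : 0 < X) by nra.
assert (Hln : forall t, 0 < t -> ln t <= t - 1).
{ intros t Ht; apply ln_le_of_exp; [exact Ht|].
  generalize (exp_ineq1_le (t - 1)); lra. }
assert (Hd0 : 0 <= d) by nra.
assert (H1 := Hln (X / Y) ltac:(apply Rdiv_lt_0_compat; assumption)).
assert (H2 := Hln (Y / X) ltac:(apply Rdiv_lt_0_compat; assumption)).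
unfold Rdiv in H1, H2; rewrite ln_mult, ln_Rinv in H1, H2 by (try apply Rinv_0_lt_compat; assumption).
assert (E1 : X * / Y <= 1 + d).
{ apply Rmult_le_reg_r with Y; [exact HY|]; rewrite Rmult_assoc, Rinv_l by lra; lra. }
assert (E2 : Y * / X <= 1 + 2 * d).
{ apply Rmult_le_reg_r with X; [exact HX|]; rewrite Rmult_assoc, Rinv_l by lra; nra. }
apply Rabs_le; lra.
Qed.

Section LinearForms.

Variables (n1 a m1 b : nat).
Hypotheses (Hn1 : (2 <= n1)%nat) (Ha : (1 <= a)%nat) (Hb : (1 <= b)%nat).
Hypothesis Heq :
  (fib (n1 + a) - fib n1 = 3 ^ Z.of_nat (m1 + b) - 3 ^ Z.of_nat m1)%Z.

Let n := (n1 + a)%nat.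
Let m := (m1 + b)%nat.

Definition Del : R := 3 ^ m - 3 ^ m1.

Lemma HeqR : IZR (fib n) - IZR (fib n1) = Del.
Proof.
unfold Del; rewrite !pow_IZR, <- !minus_IZR; f_equal; exact Heq.
Qed.

Lemma Del_eq : Del = 3 ^ m1 * (3 ^ b - 1).
Proof. unfold Del, m; rewrite pow_add; ring. Qed.

Lemma pow3_ge_3 : 3 <= 3 ^ b.
Proof. rewrite <- (pow_1 3) at 1; apply Rle_pow; [lra|exact Hb]. Qed.

Lemma Del_bounds : 2 * 3 ^ m <= 3 * Del /\ Del <= 3 ^ m /\ 0 < Del.
Proof.
assert (H := pow3_ge_3); assert (H1 : 0 < 3 ^ m1) by (apply pow_lt; lra).
rewrite Del_eq; unfold m; rewrite pow_add; repeat split; nra.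
Qed.

Lemma al4 : al ^ 4 < 686 / 100.
Proof.
assert (H := al_bounds).
replace (al ^ 4) with ((al * al) * (al * al)) by ring; rewrite al_sq; nra.
Qed.

(** As n1 <= n - 1, the difference of the two Fibonacci numbers is at least F_(n-2). *)
Lemma al_n_le : al ^ n <= al ^ 4 * Del.
Proof.
assert (Hb0 := al_gt_1).
assert (H : al ^ n <= al ^ 4 * IZR (fib (n - 2))).
{ unfold n; destruct (n1 + a)%nat as [|[|[|k]]] eqn:E; [lia|lia|lia|].
  replace (S (S (S k)) - 2)%nat with (S k) by lia.
  replace (al ^ S (S (S k))) with (al ^ 3 * al ^ k) by (simpl; ring).
  replace (al ^ 4) with (al ^ 3 * al) by ring.
  rewrite Rmult_assoc; apply Rmult_le_compat_l; [apply pow_le; lra|apply fib_ge_al]. }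
eapply Rle_trans; [exact H|]; apply Rmult_le_compat_l; [apply pow_le; lra|].
rewrite <- HeqR, <- minus_IZR; apply IZR_le.
assert (Hle : (fib n1 <= fib (n - 1))%Z) by (apply fib_le; unfold n; lia).
assert (E : fib n = (fib (n - 1) + fib (n - 2))%Z).
{ unfold n; destruct (n1 + a)%nat as [|[|k]] eqn:Ek; [lia|lia|].
  replace (S (S k) - 1)%nat with (S k) by lia; replace (S (S k) - 2)%nat with k by lia.
  apply fib_SS. }
lia.
Qed.

Lemma fib_n1_le : IZR (fib n1) * al ^ a <= 424 / 100 * Del.
Proof.
assert (Hb0 := al_bounds).
assert (H : IZR (fib n1) * al <= al ^ n1).
{ destruct n1 as [|k]; [lia|]; simpl pow; rewrite Rmult_comm.
  apply Rmult_le_compat_l; [lra|apply fib_le_al]. }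
assert (Hn := al_n_le); unfold n in Hn; rewrite pow_add in Hn.
assert (Hpa : 0 < al ^ a) by (apply pow_lt; lra).
assert (HD := proj2 (proj2 Del_bounds)).
replace (al ^ 4) with (al * al ^ 3) in Hn by ring.
assert (H3 : al ^ 3 <= 424 / 100).
{ replace (al ^ 3) with ((al * al) * al) by ring; rewrite al_sq; nra. }
assert (H4 : IZR (fib n1) * al ^ a * al <= al * al ^ 3 * Del).
{ apply Rle_trans with (al ^ n1 * al ^ a); [|exact Hn].
  replace (IZR (fib n1) * al ^ a * al) with (IZR (fib n1) * al * al ^ a) by ring.
  apply Rmult_le_compat_r; lra. }
assert (IZR (fib n1) * al ^ a <= al ^ 3 * Del).
{ apply Rmult_le_reg_r with al; lra. }
nra.
Qed.

Lemma fib_n1_ge : 1 <= IZR (fib n1).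
Proof. apply (IZR_le 1); destruct n1 as [|k]; [lia|]; generalize (fib_pos k); lia. Qed.

Lemma m_le_n : (m <= n)%nat.
Proof.
assert (H : 2 * 3 ^ m <= 3 * al ^ (n - 1)).
{ eapply Rle_trans; [apply (proj1 Del_bounds)|].
  apply Rmult_le_compat_l; [lra|]; rewrite <- HeqR.
  assert (H1 := fib_n1_ge).
  assert (H2 := fib_le_al (n - 1)); replace (S (n - 1)) with n in H2 by (unfold n; lia); lra. }
apply Nat.nlt_ge; intros Hlt.
assert (H1 : al ^ (n - 1) <= 3 ^ (n - 1)) by (apply pow_incr; generalize al_bounds; lra).
assert (H2 : 3 ^ S (n - 1) <= 3 ^ m) by (apply Rle_pow; [lra|unfold n in *; lia]).
assert (0 < 3 ^ (n - 1)) by (apply pow_lt; lra).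
simpl in H2; lra.
Qed.

Lemma s5_pos : 0 < sqrt 5.
Proof. generalize sqrt5_bounds; lra. Qed.

(** Both lower terms, the Fibonacci number at [n1] and 3^m1, are discarded; [E] is a common lower
    bound for the two ratios this requires to be large. *)
Lemma form1 E : 26 <= E -> E <= al ^ a -> E <= 3 ^ b ->
  Rabs (INR n * ln al - INR m * ln 3 - ln (sqrt 5)) <= 13 / E.
Proof.
intros HE HEa HEb.
assert (B5 := sqrt5_bounds); assert (Ba := al_bounds).
destruct Del_bounds as (D1 & D2 & D3).
assert (P3 : 0 < 3 ^ m) by (apply pow_lt; lra).
replace (INR n * ln al - INR m * ln 3 - ln (sqrt 5)) with (ln (al ^ n) - ln (sqrt 5 * 3 ^ m)).
2:{ rewrite ln_mult, !ln_pow by lra; ring. }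
replace (13 / E) with (2 * (13 / 2 / E)) by (field; lra).
apply ln_near; [nra| |].
{ apply Rmult_le_reg_r with E; [lra|]; unfold Rdiv; rewrite Rmult_assoc, Rinv_l by lra; lra. }
assert (HX : al ^ n - sqrt 5 * 3 ^ m = sqrt 5 * (IZR (fib n1) - 3 ^ m1) + be ^ n).
{ assert (H := HeqR); unfold Del in H; assert (Hbn := binet n); nra. }
rewrite HX.
assert (HF := fib_n1_le); assert (HF1 := fib_n1_ge); assert (Hbe := be_pow_le n).
assert (F1 : IZR (fib n1) * E <= 424 / 100 * 3 ^ m) by nra.
assert (F2 : 3 ^ m1 * E <= 3 ^ m).
{ unfold m; rewrite pow_add; assert (0 < 3 ^ m1) by (apply pow_lt; lra); nra. }
assert (P1 : 1 <= 3 ^ m1) by (apply pow_R1_Rle; lra).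
apply Rmult_le_reg_r with E; [lra|].
replace (13 / 2 / E * (sqrt 5 * 3 ^ m) * E) with (13 / 2 * (sqrt 5 * 3 ^ m)) by (field; lra).
assert (H0 : Rabs (sqrt 5 * (IZR (fib n1) - 3 ^ m1) + be ^ n) <= sqrt 5 * (IZR (fib n1) + 3 ^ m1)).
{ apply Rabs_le_inv in Hbe; apply Rabs_le; split; nra. }
apply Rle_trans with (sqrt 5 * (IZR (fib n1) + 3 ^ m1) * E); [apply Rmult_le_compat_r; lra|].
nra.
Qed.

Lemma be_n1_small : Rabs (be ^ n1 * (be ^ a - 1)) <= 1.
Proof.
assert (Bb := be_bounds).
assert (H : Rabs (be ^ n1) <= / 2).
{ destruct n1 as [|[|k]]; [lia|lia|].
  replace (be ^ S (S k)) with ((be + 1) * be ^ k) by (rewrite <- be_sq; simpl; ring).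
  assert (Hk := be_pow_le k); rewrite Rabs_mult, (Rabs_right (be + 1)) by lra.
  assert (0 <= Rabs (be ^ k)) by apply Rabs_pos; nra. }
assert (H2 : Rabs (be ^ a - 1) <= 2).
{ assert (Hk := be_pow_le a); apply Rabs_le_inv in Hk; apply Rabs_le; lra. }
rewrite Rabs_mult; assert (H3 := Rabs_pos (be ^ n1)); assert (H4 := Rabs_pos (be ^ a - 1)); nra.
Qed.

Lemma al_a_pos : 0 < al ^ a - 1.
Proof.
assert (H := al_gt_1); assert (al <= al ^ a); [|lra].
rewrite <- (pow_1 al) at 1; apply Rle_pow; [lra|exact Ha].
Qed.

Lemma binet_diff : al ^ n1 * (al ^ a - 1) = sqrt 5 * Del + be ^ n1 * (be ^ a - 1).
Proof.
rewrite <- HeqR; assert (B1 := binet n); assert (B2 := binet n1).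
unfold n in *; rewrite !pow_add in B1; lra.
Qed.

(** Only 3^m1 is discarded and the two Fibonacci numbers stay together, so the error is governed by
    [b] alone. *)
Lemma form2a :
  Rabs (INR n1 * ln al - INR m * ln 3 - (ln (sqrt 5) - ln (al ^ a - 1))) <= 3 / 3 ^ b.
Proof.
assert (B5 := sqrt5_bounds); assert (Ba := al_bounds); assert (H3 := pow3_ge_3).
assert (Hal := al_a_pos); assert (Hbe := be_n1_small).
assert (P3 : 0 < 3 ^ m) by (apply pow_lt; lra).
replace (INR n1 * ln al - INR m * ln 3 - (ln (sqrt 5) - ln (al ^ a - 1))) with
  (ln (al ^ n1 * (al ^ a - 1)) - ln (sqrt 5 * 3 ^ m)).
2:{ rewrite !ln_mult, !ln_pow by (try apply pow_lt; lra); ring. }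
replace (3 / 3 ^ b) with (2 * (3 / 2 / 3 ^ b)) by (field; lra).
apply ln_near; [nra| |].
{ apply Rmult_le_reg_r with (3 ^ b); [lra|].
  unfold Rdiv; rewrite Rmult_assoc, Rinv_l by lra; lra. }
rewrite binet_diff; unfold Del.
assert (P1 : 1 <= 3 ^ m1) by (apply pow_R1_Rle; lra).
replace (3 / 2 / 3 ^ b * (sqrt 5 * 3 ^ m)) with (3 / 2 * (sqrt 5 * 3 ^ m1)).
2:{ unfold m; rewrite pow_add; field; lra. }
apply Rabs_le_inv in Hbe; apply Rabs_le; split; nra.
Qed.

(** The mirror case: the powers of 3 stay together and the smaller Fibonacci number is discarded. *)
Lemma form2b : 13 <= al ^ a ->
  Rabs (INR n * ln al - INR m1 * ln 3 - (ln (sqrt 5 * (3 ^ b - 1)))) <= 13 / al ^ a.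
Proof.
intros HE.
assert (B5 := sqrt5_bounds); assert (Ba := al_bounds); assert (H3 := pow3_ge_3).
destruct Del_bounds as (D1 & D2 & D3).
replace (INR n * ln al - INR m1 * ln 3 - ln (sqrt 5 * (3 ^ b - 1))) with
  (ln (al ^ n) - ln (sqrt 5 * Del)).
2:{ rewrite Del_eq, !ln_mult, !ln_pow by (try apply Rmult_lt_0_compat; try apply pow_lt; lra); ring. }
replace (13 / al ^ a) with (2 * (13 / 2 / al ^ a)) by (field; lra).
apply ln_near; [nra| |].
{ apply Rmult_le_reg_r with (al ^ a); [lra|].
  unfold Rdiv; rewrite Rmult_assoc, Rinv_l by lra; lra. }
assert (HX : al ^ n - sqrt 5 * Del = sqrt 5 * IZR (fib n1) + be ^ n).
{ assert (H := HeqR); assert (Hbn := binet n); nra. }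
rewrite HX.
assert (HF := fib_n1_le); assert (HF1 := fib_n1_ge); assert (Hbe := be_pow_le n).
apply Rmult_le_reg_r with (al ^ a); [lra|].
replace (13 / 2 / al ^ a * (sqrt 5 * Del) * al ^ a) with (13 / 2 * (sqrt 5 * Del)) by (field; lra).
assert (H0 : Rabs (sqrt 5 * IZR (fib n1) + be ^ n) <= 3 / 2 * sqrt 5 * IZR (fib n1)).
{ apply Rabs_le_inv in Hbe; apply Rabs_le; split; nra. }
apply Rle_trans with (3 / 2 * sqrt 5 * IZR (fib n1) * al ^ a); [apply Rmult_le_compat_r; lra|].
nra.
Qed.

(** Nothing is discarded except the powers of [be] in Binet's formula, of total size at most 1. *)
Lemma form3 : 7 <= al ^ n ->
  Rabs (INR n1 * ln al - INR m1 * ln 3 - (ln (sqrt 5 * (3 ^ b - 1)) - ln (al ^ a - 1))) <= 7 / al ^ n.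
Proof.
intros HE.
assert (B5 := sqrt5_bounds); assert (Ba := al_bounds); assert (H3 := pow3_ge_3).
assert (Hal := al_a_pos); assert (Hbe := be_n1_small).
destruct Del_bounds as (D1 & D2 & D3).
replace (INR n1 * ln al - INR m1 * ln 3 - (ln (sqrt 5 * (3 ^ b - 1)) - ln (al ^ a - 1))) with
  (ln (al ^ n1 * (al ^ a - 1)) - ln (sqrt 5 * Del)).
2:{ rewrite Del_eq, !ln_mult, !ln_pow by (try apply Rmult_lt_0_compat; try apply pow_lt; lra); ring. }
replace (7 / al ^ n) with (2 * (7 / 2 / al ^ n)) by (field; lra).
apply ln_near; [nra| |].
{ apply Rmult_le_reg_r with (al ^ n); [lra|].
  unfold Rdiv; rewrite Rmult_assoc, Rinv_l by lra; lra. }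
rewrite binet_diff.
replace (sqrt 5 * Del + be ^ n1 * (be ^ a - 1) - sqrt 5 * Del) with (be ^ n1 * (be ^ a - 1)) by ring.
eapply Rle_trans; [exact Hbe|].
apply Rmult_le_reg_r with (al ^ n); [lra|].
replace (7 / 2 / al ^ n * (sqrt 5 * Del) * al ^ n) with (7 / 2 * (sqrt 5 * Del)) by (field; lra).
assert (H := al_n_le); assert (H4 := al4); nra.
Qed.

End LinearForms.

(** * Powers of 3 dividing Fibonacci numbers *)

Fixpoint fibmod (M : Z) (n : nat) : Z * Z :=
  match n with
  | O => (0, 1 mod M)%Z
  | S k => let (x, y) := fibmod M k in (y, (x + y) mod M)%Z
  end.

Lemma fibmod_spec M n : (0 < M)%Z -> fibmod M n = (fib n mod M, fib (S n) mod M)%Z.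
Proof.
intros HM; induction n as [|n IH]; [reflexivity|].
change (fibmod M (S n)) with (let (x, y) := fibmod M n in (y, (x + y) mod M)%Z).
rewrite IH, fib_SS; f_equal; rewrite Z.add_comm, Z.add_mod_idemp_l, Z.add_mod_idemp_r; lia.
Qed.

Lemma fib_period M P : (0 < M)%Z -> fibmod M P = (0, 1 mod M)%Z ->
  forall n, (fib n mod M = fib (n mod P) mod M)%Z.
Proof.
intros HM HP.
rewrite fibmod_spec in HP by exact HM; injection HP as H0 H1.
assert (Hstep : forall n, (fib (n + P) mod M = fib n mod M)%Z).
{ intros n; induction n as [| |n IH1 IH2] using nat_ind2.
  - rewrite Z.mod_0_l by lia; exact H0.
  - exact H1.
  - change (S (S n) + P)%nat with (S (S (n + P))); change (S n + P)%nat with (S (n + P)) in IH2.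
    rewrite !fib_SS, (Z.add_mod _ (fib (n + P))), (Z.add_mod _ (fib n)), IH1, IH2 by lia.
    reflexivity. }
intros n; destruct (Nat.eq_dec P 0) as [->|HP0].
{ rewrite Nat.mod_0_r; reflexivity. }
rewrite (Nat.div_mod_eq n P) at 1; induction (n / P)%nat as [|q IH].
- rewrite Nat.mul_0_r; reflexivity.
- replace (P * S q + n mod P)%nat with (P * q + n mod P + P)%nat by lia.
  rewrite Hstep; exact IH.
Qed.

(** Modulo 9 the period is 24, and a check over one period finds zeros only at multiples of 12. *)
Lemma fib_9_12 k : (9 | fib k)%Z -> (k mod 12 = 0)%nat.
Proof.
intros H; apply Znumtheory.Zdivide_mod in H.
rewrite (fib_period 9 24) in H by (reflexivity || lia).
assert (Hr := Nat.mod_upper_bound k 24 ltac:(lia)).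
assert (Hc : forallb (fun r => implb (Z.eqb (fst (fibmod 9 r)) 0) (Nat.eqb (r mod 12) 0)) (seq 0 24) = true)
  by reflexivity.
rewrite forallb_forall in Hc; specialize (Hc (k mod 24)%nat ltac:(apply in_seq; lia)).
rewrite fibmod_spec in Hc by lia; cbn [fst] in Hc; rewrite H in Hc; cbn [Z.eqb implb] in Hc.
apply Nat.eqb_eq in Hc.
rewrite (Nat.div_mod_eq k 24); replace (24 * (k / 24))%nat with ((2 * (k / 24)) * 12)%nat by lia.
rewrite Nat.add_comm, Nat.Div0.mod_add; exact Hc.
Qed.

Lemma fib_4_3 k : (3 | fib (4 * k))%Z.
Proof.
apply Znumtheory.Zmod_divide; [lia|].
rewrite (fib_period 3 8) by (reflexivity || lia).
replace ((4 * k) mod 8)%nat with (4 * (k mod 2))%nat.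
2:{ replace 8%nat with (4 * 2)%nat by lia; rewrite Nat.Div0.mul_mod_distr_l; reflexivity. }
assert (Hr := Nat.mod_upper_bound k 2 ltac:(lia)).
destruct (k mod 2)%nat as [|[|r]]; [reflexivity|reflexivity|lia].
Qed.

Lemma fib_triple k : Nat.Even k ->
  (fib (3 * k) = fib k * (5 * (fib k * fib k) + 3))%Z.
Proof.
intros [i Hi]; apply eq_IZR; rewrite mult_IZR, plus_IZR, !mult_IZR.
assert (B5 := s5_pos).
apply (Rmult_eq_reg_l (sqrt 5)); [|lra].
rewrite binet; replace (3 * k)%nat with (k + k + k)%nat by lia; rewrite !pow_add.
assert (Hab : al ^ k * be ^ k = 1).
{ rewrite al_be_pow, Hi; apply pow_1_even. }
assert (Hb := binet k); set (x := al ^ k) in *; set (y := be ^ k) in *; set (F := IZR (fib k)) in *.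
assert (H5 : 5 * (F * F) = (x - y) * (x - y)).
{ rewrite <- Hb; transitivity (sqrt 5 * sqrt 5 * (F * F)); [rewrite sqrt5_sq; ring|ring]. }
rewrite H5, <- Rmult_assoc, Hb.
transitivity ((x - y) * ((x - y) * (x - y) + 3 * (x * y))); [ring|rewrite Hab; ring].
Qed.

(** Lifting the exponent: if 9 divides F_k then k = 3k' with 4 | k', so 3 | F_k', and the cofactor 5
    F_k'^2 + 3 contains 3 exactly once. Dividing the index by 3 thus removes one factor 3. *)
Lemma pow3_dvd_fib k : (0 < k)%nat -> forall j, (3 ^ Z.of_nat j | fib k)%Z ->
  (3 ^ Z.of_nat j <= 3 * Z.of_nat k)%Z.
Proof.
induction k as [k IH] using (well_founded_induction lt_wf); intros Hk j Hj.
destruct j as [|[|j]]; [change (3 ^ Z.of_nat 0)%Z with 1%Z; lia|change (3 ^ Z.of_nat 1)%Z with 3%Z; lia|].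
assert (H9 : (9 | fib k)%Z).
{ eapply Z.divide_trans; [|exact Hj]; exists (3 ^ Z.of_nat j)%Z.
  rewrite !Nat2Z.inj_succ, !Z.pow_succ_r by lia; ring. }
apply fib_9_12 in H9.
assert (Ek : k = (3 * (4 * (k / 12)))%nat).
{ assert (E := Nat.div_mod_eq k 12); rewrite H9 in E; lia. }
set (k' := (4 * (k / 12))%nat) in *.
destruct (fib_4_3 (k / 12)) as [f Hf]; fold k' in Hf.
assert (Hev : Nat.Even k') by (exists (2 * (k / 12))%nat; unfold k'; lia).
assert (Hlt : (k' < k)%nat) by lia.
assert (H3 : (3 ^ Z.of_nat (S j) | fib k')%Z).
{ rewrite Ek, (fib_triple k' Hev) in Hj.
  rewrite Hf in Hj |- * .
  replace (f * 3 * (5 * (f * 3 * (f * 3)) + 3))%Z with (3 * (f * 3 * (15 * (f * f) + 1)))%Z in Hj by ring.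
  rewrite (Nat2Z.inj_succ (S j)), Z.pow_succ_r in Hj by lia.
  apply Z.mul_divide_cancel_l in Hj; [|lia].
  rewrite Z.mul_comm in Hj; apply Gauss with (15 * (f * f) + 1)%Z; [exact Hj|].
  apply rel_prime_sym, rel_prime_Zpower_r; [lia|].
  apply rel_prime_sym, prime_rel_prime; [exact prime_3|].
  intros [q Hq]; lia. }
specialize (IH k' Hlt ltac:(lia) (S j) H3).
rewrite (Nat2Z.inj_succ (S j)), Z.pow_succ_r by lia; lia.
Qed.

Lemma fib_double e : (fib (2 * e) = fib e * luc e)%Z.
Proof.
apply eq_IZR; rewrite mult_IZR; assert (B5 := s5_pos).
apply (Rmult_eq_reg_l (sqrt 5)); [|lra].
rewrite <- Rmult_assoc, !binet, luc_binet; replace (2 * e)%nat with (e + e)%nat by lia.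
rewrite !pow_add; ring.
Qed.

Lemma pow3_dvd_luc e : (0 < e)%nat -> forall j, (3 ^ Z.of_nat j | luc e)%Z ->
  (3 ^ Z.of_nat j <= 6 * Z.of_nat e)%Z.
Proof.
intros He j Hj.
assert (H := pow3_dvd_fib (2 * e) ltac:(lia) j); rewrite fib_double in H.
specialize (H ltac:(apply Z.divide_mul_r, Hj)); lia.
Qed.

Lemma pow3_split m : forall A B, (3 ^ Z.of_nat m | A * B)%Z ->
  exists i j, (i + j = m)%nat /\ (3 ^ Z.of_nat i | A)%Z /\ (3 ^ Z.of_nat j | B)%Z.
Proof.
induction m as [|m IH]; intros A B H.
- exists 0%nat, 0%nat; repeat split; apply Z.divide_1_l.
- rewrite Nat2Z.inj_succ, Z.pow_succ_r in H by lia.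
  assert (H3 : (3 | A * B)%Z) by (eapply Z.divide_trans; [apply Z.divide_factor_l|exact H]).
  apply prime_mult in H3; [|exact prime_3]; destruct H3 as [[A' ->]|[B' ->]].
  + replace (A' * 3 * B)%Z with (3 * (A' * B))%Z in H by ring.
    apply Z.mul_divide_cancel_l in H; [|lia].
    destruct (IH _ _ H) as (i & j & Hij & Hi & Hj); exists (S i), j; split; [lia|].
    split; [|exact Hj]; rewrite Nat2Z.inj_succ, Z.pow_succ_r, Z.mul_comm by lia.
    apply Z.mul_divide_mono_r, Hi.
  + replace (A * (B' * 3))%Z with (3 * (A * B'))%Z in H by ring.
    apply Z.mul_divide_cancel_l in H; [|lia].
    destruct (IH _ _ H) as (i & j & Hij & Hi & Hj); exists i, (S j); split; [lia|].
    split; [exact Hi|]; rewrite Nat2Z.inj_succ, Z.pow_succ_r, Z.mul_comm by lia.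
    apply Z.mul_divide_mono_r, Hj.
Qed.

Lemma fib_diff_even n1 d : Nat.Even d ->
  (fib (n1 + 2 * d) - fib n1 = fib d * luc (n1 + d))%Z.
Proof.
intros [i Hi]; apply eq_IZR; rewrite minus_IZR, mult_IZR, luc_binet; assert (B5 := s5_pos).
apply (Rmult_eq_reg_l (sqrt 5)); [|lra].
rewrite Rmult_minus_distr_l, <- Rmult_assoc, !binet.
assert (Hab : al ^ d * be ^ d = 1) by (rewrite al_be_pow, Hi; apply pow_1_even).
replace (n1 + 2 * d)%nat with (n1 + d + d)%nat by lia; rewrite !pow_add.
set (x := al ^ d) in *; set (y := be ^ d) in *; set (u := al ^ n1); set (v := be ^ n1).
transitivity (u * x * x - v * y * y - u * (x * y) + v * (x * y)); [rewrite Hab; ring|ring].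
Qed.

(** * Rational multipliers *)

Lemma square_of_ratio p q r : q <> 0%Z -> (p * p = r * (q * q))%Z -> exists y, (r = y * y)%Z.
Proof.
intros Hq H.
assert (Hg := Z.gcd_nonneg p q).
assert (Hg0 : Z.gcd p q <> 0%Z) by (intros Hc; apply Hq, (Z.gcd_eq_0_r p q Hc)).
destruct (Z.gcd_divide_l p q) as [p' Hp]; destruct (Z.gcd_divide_r p q) as [q' Hq'].
assert (Hc : Z.gcd p' q' = 1%Z).
{ apply (Z.mul_reg_r _ _ (Z.gcd p q)); [exact Hg0|].
  rewrite Z.mul_1_l, <- (Z.abs_eq (Z.gcd p q)) at 1 by exact Hg.
  rewrite <- Z.gcd_mul_mono_r, <- Hp, <- Hq'; reflexivity. }
set (g := Z.gcd p q) in *.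
assert (H1 : (p' * p' = r * (q' * q'))%Z).
{ apply (Z.mul_reg_r _ _ (g * g)); [nia|]; rewrite Hp, Hq' in H; lia. }
assert (Hd : (q' | p')%Z).
{ apply Z.gauss with p'; [exists (r * q')%Z; lia|rewrite Z.gcd_comm; exact Hc]. }
destruct Hd as [y Hy].
exists y; apply (Z.mul_reg_r _ _ (q' * q')).
- assert (q' <> 0)%Z by (intros ->; apply Hq; rewrite Hq'; ring); nia.
- rewrite <- H1, Hy; ring.
Qed.

Lemma not_square_nonsq r : (forall y, r <> (y * y)%Z) -> nonsq r.
Proof.
intros Hr p q H; destruct (Z.eq_dec q 0) as [Hq|Hq]; [exact Hq|].
destruct (square_of_ratio p q r Hq H) as [y Hy]; destruct (Hr y Hy).
Qed.

(** As for [ns_3], the number p + q al must have a rational square, so q = 0 or q = -2p. The second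
    makes it -p sqrt 5, which is why [5 * k] is tested too. *)
Lemma NS_IZR k : nonsq k -> nonsq (5 * k) -> NS Q0 (IZR k).
Proof.
intros Hk Hk5 x y Hx Hy (x' & Ox & _) (y' & Oy & _) Heq.
destruct (inO_norm y y' Oy) as (t & Ht & Ht0).
assert (Oz : inO (x * y') (x' * y)).
{ apply inO_mul; [exact Ox|]; destruct Oy as (p & q & -> & ->).
  exists (p + q)%Z, (- q)%Z; rewrite plus_IZR, opp_IZR.
  replace be with (1 - al) by (unfold al, be; lra); split; ring. }
destruct Oz as (p & q & Ez & _).
assert (H0 : inO (IZR (p * p + q * q - k * t * t) + IZR (2 * p * q + q * q) * al)
              (IZR (p * p + q * q - k * t * t) + IZR (2 * p * q + q * q) * be)).
{ eexists; eexists; split; reflexivity. }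
assert (V0 : IZR (p * p + q * q - k * t * t) + IZR (2 * p * q + q * q) * al = 0).
{ rewrite minus_IZR, !plus_IZR, !mult_IZR, <- Ht.
  transitivity ((IZR p + IZR q * al) * (IZR p + IZR q * al) - IZR k * (y * y') * (y * y')
     - IZR q * IZR q * (al * al - al - 1)); [ring|].
  rewrite al_sq, <- Ez.
  transitivity ((x * x - IZR k * (y * y)) * (y' * y')); [ring|rewrite Heq; ring]. }
assert (V1 := inO_conj_zero _ _ H0 V0).
assert (Hab : al - be <> 0) by (assert (B1 := al_bounds); assert (B2 := be_bounds); lra).
assert (Hq : IZR (2 * p * q + q * q) = 0) by (apply (Rmult_eq_reg_r (al - be)); [lra|exact Hab]).
rewrite Hq in V0.
assert (Hp : IZR (p * p + q * q - k * t * t) = 0) by lra.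
apply eq_IZR in Hq; apply eq_IZR in Hp.
apply Ht0.
assert (q = 0 \/ q = -2 * p)%Z as [->| ->] by nia.
- apply (Hk p t); lia.
- apply (Hk5 (5 * p)%Z t); lia.
Qed.

(* Extracting the maximal power [c] makes the four nonsquare conditions of [baker] hold
   for [g]. *)
Lemma rational_multiplier (r : nat) : (0 < r)%nat -> (forall j, r <> 3 ^ j)%nat ->
  exists j c g g', (0 < c)%nat /\ 2 <= g /\ Rabs g' = g /\ inO g g' /\
    INR r = 3 ^ j * g ^ c /\
    NS Q0 g /\ NS Q0 (3 * g) /\ NS Q0 (al * g) /\ NS Q0 (al * (3 * g)).
Proof.
induction r as [r IH] using (well_founded_induction lt_wf); intros Hr H3.
assert (B5 := sqrt5_bounds).
assert (Hsq : forall y, (0 < y)%nat -> exists g g', 2 <= g /\ Rabs g' = g /\ inO g g' /\ g * g = 5 * (INR y * INR y) /\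
    NS Q0 g /\ NS Q0 (3 * g) /\ NS Q0 (al * g) /\ NS Q0 (al * (3 * g))).
{ intros y Hy; assert (Hy1 : 1 <= INR y) by (apply (le_INR 1); lia).
  assert (HO : inO (sqrt 5 * INR y) (- sqrt 5 * INR y)).
  { apply inO_mul; [exact inO_sqrt5|rewrite INR_IZR_INZ; apply inO_IZR]. }
  exists (sqrt 5 * INR y), (- sqrt 5 * INR y); split; [nra|].
  split; [rewrite Rabs_left; nra|]; split; [exact HO|].
  split; [transitivity (sqrt 5 * sqrt 5 * (INR y * INR y)); [ring|rewrite sqrt5_sq; ring]|].
  apply (NS4 _ _ (- (5 * (Z.of_nat y * Z.of_nat y))) HO).
  - rewrite opp_IZR, !mult_IZR, <- INR_IZR_INZ.
    transitivity (- (sqrt 5 * sqrt 5) * (INR y * INR y)); [ring|rewrite sqrt5_sq; ring].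
  - apply nonsq_neg; nia.
  - rewrite Z.opp_involutive; apply nonsq_mul_sq; [lia|exact nonsq_5]. }
destruct (classic (exists y, r = y * y)%nat) as [[y Hy]|Ha].
{ destruct (IH y) as (j & c & g & g' & Hc & Hg & Hg' & HO & He & HN).
  - destruct (Nat.eq_dec y 1) as [->|]; [destruct (H3 0%nat); rewrite Hy; reflexivity|nia].
  - nia.
  - intros j Hj; apply (H3 (j + j)%nat); rewrite Nat.pow_add_r, <- Hj; exact Hy.
  - exists (j + j)%nat, (c + c)%nat, g, g'; split; [lia|].
    split; [exact Hg|split; [exact Hg'|split; [exact HO|split; [|exact HN]]]].
    rewrite Hy, mult_INR, He, !pow_add; ring. }
destruct (classic (exists y, r = 3 * (y * y))%nat) as [[y Hy]|Hb].
{ destruct (IH y) as (j & c & g & g' & Hc & Hg & Hg' & HO & He & HN).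
  - nia.
  - nia.
  - intros j Hj; apply (H3 (S (j + j))); rewrite Nat.pow_succ_r', Nat.pow_add_r, <- Hj; exact Hy.
  - exists (S (j + j)), (c + c)%nat, g, g'; split; [lia|].
    split; [exact Hg|split; [exact Hg'|split; [exact HO|split; [|exact HN]]]].
    rewrite Hy, !mult_INR, He; replace (INR 3) with 3 by (simpl; lra).
    change (3 ^ S (j + j)) with (3 * 3 ^ (j + j)); rewrite !pow_add; ring. }
(* Here [r] is a square in the larger ring, namely of sqrt 5 times [y], whose norm -5y^2 satisfies
   the criterion [NS4]. *)
destruct (classic (exists y, r = 5 * (y * y))%nat) as [[y Hy]|Hc].
{ destruct (Hsq y ltac:(nia)) as (g & g' & Hg & Hg' & HO & Hgg & HN).
  exists 0%nat, 2%nat, g, g'; split; [lia|].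
  split; [exact Hg|split; [exact Hg'|split; [exact HO|split; [|exact HN]]]].
  rewrite Hy, !mult_INR; replace (INR 5) with 5 by (simpl; lra).
  rewrite <- Hgg; ring. }
destruct (classic (exists y, r = 15 * (y * y))%nat) as [[y Hy]|Hd].
{ destruct (Hsq y ltac:(nia)) as (g & g' & Hg & Hg' & HO & Hgg & HN).
  exists 1%nat, 2%nat, g, g'; split; [lia|].
  split; [exact Hg|split; [exact Hg'|split; [exact HO|split; [|exact HN]]]].
  rewrite Hy, !mult_INR; replace (INR 15) with (3 * 5) by (simpl; lra).
  transitivity (3 * (g * g)); [rewrite Hgg; ring|ring]. }
set (z := Z.of_nat r).
assert (Hz : (0 < z)%Z) by (unfold z; lia).
assert (HIz : INR r = IZR z) by apply INR_IZR_INZ.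
assert (P : forall p k y, prime p -> (z * p * k = y * y)%Z -> exists y', (z * k = p * (y' * y'))%Z).
{ intros p k y Hp He.
  assert (Hdv : (p | y * y)%Z) by (exists (z * k)%Z; lia).
  apply prime_mult in Hdv; [|exact Hp].
  assert (Hdv' : (p | y)%Z) by tauto; destruct Hdv' as [y' ->]; exists y'.
  assert (Hp2 := prime_ge_2 p Hp); nia. }
assert (Z1 : nonsq z).
{ apply not_square_nonsq; intros y Hy; apply Ha; exists (Z.abs_nat y); unfold z in Hy; nia. }
assert (Z3 : nonsq (3 * z)).
{ apply not_square_nonsq; intros y Hy.
  destruct (P 3 1 y)%Z as [y' Hy']; [exact prime_3|lia|].
  apply Hb; exists (Z.abs_nat y'); unfold z in Hy'; nia. }
assert (Z5 : nonsq (5 * z)).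
{ apply not_square_nonsq; intros y Hy.
  destruct (P 5 1 y)%Z as [y' Hy']; [exact prime_5|lia|].
  apply Hc; exists (Z.abs_nat y'); unfold z in Hy'; nia. }
assert (Z15 : nonsq (5 * (3 * z))).
{ apply not_square_nonsq; intros y Hy.
  destruct (P 5 3 y)%Z as [y' Hy']; [exact prime_5|lia|].
  assert (H3y : (3 | 5 * (y' * y'))%Z) by (exists z; lia).
  apply prime_mult in H3y; [|exact prime_3]; destruct H3y as [[q Hq]|H3y]; [lia|].
  apply prime_mult in H3y; [|exact prime_3].
  assert (H3y' : (3 | y')%Z) by tauto; destruct H3y' as [y'' ->].
  apply Hd; exists (Z.abs_nat y''); unfold z in Hy'; nia. }
exists 0%nat, 1%nat, (INR r), (INR r); split; [lia|].
split.
{ apply (le_INR 2); assert (r <> 1)%nat; [|lia].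
  intros ->; apply (H3 0%nat); reflexivity. }
split; [apply Rabs_right, Rle_ge, pos_INR|].
assert (HO : inO (INR r) (INR r)) by (rewrite HIz; apply inO_IZR).
split; [exact HO|].
split; [simpl; ring|].
rewrite HIz in HO |- *; repeat split.
- apply NS_IZR; assumption.
- rewrite <- mult_IZR; apply NS_IZR; assumption.
- apply (Q0_NS _ (be * IZR z) (- (z * z))); [apply inO_mul; [exact inO_al|exact HO]| |].
  + rewrite opp_IZR, mult_IZR; transitivity (al * be * (IZR z * IZR z)); [ring|rewrite al_be; ring].
  + apply nonsq_neg; nia.
- apply (Q0_NS _ (be * (3 * IZR z)) (- (9 * (z * z)))).
  + apply inO_mul; [exact inO_al|apply inO_mul; [apply (inO_IZR 3)|exact HO]].
  + rewrite opp_IZR, !mult_IZR; transitivity (al * be * (9 * (IZR z * IZR z))); [ring|rewrite al_be; ring].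
  + apply nonsq_neg; nia.
Qed.

(** * The absolute bound *)

(** The constant of [baker] for [l = 3 * l0], where 2^l0 bounds [n]. The multiple 3 leaves room for
    heights up to 11 C^2. *)
Definition Cb (l0 : nat) : R := 4294967296 * (3 * INR l0) ^ 7.

(** Polynomial against exponential growth, by induction from 321, where the step multiplies l0^21 by
    less than 2. The threshold 2^320 originates here. *)
Lemma Cb_growth l0 : (321 <= l0)%nat -> 40 * Cb l0 ^ 3 <= 2 ^ (l0 - 1).
Proof.
assert (E : forall k, 40 * Cb k ^ 3 = (40 * 4294967296 ^ 3 * 3 ^ 21) * INR k ^ 21) by (intros k; unfold Cb; ring).
intros H; induction H as [|k Hk IH].
- rewrite E; replace (INR 321) with 321 by (rewrite INR_IZR_INZ; reflexivity).
  replace (321 - 1)%nat with 320%nat by reflexivity; lra.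
- replace (S k - 1)%nat with (S (k - 1)) by lia; simpl pow at 2.
  rewrite E in IH |- *.
  assert (Hk1 : 321 <= INR k).
  { replace 321 with (INR 321) by (rewrite INR_IZR_INZ; reflexivity); apply le_INR, Hk. }
  assert (Hs : INR (S k) ^ 21 <= 2 * INR k ^ 21).
  { apply Rle_trans with ((322 / 321 * INR k) ^ 21).
    - apply pow_incr; rewrite S_INR; lra.
    - rewrite Rpow_mult_distr; apply Rmult_le_compat_r; [apply pow_le; lra|lra]. }
  assert (H0 : 0 <= 40 * 4294967296 ^ 3 * 3 ^ 21) by lra.
  nra.
Qed.

Lemma Cb_large l0 : (321 <= l0)%nat -> 1000000 <= Cb l0 /\ 4194304 * (3 * INR l0) ^ 4 <= Cb l0 / 900000.
Proof.
intros Hk; unfold Cb.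
assert (Hk1 : 321 <= INR l0).
{ replace 321 with (INR 321) by (rewrite INR_IZR_INZ; reflexivity); apply le_INR, Hk. }
set (x := 3 * INR l0); assert (Hx : 900 <= x) by (unfold x; lra).
assert (H4 : 1 <= x ^ 4) by (apply pow_R1_Rle; lra).
assert (H3 : 900 ^ 3 <= x ^ 3) by (apply pow_incr; lra).
replace (x ^ 7) with (x ^ 4 * x ^ 3) by ring.
split; nra.
Qed.

Lemma baker_n (g1 g1' g2 g2' : R) (n m c h l0 : nat) : (321 <= l0)%nat ->
  0 < g1 -> 0 < g2 -> inO g1 g1' -> inO g2 g2' ->
  g1 <= exp (INR h) -> Rabs g1' <= exp (INR h) ->
  g2 <= exp (INR h) -> Rabs g2' <= exp (INR h) ->
  NS Q0 (g1 * g2) /\ NS Q0 (3 * (g1 * g2)) /\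
  NS Q0 (al * (g1 * g2)) /\ NS Q0 (al * (3 * (g1 * g2))) ->
  (0 < c)%nat -> (0 < h)%nat -> INR c + INR n + INR m <= 3 * 2 ^ l0 ->
  INR h <= 11 * Cb l0 ^ 2 ->
  exp (- (Cb l0 * INR h)) <
  Rabs (INR n * ln al - INR m * ln 3 - INR c * (ln g1 - ln g2)).
Proof.
intros Hl Hg1 Hg2 O1 O2 B1 B1' B2 B2' (N1 & N2 & N3 & N4) Hc Hh Hs Hh2.
set (l := (3 * l0)%nat).
assert (Hlr : INR l = 3 * INR l0) by (unfold l; rewrite mult_INR; simpl; ring).
assert (Hk1 : 321 <= INR l0).
{ replace 321 with (INR 321) by (rewrite INR_IZR_INZ; reflexivity); apply le_INR, Hl. }
set (T' := (2 ^ 21 * l ^ 4)%nat).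
assert (HT : INR T' = 2097152 * INR l ^ 4).
{ unfold T'; rewrite mult_INR, !pow_INR; replace (INR 2) with 2 by (simpl; lra).
  f_equal; lra. }
replace (Cb l0 * INR h) with (4294967296 * INR h * INR l ^ 7) by (unfold Cb; rewrite Hlr; ring).
apply baker with g1' g2' T'; try assumption; [rewrite Hlr; lra|].
apply INR_le; rewrite !mult_INR, !plus_INR, HT, pow_INR, Hlr.
replace (INR 2) with 2 by (simpl; lra).
destruct (Cb_large l0 Hl) as [C1 C2]; assert (C3 := Cb_growth l0 Hl).
set (C := Cb l0) in *; set (y := (3 * INR l0) ^ 4) in *.
assert (Hy : 0 <= y) by (unfold y; apply pow_le; lra).
assert (Hp : 0 < 2 ^ l0) by (apply pow_lt; lra).
assert (E1 : INR h * (2 * (2097152 * y)) <= 2 ^ (l0 - 1) / 36).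
{ apply Rle_trans with (11 * C ^ 2 * (C / 900000)); [|nra].
  apply Rmult_le_compat; [apply pos_INR|lra|exact Hh2|lra]. }
apply Rle_trans with (2 ^ (l0 - 1) / 36 * (3 * 2 ^ l0)).
- apply Rmult_le_compat; [|assert (P1 := pos_INR c); assert (P2 := pos_INR n); assert (P3 := pos_INR m); lra|exact E1|exact Hs].
  apply Rmult_le_pos; [apply pos_INR|lra].
- replace (l - 1)%nat with ((l0 - 1) + l0 + l0)%nat by (unfold l; lia); rewrite !pow_add.
  assert (0 < 2 ^ (l0 - 1)) by (apply pow_lt; lra).
  assert (1 <= 2 ^ l0) by (apply pow_R1_Rle; lra).
  assert (0 < 2 ^ (l0 - 1) * 2 ^ l0) by (apply Rmult_lt_0_compat; lra).
  replace (2 ^ (l0 - 1) / 36 * (3 * 2 ^ l0)) with (2 ^ (l0 - 1) * 2 ^ l0 * (1 / 12)) by field.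
  apply Rmult_le_compat_l; lra.
Qed.

Lemma la_ge : 2 / 5 <= ln al.
Proof.
assert (B := al_bounds).
rewrite <- (ln_exp (2 / 5)).
assert (He : exp (2 / 5) < al).
{ assert (H : 1 - / 20 <= exp (- / 20)) by (generalize (exp_ineq1_le (- / 20)); lra).
  assert (H2 : exp (2 / 5) * exp (- / 20) ^ 8 = 1).
  { rewrite <- exp_INR_mul, <- exp_plus, <- exp_0; f_equal; simpl; field. }
  assert (H3 : (1 - / 20) ^ 8 <= exp (- / 20) ^ 8) by (apply pow_incr; lra).
  assert (0 < exp (2 / 5)) by apply exp_pos; nra. }
left; apply ln_increasing; [apply exp_pos|exact He].
Qed.

Lemma l3_ge : 1 <= ln 3.
Proof.
rewrite <- (ln_exp 1).
assert (He : exp 1 < 3).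
{ assert (H := exp_3_lt_24); replace 3 with (INR 3 * 1) in H at 1 by (simpl; ring).
  rewrite exp_INR_mul in H; assert (H0 := exp_pos 1).
  apply Rnot_le_lt; intros Hc; assert (3 ^ 3 <= exp 1 ^ 3) by (apply pow_incr; lra); lra. }
left; apply ln_increasing; [apply exp_pos|exact He].
Qed.

Lemma pow_al_le_exp k x : al ^ k <= exp x -> 2 / 5 * INR k <= x.
Proof.
intros H; assert (Hl := la_ge); assert (Ha := al_bounds).
apply ln_le_of_exp in H; [|apply pow_lt; lra]; rewrite ln_pow in H by lra.
assert (Hk := pos_INR k); nra.
Qed.

Lemma pow_3_le_exp k x : 3 ^ k <= exp x -> INR k <= x.
Proof.
intros H; assert (Hl := l3_ge).
apply ln_le_of_exp in H; [|apply pow_lt; lra]; rewrite ln_pow in H by lra.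
assert (Hk := pos_INR k); nra.
Qed.

Section Bound.

Variables (n1 a m1 b : nat).
Hypotheses (Hn1 : (2 <= n1)%nat) (Ha : (1 <= a)%nat) (Hb : (1 <= b)%nat).
Hypothesis Heq :
  (fib (n1 + a) - fib n1 = 3 ^ Z.of_nat (m1 + b) - 3 ^ Z.of_nat m1)%Z.
Hypotheses (Ha4 : a <> 4%nat) (Ha8 : a <> 8%nat).

Let n := (n1 + a)%nat.
Let m := (m1 + b)%nat.

Variable l0 : nat.
Hypothesis Hl0 : (321 <= l0)%nat.
Hypothesis Hnl : INR n <= 2 ^ l0.

Let C := Cb l0.

Let C1 : 1000000 <= C.
Proof. apply (Cb_large l0 Hl0). Qed.

Let Hmn : INR m <= INR n.
Proof. apply le_INR; exact (m_le_n n1 a m1 b Hn1 Ha Hb Heq). Qed.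

Let Hp1 : 1 <= 2 ^ l0.
Proof. apply pow_R1_Rle; lra. Qed.

Lemma inO_g2 : inO (al ^ a - 1) (be ^ a - 1).
Proof. apply inO_sub; [apply inO_pow, inO_al|apply (inO_IZR 1)]. Qed.

Lemma g2_bounds : al ^ a - 1 <= exp (INR a) /\ Rabs (be ^ a - 1) <= exp (INR a).
Proof.
assert (B := al_bounds); split.
- assert (al ^ a <= exp (INR a * 1)); [|rewrite Rmult_1_r in *; lra].
  apply pow_le_exp; [lra|]; generalize (exp_ineq1_le 1); lra.
- assert (H := be_pow_le a); apply Rabs_le_inv in H.
  assert (H1 : 1 <= INR a) by (apply (le_INR 1), Ha).
  assert (H2 := exp_ineq1_le (INR a)); apply Rabs_le; lra.
Qed.

Lemma inO_g1 : inO (sqrt 5 * (3 ^ b - 1)) (- sqrt 5 * (3 ^ b - 1)).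
Proof.
apply inO_mul; [exact inO_sqrt5|]; rewrite pow_IZR, <- minus_IZR; apply inO_IZR.
Qed.

Lemma g1_bounds : 0 < sqrt 5 * (3 ^ b - 1) /\ sqrt 5 * (3 ^ b - 1) <= exp (INR (2 * b)) /\
  Rabs (- sqrt 5 * (3 ^ b - 1)) <= exp (INR (2 * b)).
Proof.
assert (B5 := sqrt5_bounds); assert (H3 := pow3_ge_3 b Hb).
assert (E2 : sqrt 5 * (3 ^ b - 1) <= exp (INR (2 * b))).
{ replace (INR (2 * b)) with (INR b * 2) by (rewrite mult_INR; simpl; ring).
  rewrite exp_INR_mul.
  assert (He : 7 <= exp 2).
  { assert (E := texp_le_exp 6 2 ltac:(lra)); unfold texp in E; simpl in E; lra. }
  apply Rle_trans with (7 ^ b); [|apply pow_incr; lra].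
  assert (Hk : forall k, (1 <= k)%nat -> sqrt 5 * (3 ^ k - 1) <= 7 ^ k).
  { intros k Hk; induction Hk as [|k Hk IH]; [simpl; lra|].
    assert (7 <= 7 ^ k) by (rewrite <- (pow_1 7) at 1; apply Rle_pow; [lra|exact Hk]).
    simpl; lra. }
  apply Hk, Hb. }
repeat split; [nra|exact E2|].
rewrite Rabs_left; [|nra]; lra.
Qed.

Lemma norm_3b : (3 ^ Z.of_nat b - 1 <> 0)%Z.
Proof. assert (H := Z.pow_gt_1 3 (Z.of_nat b) ltac:(lia)); lia. Qed.

(** [form1] against the lower bound with height 1. *)
Lemma step1 : INR a <= 3 * C \/ INR b <= 2 * C.
Proof.
assert (B5 := sqrt5_bounds).
assert (Hb0 : exp (- (C * INR 1)) <
  Rabs (INR n * ln al - INR m * ln 3 - INR 1 * (ln (sqrt 5) - ln 1))).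
{ apply (baker_n (sqrt 5) (- sqrt 5) 1 1 n m 1 1 l0 Hl0); try lra; try lia.
  - exact inO_sqrt5.
  - apply (inO_IZR 1).
  - simpl; assert (E := texp_le_exp 4 1 ltac:(lra)); unfold texp in E; simpl in E; lra.
  - rewrite Rabs_left by lra; simpl; assert (E := texp_le_exp 4 1 ltac:(lra)); unfold texp in E; simpl in E; lra.
  - generalize (exp_ineq1_le (INR 1)); simpl; lra.
  - rewrite Rabs_R1; generalize (exp_ineq1_le (INR 1)); simpl; lra.
  - rewrite Rmult_1_r; apply (NS4 _ _ (-5) inO_sqrt5).
    + transitivity (- (sqrt 5 * sqrt 5)); [ring|rewrite sqrt5_sq; simpl; ring].
    + apply nonsq_neg; lia.
    + exact nonsq_5.
  - replace (INR 1) with 1 by reflexivity; lra.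
  - fold C; replace (INR 1) with 1 by reflexivity; nra. }
replace (INR 1) with 1 in Hb0 by reflexivity.
rewrite ln_1, Rminus_0_r, Rmult_1_r, Rmult_1_l in Hb0.
(* The value at which the upper bound 13/E of [form1] meets the lower bound e^(-C). *)
set (E := 13 * exp C).
assert (HeC := exp_ineq1_le C).
destruct (Rle_dec E (al ^ a)) as [H1|H1]; [destruct (Rle_dec E (3 ^ b)) as [H2|H2]|].
- exfalso.
  assert (Hf := form1 n1 a m1 b Hn1 Ha Hb Heq E ltac:(unfold E; lra) H1 H2).
  fold n m in Hf; unfold E in Hf; rewrite exp_Ropp in Hb0.
  replace (13 / (13 * exp C)) with (/ exp C) in Hf by (field; lra); lra.
- right; assert (H3 : 3 ^ b <= exp (C + 3)).
  { rewrite exp_plus, Rmult_comm; apply Rnot_le_lt in H2; unfold E in H2.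
    assert (E3 := texp_le_exp 5 3 ltac:(lra)); unfold texp in E3; simpl in E3; nra. }
  apply pow_3_le_exp in H3; lra.
- left; assert (H3 : al ^ a <= exp (C + 3)).
  { rewrite exp_plus, Rmult_comm; apply Rnot_le_lt in H1; unfold E in H1.
    assert (E3 := texp_le_exp 5 3 ltac:(lra)); unfold texp in E3; simpl in E3; nra. }
  apply pow_al_le_exp in H3; lra.
Qed.

Lemma e2_ge : 7 <= exp 2.
Proof. assert (E := texp_le_exp 6 2 ltac:(lra)); unfold texp in E; simpl in E; lra. Qed.

Lemma lower_to_b h : exp (- (C * INR h)) < 3 / 3 ^ b -> INR b <= C * INR h + 2.
Proof.
intros H; apply pow_3_le_exp.
rewrite exp_plus; rewrite exp_Ropp in H.
assert (P := exp_pos (C * INR h)); assert (P3 : 0 < 3 ^ b) by (apply pow_lt; lra).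
assert (H2 := e2_ge).
assert (Hx : 3 ^ b < 3 * exp (C * INR h)).
{ apply (Rmult_lt_compat_r (3 ^ b * exp (C * INR h))) in H; [|nra].
  replace (/ exp (C * INR h) * (3 ^ b * exp (C * INR h))) with (3 ^ b) in H by (field; lra).
  replace (3 / 3 ^ b * (3 ^ b * exp (C * INR h))) with (3 * exp (C * INR h)) in H by (field; lra).
  exact H. }
nra.
Qed.

Lemma lower_to_al K k h : 0 < K -> K <= 19 -> exp (- (C * INR h)) < K / al ^ k ->
  2 / 5 * INR k <= C * INR h + 3.
Proof.
intros HK HK' H; apply pow_al_le_exp.
rewrite exp_plus; rewrite exp_Ropp in H.
assert (P := exp_pos (C * INR h)).
assert (P3 : 0 < al ^ k) by (apply pow_lt; generalize al_bounds; lra).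
assert (E3 := texp_le_exp 7 3 ltac:(lra)); unfold texp in E3; simpl in E3.
assert (Hx : al ^ k < K * exp (C * INR h)).
{ apply (Rmult_lt_compat_r (al ^ k * exp (C * INR h))) in H; [|nra].
  replace (/ exp (C * INR h) * (al ^ k * exp (C * INR h))) with (al ^ k) in H by (field; lra).
  replace (K / al ^ k * (al ^ k * exp (C * INR h))) with (K * exp (C * INR h)) in H by (field; lra).
  exact H. }
assert (19 <= exp 3) by lra; nra.
Qed.

(** The third number has height at most [a], so [form2a] gives b <= C a + 2 <= 3C^2 + 2. The norm
    argument is the one of [nma_mod5]. *)
Lemma step2a_odd : (a mod 4 <> 0)%nat -> INR a <= 3 * C -> INR b <= 4 * C ^ 2.
Proof.
intros Hmod Hac; assert (B5 := sqrt5_bounds).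
assert (Ha1 : 1 <= INR a) by (apply (le_INR 1), Ha).
destruct g2_bounds as [G1 G2].
assert (Hs5 : sqrt 5 <= exp (INR a)).
{ assert (E := exp_le 1 (INR a) Ha1).
  assert (E3 := texp_le_exp 4 1 ltac:(lra)); unfold texp in E3; simpl in E3; lra. }
assert (Hb0 : exp (- (C * INR a)) < 3 / 3 ^ b).
{ eapply Rlt_le_trans; [|apply (form2a n1 a m1 b Hn1 Ha Hb Heq)].
  rewrite <- (Rmult_1_l (ln (sqrt 5) - _)); change 1 with (INR 1).
  apply (baker_n (sqrt 5) (- sqrt 5) (al ^ a - 1) (be ^ a - 1) n1 m 1 a l0 Hl0); try lra; try lia.
  - apply al_a_pos, Ha.
  - exact inO_sqrt5.
  - exact inO_g2.
  - rewrite Rabs_left by lra; lra.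
  - apply (NS4 _ _ (-5 * nma a) (inO_mul _ _ _ _ inO_sqrt5 inO_g2)).
    + rewrite mult_IZR, <- nma_spec.
      transitivity (- (sqrt 5 * sqrt 5) * ((al ^ a - 1) * (be ^ a - 1))); [ring|rewrite sqrt5_sq; ring].
    + replace (-5 * nma a)%Z with (5 * (- nma a))%Z by ring; apply nonsq_5mul.
      intros Hd; apply (nma_mod5 a Hmod), Z.divide_opp_r, Hd.
    + replace (- (-5 * nma a))%Z with (5 * nma a)%Z by ring; apply nonsq_5mul, (nma_mod5 a Hmod).
  - assert (INR n1 <= INR n) by (apply le_INR; unfold n; lia); replace (INR 1) with 1 by reflexivity; lra.
  - fold C; nra. }
apply lower_to_b in Hb0; nra.
Qed.

(** The third number is sqrt 5 (3^b - 1), of height at most 2b <= 4C. Its norm is -5 times a square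
    for every [b], so no case distinction on [a] arises. *)
Lemma step2b : INR b <= 2 * C -> INR a <= 11 * C ^ 2.
Proof.
intros Hbc; assert (B5 := sqrt5_bounds).
assert (Hb1 : 1 <= INR b) by (apply (le_INR 1), Hb).
destruct g1_bounds as (G0 & G1 & G2).
assert (H2b : INR (2 * b) = 2 * INR b) by (rewrite mult_INR; simpl; ring).
destruct (Rle_dec 13 (al ^ a)) as [H13|H13].
- assert (Hb0 : exp (- (C * INR (2 * b))) < 13 / al ^ a).
  { eapply Rlt_le_trans; [|apply (form2b n1 a m1 b Hn1 Ha Hb Heq H13)].
    replace (ln (sqrt 5 * (3 ^ b - 1))) with (INR 1 * (ln (sqrt 5 * (3 ^ b - 1)) - ln 1))
      by (rewrite ln_1; simpl; ring).
    apply (baker_n _ _ 1 1 (n1 + a) m1 1 (2 * b) l0 Hl0 G0 ltac:(lra) inO_g1 (inO_IZR 1) G1 G2).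
    - generalize (exp_ineq1_le (INR (2 * b))); rewrite H2b; lra.
    - rewrite Rabs_R1; generalize (exp_ineq1_le (INR (2 * b))); rewrite H2b; lra.
    - rewrite Rmult_1_r; apply (NS4 _ _ (-5 * ((3 ^ Z.of_nat b - 1) * (3 ^ Z.of_nat b - 1))) inO_g1).
      + rewrite !mult_IZR, minus_IZR, <- pow_IZR.
        transitivity (- (sqrt 5 * sqrt 5) * ((3 ^ b - 1) * (3 ^ b - 1))); [ring|rewrite sqrt5_sq; ring].
      + apply nonsq_mul_sq; [exact norm_3b|apply nonsq_neg; lia].
      + replace (- (-5 * ((3 ^ Z.of_nat b - 1) * (3 ^ Z.of_nat b - 1))))%Z with
          (5 * ((3 ^ Z.of_nat b - 1) * (3 ^ Z.of_nat b - 1)))%Z by ring.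
        apply nonsq_mul_sq; [exact norm_3b|exact nonsq_5].
    - lia.
    - lia.
    - assert (INR m1 <= INR m) by (apply le_INR; unfold m; lia).
      fold n; replace (INR 1) with 1 by reflexivity; lra.
    - fold C; rewrite H2b; nra. }
  apply lower_to_al in Hb0; [|lra|lra]; rewrite H2b in Hb0; nra.
- assert (H3 : al ^ a <= exp 3).
  { assert (E3 := texp_le_exp 5 3 ltac:(lra)); unfold texp in E3; simpl in E3; lra. }
  apply pow_al_le_exp in H3; nra.
Qed.

(** [form3] with height max(a, 2b) <= 11 C^2; dividing by the lower estimate 2/5 for [ln al] gives
    27.5 C^3 and a constant. *)
Lemma step3 : (a mod 4 <> 0)%nat -> INR a <= 11 * C ^ 2 -> INR b <= 4 * C ^ 2 ->
  INR n <= 28 * C ^ 3.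
Proof.
intros Hmod Hac Hbc; assert (B5 := sqrt5_bounds).
assert (Hb1 : 1 <= INR b) by (apply (le_INR 1), Hb).
destruct g1_bounds as (G0 & G1 & G2); destruct g2_bounds as (G3 & G4).
assert (H2b : INR (2 * b) = 2 * INR b) by (rewrite mult_INR; simpl; ring).
set (h := Nat.max a (2 * b)).
assert (Hha : INR a <= INR h) by (apply le_INR; unfold h; lia).
assert (Hhb : INR (2 * b) <= INR h) by (apply le_INR; unfold h; lia).
assert (Hh : INR h <= 11 * C ^ 2).
{ unfold h; destruct (Nat.max_spec a (2 * b)) as [[_ ->]|[_ ->]]; [rewrite H2b; nra|exact Hac]. }
assert (Ea := exp_le _ _ Hha); assert (Eb := exp_le _ _ Hhb).
destruct (Rle_dec 7 (al ^ n)) as [H7|H7].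
- assert (Hb0 : exp (- (C * INR h)) < 7 / al ^ n).
  { eapply Rlt_le_trans; [|apply (form3 n1 a m1 b Hn1 Ha Hb Heq H7)].
    rewrite <- (Rmult_1_l (ln _ - _)); change 1 with (INR 1) at 1.
    apply (baker_n _ (- sqrt 5 * (3 ^ b - 1)) _ (be ^ a - 1) n1 m1 1 h l0 Hl0 G0 (al_a_pos a Ha) inO_g1 inO_g2); try lra.
    - apply (NS4 _ _ (-5 * nma a * ((3 ^ Z.of_nat b - 1) * (3 ^ Z.of_nat b - 1))) (inO_mul _ _ _ _ inO_g1 inO_g2)).
      + rewrite !mult_IZR, minus_IZR, <- pow_IZR, <- nma_spec.
        transitivity (- (sqrt 5 * sqrt 5) * ((al ^ a - 1) * (be ^ a - 1)) * ((3 ^ b - 1) * (3 ^ b - 1))); [ring|rewrite sqrt5_sq; ring].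
      + apply nonsq_mul_sq; [exact norm_3b|].
        replace (-5 * nma a)%Z with (5 * (- nma a))%Z by ring; apply nonsq_5mul.
        intros Hd; apply (nma_mod5 a Hmod), Z.divide_opp_r, Hd.
      + rewrite <- Z.mul_opp_l; apply nonsq_mul_sq; [exact norm_3b|].
        replace (- (-5 * nma a))%Z with (5 * nma a)%Z by ring; apply nonsq_5mul, (nma_mod5 a Hmod).
    - lia.
    - unfold h; lia.
    - assert (INR m1 <= INR m) by (apply le_INR; unfold m; lia).
      assert (INR n1 <= INR n) by (apply le_INR; unfold n; lia).
      replace (INR 1) with 1 by reflexivity; lra.
    - exact Hh. }
  apply lower_to_al in Hb0; [|lra|lra].
  assert (C * INR h <= C * (11 * C ^ 2)) by (apply Rmult_le_compat_l; lra).
  assert (1 <= C ^ 3) by (apply pow_R1_Rle; lra).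
  replace (C * (11 * C ^ 2)) with (11 * C ^ 3) in H by ring.
  assert (1000000 <= C ^ 3) by nra. lra.
- assert (H3 : al ^ n <= exp 3).
  { assert (E3 := texp_le_exp 5 3 ltac:(lra)); unfold texp in E3; simpl in E3; lra. }
  apply pow_al_le_exp in H3; assert (1 <= C ^ 3) by (apply pow_R1_Rle; lra).
  assert (1000000 <= C ^ 3) by nra. lra.
Qed.

Lemma n_le_m : INR n <= 3 * INR m + 5.
Proof.
assert (H := al_n_le n1 a m1 b Hn1 Ha Hb Heq); fold n in H.
destruct (Del_bounds m1 b Hb) as (_ & D2 & _); fold m in D2.
assert (H4 := al4); assert (Ba := al_bounds).
assert (H3 : al ^ n <= exp (2 + 11 / 10 * INR m)).
{ rewrite exp_plus; replace (11 / 10 * INR m) with (INR m * (11 / 10)) by ring.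
  rewrite exp_INR_mul; assert (E2 := e2_ge); assert (E3 := proj2 exp_bound1).
  assert (P0 : 0 <= al ^ 4) by (apply pow_le; lra).
  assert (P1 : 3 ^ m <= exp (11 / 10) ^ m) by (apply pow_incr; lra).
  assert (P2 : 0 < 3 ^ m) by (apply pow_lt; lra).
  apply Rle_trans with (al ^ 4 * 3 ^ m); [nra|].
  apply Rmult_le_compat; lra. }
apply pow_al_le_exp in H3; assert (Hm := pos_INR m); lra.
Qed.

(** 3^m1 divides F_d L_(n1+d), and a power of 3 dividing either factor is at most linear in the
    index, so 3^m1 <= 18 * 4^l0. In this case the estimate takes the place of [form3]. *)
Lemma m1_small : (a mod 4 = 0)%nat -> INR m1 <= 3 * INR l0 + 5.
Proof.
intros Hmod.
set (d := (2 * (a / 4))%nat).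
assert (Ed : a = (2 * d)%nat) by (unfold d; assert (E := Nat.div_mod_eq a 4); lia).
assert (Hd : Nat.Even d) by (exists (a / 4)%nat; reflexivity).
assert (Hd0 : (0 < d)%nat) by lia.
assert (Hdv : (3 ^ Z.of_nat m1 | fib d * luc (n1 + d))%Z).
{ rewrite <- (fib_diff_even n1 d Hd), <- Ed, Heq.
  rewrite Nat2Z.inj_add, Z.pow_add_r by lia.
  exists (3 ^ Z.of_nat b - 1)%Z; ring. }
destruct (pow3_split _ _ _ Hdv) as (i & j & Hij & Hi & Hj).
apply pow3_dvd_fib in Hi; [|exact Hd0]; apply pow3_dvd_luc in Hj; [|lia].
apply IZR_le in Hi; apply IZR_le in Hj.
rewrite !mult_IZR, <- pow_IZR, <- INR_IZR_INZ in Hi, Hj.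
assert (Hdn : INR d <= INR n) by (apply le_INR; unfold n; lia).
assert (Hen : INR (n1 + d) <= INR n) by (apply le_INR; unfold n; lia).
assert (H3 : 3 ^ m1 <= 18 * 2 ^ l0 * 2 ^ l0).
{ rewrite <- Hij, pow_add; replace (18 * 2 ^ l0 * 2 ^ l0) with (3 * 2 ^ l0 * (6 * 2 ^ l0)) by ring.
  apply Rmult_le_compat; try (apply pow_le; lra); lra. }
assert (He : 3 ^ m1 <= exp (INR l0 + INR l0 + 3)).
{ eapply Rle_trans; [exact H3|]; rewrite !exp_plus.
  assert (P := pow2_le_exp l0).
  assert (E3 := texp_le_exp 6 3 ltac:(lra)); unfold texp in E3; simpl in E3.
  assert (2 ^ l0 * 2 ^ l0 <= exp (INR l0) * exp (INR l0)) by (apply Rmult_le_compat; lra).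
  assert (0 <= 2 ^ l0 * 2 ^ l0) by nra.
  apply Rle_trans with (18 * (2 ^ l0 * 2 ^ l0)); [lra|nra]. }
apply pow_3_le_exp in He; assert (P := pos_INR l0); lra.
Qed.

(** [pow3_dvd_fib] gives F_d <= 3d, so d < 10 and a few values remain. The two survivors are [a = 4]
    and [a = 8]. *)
Lemma fib_pow3 d j : (0 < d)%nat -> Nat.Even d -> Z.to_nat (fib d) = (3 ^ j)%nat -> d = 2%nat \/ d = 4%nat.
Proof.
intros Hd [i Hi] Hj.
assert (Hf : fib d = (3 ^ Z.of_nat j)%Z).
{ rewrite <- (Z2Nat.id (fib d)) by apply fib_nonneg; rewrite Hj, Nat2Z.inj_pow; reflexivity. }
assert (Hle := pow3_dvd_fib d Hd j ltac:(rewrite Hf; apply Z.divide_refl)).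
rewrite <- Hf in Hle.
assert (Hg : forall k, (10 <= k)%nat -> (3 * Z.of_nat k < fib k)%Z).
{ intros k Hk.
  enough (3 * Z.of_nat k < fib k /\ 3 * Z.of_nat (S k) < fib (S k))%Z by tauto.
  induction Hk as [|k Hk [IH1 IH2]]; [split; reflexivity|].
  split; [exact IH2|]; rewrite fib_SS; lia. }
assert (Hd10 : (d < 10)%nat).
{ apply Nat.nle_gt; intros H10; specialize (Hg d H10); lia. }
assert (Hj6 : (j <= 3)%nat).
{ apply Nat.nlt_ge; intros Hj4.
  assert (H81 : (3 ^ 4 <= 3 ^ Z.of_nat j)%Z) by (apply Z.pow_le_mono_r; lia).
  rewrite <- Hf in H81; change (3 ^ 4)%Z with 81%Z in H81; lia. }
assert (i = 1 \/ i = 2 \/ i = 3 \/ i = 4)%nat as [->|[->|[->| ->]]] by lia; subst d; auto; exfalso;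
(destruct j as [|[|[|[|j]]]]; [| | | |lia]); vm_compute in Hf; discriminate Hf.
Qed.

(** Since [al^a - 1] is sqrt 5 al^d F_d, the root of 5 cancels from [form2a]. Writing F_d = 3^j g^c
    absorbs [j] into the coefficient of [ln 3] and makes [c] the coefficient of the third
    logarithm. *)
Lemma step2a_even : (a mod 4 = 0)%nat -> INR a <= 3 * C -> INR b <= 4 * C ^ 2.
Proof.
intros Hmod Hac.
set (d := (2 * (a / 4))%nat).
assert (Ed : a = (2 * d)%nat) by (unfold d; assert (E := Nat.div_mod_eq a 4); lia).
assert (Hd : Nat.Even d) by (exists (a / 4)%nat; reflexivity).
assert (Hd0 : (0 < d)%nat) by lia.
assert (Hfd : (0 < fib d)%Z) by (destruct d as [|d']; [lia|apply fib_pos]).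
assert (HF : INR (Z.to_nat (fib d)) = IZR (fib d)).
{ rewrite INR_IZR_INZ, Z2Nat.id by lia; reflexivity. }
destruct (rational_multiplier (Z.to_nat (fib d))) as (j & c & g & g' & Hc & Hg & Hg' & HO & He & HN).
{ lia. }
{ intros j Hj; destruct (fib_pow3 d j Hd0 Hd Hj); lia. }
rewrite HF in He.
assert (B5 := sqrt5_bounds); assert (Ba := al_bounds).
assert (Ha1 : 1 <= INR a) by (apply (le_INR 1), Ha).
assert (Hfe : IZR (fib d) <= exp (INR a)).
{ assert (H1 : IZR (fib d) <= al ^ d).
  { destruct d as [|d']; [lia|]; eapply Rle_trans; [apply fib_le_al|].
    apply Rle_pow; [lra|lia]. }
  assert (H2 : al ^ d <= al ^ a) by (apply Rle_pow; [lra|lia]).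
  assert (H3 := proj1 g2_bounds).
  assert (H4 : al ^ a <= exp (INR a * 1)).
  { apply pow_le_exp; [lra|]; generalize (exp_ineq1_le 1); lra. }
  rewrite Rmult_1_r in H4; lra. }
assert (H3j : 1 <= 3 ^ j) by (apply pow_R1_Rle; lra).
assert (Hgc : g ^ c <= IZR (fib d)).
{ assert (0 < g ^ c) by (apply pow_lt; lra); rewrite He; nra. }
assert (Hgf : g <= IZR (fib d)).
{ eapply Rle_trans; [|exact Hgc]; rewrite <- (pow_1 g) at 1; apply Rle_pow; [lra|exact Hc]. }
assert (Hca : INR c <= INR a).
{ apply Rnot_lt_le; intros Hlt.
  assert (H1 : 2 ^ c <= g ^ c) by (apply pow_incr; lra).
  assert (H2 : IZR (fib d) <= 2 ^ d).
  { destruct d as [|d']; [lia|]; eapply Rle_trans; [apply fib_le_al|].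
    apply Rle_trans with (2 ^ d'); [apply pow_incr; lra|apply Rle_pow; [lra|lia]]. }
  apply INR_lt in Hlt.
  assert (H3 : 2 ^ S d <= 2 ^ c) by (apply Rle_pow; [lra|lia]).
  assert (0 < 2 ^ d) by (apply pow_lt; lra); simpl in H3; lra. }
assert (Han : INR a <= INR n) by (apply le_INR; unfold n; lia).
assert (Hjm : (j <= m)%nat).
{ apply Nat.nlt_ge; intros Hlt.
  assert (H1 : 3 ^ j <= IZR (fib d)).
  { assert (1 <= g ^ c) by (apply pow_R1_Rle; lra); rewrite He; nra. }
  assert (H2 : 3 ^ m < 3 ^ j) by (apply Rlt_pow; [lra|exact Hlt]).
  assert (H3 : IZR (fib d) <= Del m1 b).
  { rewrite <- (HeqR n1 a m1 b Heq), <- minus_IZR; rewrite Ed, (fib_diff_even n1 d Hd); apply IZR_le.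
    generalize (luc_pos (n1 + d)); nia. }
  destruct (Del_bounds m1 b Hb) as (_ & D2 & _); fold m in D2; lra. }
assert (Hb0 : exp (- (C * INR a)) < 3 / 3 ^ b).
{ eapply Rlt_le_trans; [|apply (form2a n1 a m1 b Hn1 Ha Hb Heq)].
  fold m.
  replace (INR n1 * ln al - INR m * ln 3 - (ln (sqrt 5) - ln (al ^ a - 1))) with
    (INR (n1 + d) * ln al - INR (m - j) * ln 3 - INR c * (ln 1 - ln g)).
  2:{ assert (Hfac : al ^ a - 1 = sqrt 5 * (al ^ d * (3 ^ j * g ^ c))).
      { rewrite <- He; transitivity (al ^ d * (sqrt 5 * IZR (fib d))); [|ring].
        rewrite binet, Ed; replace (2 * d)%nat with (d + d)%nat by lia; rewrite pow_add.
        destruct Hd as [i Hi]; assert (Hab := al_be_pow d); rewrite Hi in Hab at 3.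
        rewrite pow_1_even in Hab; lra. }
      rewrite Hfac, !ln_mult, !ln_pow, ln_1, plus_INR, minus_INR
        by (try exact Hjm; try lra; repeat apply Rmult_lt_0_compat; try apply pow_lt; lra).
      ring. }
  apply (baker_n 1 1 g g' (n1 + d) (m - j) c a l0 Hl0); try lra; try lia; try assumption.
  - apply (inO_IZR 1).
  - rewrite Rabs_R1; generalize (exp_ineq1_le (INR a)); lra.
  - rewrite Rmult_1_l; exact HN.
  - assert (INR (n1 + d) <= INR n) by (apply le_INR; unfold n; lia).
    assert (INR (m - j) <= INR m) by (apply le_INR; lia); lra.
  - fold C; nra. }
apply lower_to_b in Hb0; nra.
Qed.

(** If 4 divides [a], the bound on [n] comes from m = m1 + b and [n_le_m]; otherwise from
    [step3]. *)
Lemma n_bound : INR n <= 28 * C ^ 3.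
Proof.
destruct (Nat.eq_dec (a mod 4) 0) as [Hmod|Hmod].
- assert (Hb4 : INR b <= 4 * C ^ 2).
  { destruct step1 as [H|H]; [apply step2a_even; assumption|nra]. }
  assert (H1 := m1_small Hmod); assert (H2 := n_le_m).
  assert (Hl : INR l0 <= C).
  { destruct (Cb_large l0 Hl0) as [_ E]; fold C in E.
    assert (Hk1 : 321 <= INR l0).
    { replace 321 with (INR 321) by (rewrite INR_IZR_INZ; reflexivity); apply le_INR, Hl0. }
    assert (3 * INR l0 <= (3 * INR l0) ^ 4).
    { rewrite <- (pow_1 (3 * INR l0)) at 1; apply Rle_pow; [lra|lia]. }
    lra. }
  assert (Hm : INR m = INR m1 + INR b) by (unfold m; apply plus_INR).
  assert (C <= C ^ 2) by nra. assert (1000000 * C ^ 2 <= C ^ 3) by nra. lra.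
- destruct step1 as [H|H].
  + apply step3; [exact Hmod|nra|apply step2a_odd; assumption].
  + apply step3; [exact Hmod|apply step2b, H|nra].
Qed.

End Bound.

(** With [l0] the number of binary digits of [n], the inequalities n <= 28 C^3 and 40 C^3 <=
    2^(l0-1) <= n contradict each other. *)
Theorem absolute_bound (n1 a m1 b : nat) :
  (2 <= n1)%nat -> (1 <= a)%nat -> (1 <= b)%nat ->
  (fib (n1 + a) - fib n1 = 3 ^ Z.of_nat (m1 + b) - 3 ^ Z.of_nat m1)%Z ->
  a <> 4%nat -> a <> 8%nat -> INR (n1 + a) < 2 ^ 320.
Proof.
intros Hn1 Ha Hb Heq Ha4 Ha8; apply Rnot_le_lt; intros Hbig.
set (n := (n1 + a)%nat) in *.
set (l0 := S (Nat.log2 n)).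
destruct (Nat.log2_spec n ltac:(unfold n; lia)) as [L1 L2].
apply le_INR in L1; apply lt_INR in L2; rewrite pow_INR in L1, L2.
replace (INR 2) with 2 in L1, L2 by (simpl; lra).
assert (Hl0 : (321 <= l0)%nat).
{ unfold l0; apply le_n_S, Nat.nlt_ge; intros Hlt.
  assert (2 ^ S (Nat.log2 n) <= 2 ^ 320) by (apply Rle_pow; [lra|exact Hlt]); lra. }
assert (H := n_bound n1 a m1 b Hn1 Ha Hb Heq Ha4 Ha8 l0 Hl0 ltac:(left; exact L2)).
assert (Hg := Cb_growth l0 Hl0).
destruct (Cb_large l0 Hl0) as [C1 _].
fold n in H; replace (l0 - 1)%nat with (Nat.log2 n) in Hg by (unfold l0; lia).
assert (1 <= Cb l0 ^ 3) by (apply pow_R1_Rle; lra); lra.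
Qed.

Open Scope Z_scope.

(** * The equation [luc e = 3^u (3^b - 1)] *)

Fixpoint orbit {S : Type} (f : S -> S) (s : S) (n : nat) : list S :=
  match n with O => [] | Datatypes.S n' => s :: orbit f (f s) n' end.

Lemma nth_orbit {S} (f : S -> S) n : forall s i d, (i < n)%nat ->
  nth i (orbit f s n) d = Nat.iter i f s.
Proof.
induction n as [|n IH]; intros s i d Hi; [lia|].
destruct i as [|i]; [reflexivity|]; simpl nth.
rewrite IH by lia; rewrite <- Nat.iter_succ_r; reflexivity.
Qed.

Lemma iter_period {S} (f : S -> S) s P : Nat.iter P f s = s ->
  forall n, Nat.iter n f s = Nat.iter (n mod P) f s.
Proof.
intros HP n; destruct (Nat.eq_dec P 0) as [->|HP0]; [rewrite Nat.mod_0_r; reflexivity|].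
transitivity (Nat.iter (P * (n / P) + n mod P) f s); [f_equal; apply Nat.div_mod_eq|].
induction (n / P)%nat as [|q IH]; [rewrite Nat.mul_0_r; reflexivity|].
  replace (P * Datatypes.S q + n mod P)%nat with (P * q + n mod P + P)%nat by lia.
  rewrite Nat.iter_add, HP; exact IH.
Qed.

Definition lstep (M : Z) (s : Z * Z) : Z * Z := (snd s, (fst s + snd s) mod M).

Lemma lstep_iter M n : 0 < M ->
  Nat.iter n (lstep M) (2 mod M, 1 mod M) = (luc n mod M, luc (S n) mod M).
Proof.
intros HM; induction n as [|n IH]; [reflexivity|].
rewrite Nat.iter_succ, IH, luc_SS; unfold lstep; cbn [fst snd]; f_equal.
rewrite <- Z.add_mod, Z.add_comm by lia; reflexivity.
Qed.

Lemma pow3_iter M n : 0 < M ->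
  Nat.iter n (fun x => (3 * x) mod M) (1 mod M) = 3 ^ Z.of_nat n mod M.
Proof.
intros HM; induction n as [|n IH]; [reflexivity|].
rewrite Nat.iter_succ, IH, Nat2Z.inj_succ, Z.pow_succ_r, Z.mul_mod_idemp_r by lia; reflexivity.
Qed.

Record modulus := { md : Z; lper : nat; pper : nat; ltab : list Z; ptab : list Z }.

Definition mk_modulus (M : Z) (P R : nat) : modulus :=
  {| md := M; lper := P; pper := R;
     ltab := map fst (orbit (lstep M) (2 mod M, 1 mod M) P);
     ptab := orbit (fun x => (3 * x) mod M) (1 mod M) R |}.

(** Both sequences return to their start, so both are purely periodic. This makes [M] prime to 3;
    moduli that are powers of 3 enter through [luc_residues]. *)
Definition valid (M : Z) (P R : nat) : Prop :=
  0 < M /\ (0 < P)%nat /\ (0 < R)%nat /\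
  Nat.iter P (lstep M) (2 mod M, 1 mod M) = (2 mod M, 1 mod M) /\
  Nat.iter R (fun x => (3 * x) mod M) (1 mod M) = 1 mod M.

Definition test (m : modulus) (e u b : nat) : bool :=
  nth (e mod lper m) (ltab m) 0 =?
  (nth (u mod pper m) (ptab m) 0 * (nth (b mod pper m) (ptab m) 0 - 1)) mod (md m).

Lemma luc_tab M P e : 0 < M -> (0 < P)%nat ->
  Nat.iter P (lstep M) (2 mod M, 1 mod M) = (2 mod M, 1 mod M) ->
  luc e mod M = nth (e mod P) (map fst (orbit (lstep M) (2 mod M, 1 mod M) P)) 0.
Proof.
intros HM HP HL; change 0 with (fst (0, 0)); rewrite map_nth, nth_orbit by (apply Nat.mod_upper_bound; lia).
rewrite <- (iter_period _ _ _ HL), lstep_iter by exact HM; reflexivity.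
Qed.

Lemma test_spec M P R0 Q e u b : valid M P R0 -> (Nat.divide P Q) -> (Nat.divide R0 Q) -> (0 < Q)%nat ->
  luc e = 3 ^ Z.of_nat u * (3 ^ Z.of_nat b - 1) ->
  test (mk_modulus M P R0) (e mod Q) (u mod Q) (b mod Q) = true.
Proof.
intros (HM & HP & HO & HL & H3) HPQ HOQ HQ Heq.
assert (Hmm : forall x R, (0 < R)%nat -> Nat.divide R Q -> ((x mod Q) mod R = x mod R)%nat).
{ intros x R HR [q Hq]; rewrite (Nat.div_mod_eq x Q) at 2.
  replace (Q * (x / Q) + x mod Q)%nat with (x mod Q + (q * (x / Q)) * R)%nat by (rewrite Hq at 3; ring).
  rewrite Nat.Div0.mod_add; reflexivity. }
unfold test; cbn [md lper pper ltab ptab mk_modulus]; rewrite !Hmm by assumption.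
rewrite <- luc_tab by assumption.
rewrite !nth_orbit by (apply Nat.mod_upper_bound; lia).
rewrite <- !(iter_period _ _ _ H3), !pow3_iter by exact HM.
apply Z.eqb_eq; rewrite Heq.
rewrite Z.mul_mod_idemp_l by lia.
rewrite (Z.mul_mod _ (3 ^ Z.of_nat b - 1)), (Z.mul_mod _ (_ mod M - 1)), Zminus_mod_idemp_l by lia.
reflexivity.
Qed.

Definition sieve (Q r : nat) (ms : list modulus) (s : list (nat * nat * nat)) : list (nat * nat * nat) :=
  flat_map (fun t => let '(e, u, b) := t in
    flat_map (fun i => flat_map (fun j => flat_map (fun k =>
      if forallb (fun m => test m (e + Q * i) (u + Q * j) (b + Q * k)) ms
      then [(e + Q * i, u + Q * j, b + Q * k)%nat] else [])
      (seq 0 r)) (seq 0 r)) (seq 0 r)) s.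

Lemma mod_mul_split x Q r : (0 < Q)%nat -> (0 < r)%nat ->
  exists i, (i < r)%nat /\ (x mod (Q * r) = x mod Q + Q * i)%nat.
Proof.
intros HQ Hr; exists ((x / Q) mod r)%nat; split; [apply Nat.mod_upper_bound; lia|].
apply Nat.Div0.mod_mul_r.
Qed.

Lemma sieve_spec Q r ms s e u b : (0 < Q)%nat -> (0 < r)%nat ->
  (forall m, In m ms -> test m (e mod (Q * r)) (u mod (Q * r)) (b mod (Q * r)) = true) ->
  In (e mod Q, u mod Q, b mod Q)%nat s ->
  In (e mod (Q * r), u mod (Q * r), b mod (Q * r))%nat (sieve Q r ms s).
Proof.
intros HQ Hr Hms Hs; unfold sieve; apply in_flat_map.
exists (e mod Q, u mod Q, b mod Q)%nat; split; [exact Hs|].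
destruct (mod_mul_split e Q r HQ Hr) as (i & Hi & Ei).
destruct (mod_mul_split u Q r HQ Hr) as (j & Hj & Ej).
destruct (mod_mul_split b Q r HQ Hr) as (k & Hk & Ek).
apply in_flat_map; exists i; split; [apply in_seq; lia|].
apply in_flat_map; exists j; split; [apply in_seq; lia|].
apply in_flat_map; exists k; split; [apply in_seq; lia|].
rewrite <- Ei, <- Ej, <- Ek.
replace (forallb _ ms) with true; [left; reflexivity|].
symmetry; apply forallb_forall; exact Hms.
Qed.

(* [(Q, r, ms)] lifts triples of residues modulo [Q] to residues modulo [Q * r]; an entry
   [(M, P, R)] of [ms] is a modulus with the periods of [luc] and of the powers of 3. *)
Definition sieve_params : list (nat * nat * list (Z * nat * nat)) :=
  [(1, 4, [(5%Z, 4, 4)]); (4, 3, [(2%Z, 3, 1); (4%Z, 6, 2); (8%Z, 12, 2)]);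
   (12, 3, [(19%Z, 18, 18)]); (36, 3, [(109%Z, 108, 27)]);
   (108, 5, [(25%Z, 20, 20); (11%Z, 10, 5); (31%Z, 30, 30); (61%Z, 60, 10); (181%Z, 90, 45);
             (271%Z, 270, 30); (541%Z, 90, 135)])]%nat.

Definition sieve_all : list (nat * nat * nat) :=
  fold_left (fun s q => let '(Q, r, ms) := q in
    sieve Q r (map (fun x => let '(M, P, R) := x in mk_modulus M P R) ms) s)
    sieve_params [(0, 0, 0)]%nat.

Lemma sieve_result : sieve_all = [(0, 0, 1); (6, 2, 1); (534, 2, 1)]%nat.
Proof. vm_compute; reflexivity. Qed.

Lemma luc_mod_540 e u b : luc e = 3 ^ Z.of_nat u * (3 ^ Z.of_nat b - 1) ->
  In (e mod 540, u mod 540, b mod 540)%nat [(0, 0, 1); (6, 2, 1); (534, 2, 1)]%nat.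
Proof.
intros Heq; rewrite <- sieve_result.
assert (Hv : forall M P R0 Q, valid M P R0 -> (Nat.divide P Q) -> (Nat.divide R0 Q) -> (0 < Q)%nat ->
  test (mk_modulus M P R0) (e mod Q) (u mod Q) (b mod Q) = true).
{ intros; apply test_spec; assumption. }
unfold sieve_all, sieve_params; cbn [fold_left map].
apply (sieve_spec 108 5); [lia|lia| |apply (sieve_spec 36 3); [lia|lia| |
  apply (sieve_spec 12 3); [lia|lia| |apply (sieve_spec 4 3); [lia|lia| |
  apply (sieve_spec 1 4); [lia|lia| |left; rewrite !Nat.mod_1_r; reflexivity]]]]];
intros m Hm; repeat (destruct Hm as [<-|Hm]; [apply Hv;
  [repeat split; try lia; vm_compute; reflexivity|
   apply Nat.Lcm0.mod_divide; reflexivity|apply Nat.Lcm0.mod_divide; reflexivity|lia]|]);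
destruct Hm.
Qed.

Lemma luc_residues M P (ok : nat -> bool) e : 0 < M -> (0 < P)%nat ->
  Nat.iter P (lstep M) (2 mod M, 1 mod M) = (2 mod M, 1 mod M) ->
  forall c, (luc e + c) mod M = 0 ->
  forallb (fun q => implb ((fst (snd q) + c) mod M =? 0) (ok (fst q)))
    (combine (seq 0 P) (orbit (lstep M) (2 mod M, 1 mod M) P)) = true ->
  ok (e mod P)%nat = true.
Proof.
intros HM HP HL c Hc Hall; rewrite forallb_forall in Hall.
assert (Hr := Nat.mod_upper_bound e P ltac:(lia)).
assert (Hlen : length (orbit (lstep M) (2 mod M, 1 mod M) P) = P).
{ clear; generalize (2 mod M, 1 mod M); induction P as [|P IH]; intros s; [reflexivity|].
  simpl; rewrite IH; reflexivity. }
specialize (Hall (nth (e mod P) (combine (seq 0 P) (orbit (lstep M) (2 mod M, 1 mod M) P)) (0%nat, (0, 0)))).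
rewrite combine_nth in Hall by (rewrite length_seq, Hlen; reflexivity).
rewrite seq_nth, nth_orbit in Hall by exact Hr; cbn [fst snd] in Hall.
rewrite <- (iter_period _ _ _ HL), lstep_iter in Hall by exact HM; cbn [fst] in Hall.
rewrite Z.add_mod_idemp_l, Hc in Hall by lia.
apply Hall; rewrite <- (lstep_iter M e HM), (iter_period _ _ _ HL e), <- (nth_orbit _ P _ _ (0, 0)) by exact Hr.
replace (0 + e mod P)%nat with (nth (e mod P) (seq 0 P) 0%nat) by (apply seq_nth, Hr).
rewrite <- combine_nth by (rewrite length_seq, Hlen; reflexivity).
apply nth_In; rewrite length_combine, length_seq, Hlen; lia.
Qed.

Lemma luc_ge_29 e : (7 <= e)%nat -> 29 <= luc e.
Proof.
intros H; enough (29 <= luc e /\ 29 <= luc (S e)) by tauto.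
induction H as [|e H [IH1 IH2]]; [split; vm_compute; discriminate|].
split; [exact IH2|]; rewrite luc_SS; lia.
Qed.

(** Congruences modulo 540 leave [u] and [b] unbounded. Moduli that are powers of 3 bound them,
    because they forbid exactly the residues of [e] that survive. *)
Lemma luc_eq e u b : (0 < e)%nat -> (0 < b)%nat ->
  luc e = 3 ^ Z.of_nat u * (3 ^ Z.of_nat b - 1) -> e = 6%nat /\ u = 2%nat /\ b = 1%nat.
Proof.
intros He Hb Heq; assert (H := luc_mod_540 e u b Heq).
assert (Hred : forall R q, (540 = R * q)%nat -> (e mod R = (e mod 540) mod R)%nat).
{ intros R q ->; rewrite Nat.Div0.mod_mul_r, Nat.mul_comm, Nat.Div0.mod_add, Nat.Div0.mod_mod; reflexivity. }
assert (Hus : (u < 540)%nat -> (u mod 540 = u)%nat) by (intros; apply Nat.mod_small; assumption).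
remember (e mod 540)%nat as re eqn:Ere; remember (u mod 540)%nat as ru eqn:Eru.
remember (b mod 540)%nat as rb eqn:Erb; clear Ere Eru Erb.
(* 27 | L_e forces e = 18 modulo 36, while the surviving classes give 0, 6 and 30. *)
assert (Hu3 : (u < 3)%nat).
{ apply Nat.nle_gt; intros Hu.
  assert (H27 : (luc e + 0) mod 27 = 0).
  { rewrite Heq, Z.add_0_r; replace u with (3 + (u - 3))%nat by lia.
    rewrite Nat2Z.inj_add, Z.pow_add_r by lia; change (3 ^ Z.of_nat 3) with 27.
    rewrite <- Z.mul_assoc, Z.mul_comm, Z.mod_mul by lia; reflexivity. }
  assert (Hok := luc_residues 27 72 (fun r => Nat.eqb (r mod 36) 18) e ltac:(lia) ltac:(lia)
    ltac:(vm_compute; reflexivity) 0 H27 ltac:(vm_compute; reflexivity)).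
  apply Nat.eqb_eq in Hok.
  replace ((e mod 72) mod 36)%nat with (e mod 36)%nat in Hok.
  2:{ change 72%nat with (36 * 2)%nat; rewrite Nat.Div0.mod_mul_r, (Nat.mul_comm 36), Nat.Div0.mod_add, Nat.Div0.mod_mod; reflexivity. }
  rewrite (Hred 36%nat 15%nat eq_refl) in Hok.
  destruct H as [H|[H|[H|[]]]]; injection H as H1 H2 H3; rewrite <- H1 in Hok; discriminate Hok. }
rewrite Hus in H by lia.
(* For b >= 2 the right side is -1 modulo 9 if u = 0, and -9 modulo 81 if u = 2; the surviving
   classes of [e] modulo 12 and 108 exclude both. *)
assert (Hb1 : b = 1%nat).
{ destruct (le_lt_dec b 1) as [Hb1|Hb1]; [lia|exfalso].
  assert (H9 : 3 ^ Z.of_nat b = 9 * 3 ^ Z.of_nat (b - 2)).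
  { replace b with (2 + (b - 2))%nat at 1 by lia.
    rewrite Nat2Z.inj_add, Z.pow_add_r by lia; reflexivity. }
  destruct H as [H|H].
  - injection H as H1 H2 H3; subst u; rewrite H9 in Heq; change (3 ^ Z.of_nat 0) with 1 in Heq.
    assert (Hm : (luc e + 1) mod 9 = 0).
    { rewrite Heq; replace (1 * (9 * 3 ^ Z.of_nat (b - 2) - 1) + 1) with (3 ^ Z.of_nat (b - 2) * 9) by ring.
      apply Z.mod_mul; lia. }
    assert (Hok := luc_residues 9 24 (fun r => negb (Nat.eqb (r mod 12) 0)) e ltac:(lia) ltac:(lia)
      ltac:(vm_compute; reflexivity) 1 Hm ltac:(vm_compute; reflexivity)).
    cbv beta in Hok; replace ((e mod 24) mod 12)%nat with (e mod 12)%nat in Hok.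
    2:{ change 24%nat with (12 * 2)%nat; rewrite Nat.Div0.mod_mul_r, (Nat.mul_comm 12), Nat.Div0.mod_add, Nat.Div0.mod_mod; reflexivity. }
    rewrite (Hred 12%nat 45%nat eq_refl), <- H1 in Hok; discriminate Hok.
  - assert (Hu : u = 2%nat) by (destruct H as [H|[H|[]]]; injection H as H1 H2 H3; lia).
    subst u; rewrite H9 in Heq; change (3 ^ Z.of_nat 2) with 9 in Heq.
    assert (Hm : (luc e + 9) mod 81 = 0).
    { rewrite Heq; replace (9 * (9 * 3 ^ Z.of_nat (b - 2) - 1) + 9) with (3 ^ Z.of_nat (b - 2) * 81) by ring.
      apply Z.mod_mul; lia. }
    assert (Hok := luc_residues 81 216 (fun r => negb (Nat.eqb (r mod 108) 6) && negb (Nat.eqb (r mod 108) 102))%bool e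
      ltac:(lia) ltac:(lia) ltac:(vm_compute; reflexivity) 9 Hm ltac:(vm_compute; reflexivity)).
    cbv beta in Hok; replace ((e mod 216) mod 108)%nat with (e mod 108)%nat in Hok.
    2:{ change 216%nat with (108 * 2)%nat; rewrite Nat.Div0.mod_mul_r, (Nat.mul_comm 108), Nat.Div0.mod_add, Nat.Div0.mod_mod; reflexivity. }
    rewrite (Hred 108%nat 5%nat eq_refl) in Hok.
    destruct H as [H|[H|[]]]; injection H as H1 H3; rewrite <- H1 in Hok; vm_compute in Hok; discriminate Hok. }
subst b; change (3 ^ Z.of_nat 1 - 1) with 2 in Heq.
assert (He7 : (e < 7)%nat).
{ apply Nat.nle_gt; intros H7; assert (H29 := luc_ge_29 e H7).
  destruct u as [|[|[|u]]]; [| | |lia].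
  - change (3 ^ Z.of_nat 0) with 1 in Heq; lia.
  - change (3 ^ Z.of_nat 1) with 3 in Heq; lia.
  - change (3 ^ Z.of_nat 2) with 9 in Heq; lia. }
destruct e as [|[|[|[|[|[|[|e]]]]]]]; try lia;
destruct u as [|[|[|u]]]; try lia; vm_compute in Heq; try discriminate Heq; auto.
Qed.

Open Scope R_scope.

(** * Approximating logarithms *)

Lemma geom_sum n t : t <> 1 ->
  rsum (seq 0 n) (fun k => t ^ k) = (1 - t ^ n) / (1 - t).
Proof.
intros Ht; induction n as [|n IH]; [simpl; field; lra|].
rewrite rsum_seq_S, IH; simpl; field; lra.
Qed.

Definition lnsum (n : nat) (t : R) : R := rsum (seq 0 n) (fun k => t ^ S k / INR (S k)).

Lemma lnsum_derive n t : derivable_pt_lim (lnsum n) t (rsum (seq 0 n) (fun k => t ^ k)).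
Proof.
induction n as [|n IH].
- apply (derivable_pt_lim_const 0).
- rewrite rsum_seq_S.
  apply (derivable_pt_lim_ext (plus_fct (lnsum n) (mult_real_fct (/ INR (S n)) (fun u => u ^ S n)))).
  { intros z; unfold plus_fct, mult_real_fct, lnsum; rewrite rsum_seq_S; unfold Rdiv; ring. }
  apply derivable_pt_lim_plus; [exact IH|].
  replace (t ^ n) with (/ INR (S n) * (INR (S n) * t ^ pred (S n))).
  + apply derivable_pt_lim_scal, derivable_pt_lim_pow.
  + simpl pred; field; apply not_0_INR; lia.
Qed.

(** By the geometric sum, -ln(1-t) minus its partial sum has derivative t^n / (1-t); then the mean
    value theorem. *)
Lemma ln1m_bounds n x : 0 < x < 1 ->
  lnsum n x <= - ln (1 - x) <= lnsum n x + x ^ S n / (1 - x).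
Proof.
intros Hx.
set (f := fun t => - ln (1 - t) - lnsum n t).
assert (Hder : forall t, 0 <= t <= x -> derivable_pt_lim f t (t ^ n / (1 - t))).
{ intros t Ht; unfold f.
  replace (t ^ n / (1 - t)) with (- (/ (1 - t) * (0 - 1)) - rsum (seq 0 n) (fun k => t ^ k)).
  2:{ rewrite geom_sum by lra; field; lra. }
  apply derivable_pt_lim_minus; [|apply lnsum_derive].
  apply derivable_pt_lim_opp.
  apply (derivable_pt_lim_comp (fun u => 1 - u) ln).
  - apply derivable_pt_lim_minus; [apply derivable_pt_lim_const|apply derivable_pt_lim_id].
  - apply derivable_pt_lim_ln; lra. }
destruct (MVT_cor2 f (fun t => t ^ n / (1 - t)) 0 x) as (c & Hc & Hc1); [lra|exact Hder|].
assert (Hf0 : f 0 = 0).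
{ unfold f, lnsum; rewrite Rminus_0_r, ln_1, (rsum_ext _ _ (fun _ => 0)), rsum_zero; [ring|].
  intros k _; simpl; unfold Rdiv; ring. }
rewrite Hf0, !Rminus_0_r in Hc; unfold f in Hc.
assert (H1 : 0 <= c ^ n <= x ^ n) by (split; [apply pow_le; lra|apply pow_incr; lra]).
assert (H2 : 0 < / (1 - c) <= / (1 - x)).
{ split; [apply Rinv_0_lt_compat; lra|apply Rinv_le_contravar; lra]. }
assert (H3 : 0 <= c ^ n / (1 - c) * x) by (unfold Rdiv; repeat apply Rmult_le_pos; lra).
assert (H4 : c ^ n / (1 - c) * x <= x ^ S n / (1 - x)).
{ unfold Rdiv; simpl; replace (x * x ^ n * / (1 - x)) with (x ^ n * / (1 - x) * x) by ring.
  apply Rmult_le_compat_r; [lra|]; apply Rmult_le_compat; lra. }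
lra.
Qed.

Definition zsum (l : list nat) (f : nat -> Z) : Z := fold_right (fun x s => (f x + s)%Z) 0%Z l.

Lemma zsum_IZR l f : IZR (zsum l f) = rsum l (fun k => IZR (f k)).
Proof. induction l as [|x l IH]; [reflexivity|]; simpl; rewrite plus_IZR, IH; reflexivity. Qed.

(** Each term costs [e] for the table entry and 1 for the integer division; the final 3 covers the
    tail of the series. *)
Lemma lnsum_approx (n : nat) (x SC e : R) (t : nat -> Z) : 0 < x < 1 -> 0 <= e ->
  (forall k, (k < n)%nat -> Rabs (SC * x ^ S k - IZR (t (S k))) <= e) ->
  0 <= SC * (x ^ S n / (1 - x)) <= 3 -> 0 <= SC ->
  Rabs (SC * - ln (1 - x) - IZR (zsum (seq 0 n) (fun k => t (S k) / Z.of_nat (S k))%Z)) <=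
  (e + 1) * INR n + 3.
Proof.
intros Hx He Ht Htail HSC.
assert (Hb := ln1m_bounds n x Hx).
assert (H1 : Rabs (SC * lnsum n x - IZR (zsum (seq 0 n) (fun k => t (S k) / Z.of_nat (S k))%Z)) <= (e + 1) * INR n).
{ rewrite zsum_IZR; unfold lnsum; rewrite <- rsum_scal, <- rsum_minus.
  eapply Rle_trans; [apply rsum_abs|].
  replace ((e + 1) * INR n) with (rsum (seq 0 n) (fun _ => e + 1)) by (rewrite rsum_const, length_seq; ring).
  apply rsum_le; intros k Hk; apply in_seq in Hk; specialize (Ht k ltac:(lia)).
  assert (Hk1 : 1 <= INR (S k)) by (apply (le_INR 1); lia).
  assert (Hfl : Rabs (IZR (t (S k)) / INR (S k) - IZR (t (S k) / Z.of_nat (S k))) <= 1).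
  { rewrite INR_IZR_INZ in Hk1 |- *; set (d := Z.of_nat (S k)) in *; set (y := t (S k)).
    assert (Hd : (0 < d)%Z) by (unfold d; lia).
    assert (E := Z.div_mod y d ltac:(lia)); assert (M := Z.mod_pos_bound y d Hd).
    assert (Er : IZR y = IZR d * IZR (y / d) + IZR (y mod d)) by (rewrite <- mult_IZR, <- plus_IZR; f_equal; exact E).
    destruct M as [M1 M2]; apply IZR_le in M1; apply IZR_lt in M2.
    replace (IZR y / IZR d - IZR (y / d)) with (IZR (y mod d) / IZR d) by (rewrite Er; field; lra).
    rewrite Rabs_right.
    - apply Rmult_le_reg_r with (IZR d); [lra|]; unfold Rdiv; rewrite Rmult_assoc, Rinv_l by lra; lra.
    - apply Rle_ge, Rmult_le_pos; [exact M1|left; apply Rinv_0_lt_compat; lra]. }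
  replace (SC * (x ^ S k / INR (S k)) - IZR (t (S k) / Z.of_nat (S k))) with
    ((SC * x ^ S k - IZR (t (S k))) / INR (S k) +
     (IZR (t (S k)) / INR (S k) - IZR (t (S k) / Z.of_nat (S k)))) by (field; lra).
  eapply Rle_trans; [apply Rabs_triang|]; apply Rplus_le_compat; [|exact Hfl].
  unfold Rdiv; rewrite Rabs_mult, Rabs_inv, (Rabs_right (INR (S k))) by lra.
  assert (Hi : / INR (S k) <= 1) by (rewrite <- Rinv_1; apply Rinv_le_contravar; lra).
  assert (0 < / INR (S k)) by (apply Rinv_0_lt_compat; lra).
  assert (0 <= Rabs (SC * x ^ S k - IZR (t (S k)))) by apply Rabs_pos; nra. }
apply Rabs_le_inv in H1; apply Rabs_le.
assert (H2 : SC * lnsum n x <= SC * - ln (1 - x)) by (apply Rmult_le_compat_l; lra).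
assert (H3 : SC * - ln (1 - x) <= SC * lnsum n x + SC * (x ^ S n / (1 - x))).
{ rewrite <- Rmult_plus_distr_l; apply Rmult_le_compat_l; lra. }
lra.
Qed.

Fixpoint fib_list (n : nat) (x y : Z) : list Z :=
  match n with O => [] | S n' => x :: fib_list n' y (x + y)%Z end.

Lemma length_fib_list n : forall x y, length (fib_list n x y) = n.
Proof. induction n as [|n IH]; intros x y; [reflexivity|]; simpl; rewrite IH; reflexivity. Qed.

Lemma nth_fib_list n : forall j i, (i < n)%nat ->
  nth i (fib_list n (fib j) (fib (S j))) 0%Z = fib (j + i).
Proof.
induction n as [|n IH]; intros j i Hi; [lia|].
destruct i as [|i]; [rewrite Nat.add_0_r; reflexivity|].
cbn [nth fib_list]; replace (fib j + fib (S j))%Z with (fib (S (S j))) by (rewrite fib_SS; ring).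
rewrite IH by lia; f_equal; lia.
Qed.

Definition ftab (K : nat) : list Z := rev (fib_list (S K) 0 1).

Lemma nth_ftab K j : (j <= K)%nat -> nth j (ftab K) 0%Z = fib (K - j).
Proof.
intros Hj; unfold ftab; rewrite rev_nth by (rewrite length_fib_list; lia).
rewrite length_fib_list; change 0%Z with (fib 0) at 1; change 1%Z with (fib 1).
rewrite nth_fib_list by lia; f_equal; lia.
Qed.

Definition lamZ (K : nat) (tab : list Z) (a : nat) : Z :=
  zsum (seq 0 (K / a)) (fun k => nth (a * S k) tab 0 / Z.of_nat (S k))%Z.

Definition lam (a : nat) : R := - ln (1 - / al ^ a).

(** By Binet's formula only powers of [be] survive, so the difference is at most 2 / sqrt 5 < 1. *)
Lemma fib_scaled K j : (j <= K)%nat -> Rabs (IZR (fib K) * (/ al) ^ j - IZR (fib (K - j))) <= 1.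
Proof.
intros Hj; assert (Ba := al_bounds); assert (Bb := be_bounds); assert (B5 := sqrt5_bounds).
assert (Hbk : forall i, Rabs (be ^ i) <= 1) by exact be_pow_le.
assert (Hia : forall i, 0 < (/ al) ^ i <= 1).
{ intros i; split; [apply pow_lt, Rinv_0_lt_compat; lra|].
  rewrite <- (pow1 i); apply pow_incr; split; [left; apply Rinv_0_lt_compat; lra|].
  rewrite <- Rinv_1; apply Rinv_le_contravar; lra. }
assert (E : sqrt 5 * (IZR (fib K) * (/ al) ^ j - IZR (fib (K - j))) = be ^ (K - j) - be ^ K * (/ al) ^ j).
{ assert (B1 := binet K); assert (B2 := binet (K - j)).
  assert (E1 : al ^ K * (/ al) ^ j = al ^ (K - j)).
  { replace K with ((K - j) + j)%nat at 1 by lia; rewrite pow_add, Rmult_assoc, <- Rpow_mult_distr, Rinv_r, pow1 by lra; ring. }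
  rewrite Rmult_minus_distr_l, <- Rmult_assoc, B1, B2, <- E1; ring. }
assert (H1 := Hbk (K - j)%nat); assert (H2 := Hbk K); assert (H3 := Hia j).
assert (H4 : Rabs (be ^ K * (/ al) ^ j) <= 1).
{ rewrite Rabs_mult, (Rabs_right ((/ al) ^ j)) by lra; assert (H5 := Rabs_pos (be ^ K)); nra. }
apply Rabs_le_inv in H1; apply Rabs_le_inv in H4; apply Rabs_le; split;
  (apply Rmult_le_reg_l with (sqrt 5); [lra|rewrite E; lra]).
Qed.

Lemma lamZ_spec K a : (1 <= a)%nat -> (a <= K)%nat ->
  Rabs (IZR (fib K) * lam a - IZR (lamZ K (ftab K) a)) <= 2 * INR K + 3.
Proof.
intros Ha HaK; unfold lam.
assert (Ba := al_bounds).
assert (Hia : 0 < / al < 1).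
{ split; [apply Rinv_0_lt_compat; lra|rewrite <- Rinv_1; apply Rinv_lt_contravar; lra]. }
set (x := / al ^ a).
assert (Ex : x = (/ al) ^ a) by (unfold x; rewrite pow_inv; reflexivity).
assert (Hx1 : x <= / al).
{ rewrite Ex; replace a with (1 + (a - 1))%nat by lia; rewrite pow_add, pow_1.
  assert ((/ al) ^ (a - 1) <= 1).
  { rewrite <- (pow1 (a - 1)); apply pow_incr; lra. }
  assert (0 < (/ al) ^ (a - 1)) by (apply pow_lt; lra); nra. }
assert (Hx : 0 < x < 1) by (split; [rewrite Ex; apply pow_lt; lra|lra]).
assert (HF : 0 <= IZR (fib K)) by (apply IZR_le, fib_nonneg).
set (n := (K / a)%nat).
assert (Hn : (a * n <= K)%nat) by apply Nat.Div0.mul_div_le.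
assert (Hn1 : (K < a * S n)%nat) by (apply Nat.mul_succ_div_gt; lia).
assert (H := lnsum_approx n x (IZR (fib K)) 1 (fun j => nth (a * j) (ftab K) 0%Z) Hx ltac:(lra)).
eapply Rle_trans; [apply H|].
- intros k Hk; rewrite nth_ftab by nia; rewrite Ex, <- pow_mult; apply fib_scaled; nia.
- assert (H1 : 0 <= IZR (fib K) * x ^ S n <= 1).
  { split; [apply Rmult_le_pos; [exact HF|apply pow_le; lra]|].
    rewrite Ex, <- pow_mult; replace (a * S n)%nat with (K + (a * S n - K))%nat by lia.
    rewrite pow_add.
    assert (Hp : (/ al) ^ (a * S n - K) <= 1) by (rewrite <- (pow1 (a * S n - K)); apply pow_incr; lra).
    assert (Hq : 0 < (/ al) ^ (a * S n - K)) by (apply pow_lt; lra).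
    assert (Hr : IZR (fib K) * (/ al) ^ K <= 1).
    { assert (Hf : IZR (fib K) <= al ^ K).
      { destruct K as [|K']; [simpl; lra|]; eapply Rle_trans; [apply fib_le_al|].
        apply Rle_pow; [lra|lia]. }
      apply Rle_trans with (al ^ K * (/ al) ^ K).
      - apply Rmult_le_compat_r; [apply pow_le; lra|exact Hf].
      - rewrite <- Rpow_mult_distr, Rinv_r, pow1 by lra; lra. }
    assert (0 <= IZR (fib K) * (/ al) ^ K) by (apply Rmult_le_pos; [exact HF|apply pow_le; lra]).
    nra. }
  assert (H2 : 0 < / (1 - x) <= 3).
  { split; [apply Rinv_0_lt_compat; lra|].
    assert (Hxa : / al <= 0.6181).
    { apply Rmult_le_reg_r with al; [lra|]; rewrite Rinv_l by lra; nra. }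
    apply Rmult_le_reg_r with (1 - x); [lra|]; rewrite Rinv_l by lra; lra. }
  unfold Rdiv; rewrite <- Rmult_assoc; split; [apply Rmult_le_pos; lra|].
  replace 3 with (1 * 3) by ring; apply Rmult_le_compat; lra.
- exact HF.
- assert (INR n <= INR K) by (apply le_INR; nia).
  assert (0 <= INR n) by apply pos_INR; lra.
Qed.

Fixpoint ytab (n : nat) (y : Z) : list Z :=
  match n with O => [y] | S n' => y :: ytab n' (y / 3)%Z end.

(** The bound 1 - 3^(-j), sharper than 1, is what the induction carries: a further division adds at
    most (2/3) 3^(-j). *)
Lemma nth_ytab n : forall y j, (j <= n)%nat ->
  0 <= IZR y * (/ 3) ^ j - IZR (nth j (ytab n y) 0%Z) <= 1 - (/ 3) ^ j.
Proof.
induction n as [|n IH]; intros y j Hj.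
- replace j with 0%nat by lia; simpl; lra.
- destruct j as [|j]; [simpl; lra|].
  simpl nth; specialize (IH (y / 3)%Z j ltac:(lia)).
  assert (E := Z.div_mod y 3 ltac:(lia)); assert (M := Z.mod_pos_bound y 3 ltac:(lia)).
  assert (Er : IZR y = 3 * IZR (y / 3) + IZR (y mod 3)) by (rewrite <- mult_IZR, <- plus_IZR; f_equal; exact E).
  assert (M1 : 0 <= IZR (y mod 3) <= 2) by (split; apply IZR_le; lia).
  assert (Hp : 0 < (/ 3) ^ j) by (apply pow_lt; lra).
  replace (IZR y * (/ 3) ^ S j) with (IZR (y / 3) * (/ 3) ^ j + IZR (y mod 3) / 3 * (/ 3) ^ j)
    by (rewrite Er; simpl; field).
  replace ((/ 3) ^ S j) with (/ 3 * (/ 3) ^ j) by reflexivity.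
  assert (0 <= IZR (y mod 3) / 3 * (/ 3) ^ j <= 2 / 3 * (/ 3) ^ j); [|lra].
  split; [apply Rmult_le_pos; lra|apply Rmult_le_compat_r; lra].
Qed.

Definition muZ (K : nat) (tab : list Z) (b : nat) : Z :=
  zsum (seq 0 (K / b)) (fun k => nth (b * S k) tab 0 / Z.of_nat (S k))%Z.

Definition mu (b : nat) : R := - ln (1 - / 3 ^ b).

Lemma muZ_spec K y b : (1 <= b)%nat -> (b <= K)%nat -> (0 <= y <= 3 ^ Z.of_nat (S K))%Z ->
  Rabs (IZR y * mu b - IZR (muZ K (ytab K y) b)) <= 2 * INR K + 3.
Proof.
intros Hb HbK [Hy Hy1]; unfold mu.
apply IZR_le in Hy; apply IZR_le in Hy1; rewrite <- pow_IZR in Hy1.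
set (x := / 3 ^ b).
assert (Ex : x = (/ 3) ^ b) by (unfold x; rewrite pow_inv; reflexivity).
assert (Hp1 : forall i, 0 < (/ 3) ^ i <= 1).
{ intros i; split; [apply pow_lt; lra|rewrite <- (pow1 i); apply pow_incr; lra]. }
assert (Hx1 : x <= / 3).
{ rewrite Ex; replace b with (1 + (b - 1))%nat by lia; rewrite pow_add, pow_1.
  specialize (Hp1 (b - 1)%nat); nra. }
assert (Hx : 0 < x < 1) by (split; [rewrite Ex; apply Hp1|lra]).
set (n := (K / b)%nat).
assert (Hn : (b * n <= K)%nat) by apply Nat.Div0.mul_div_le.
assert (Hn1 : (K < b * S n)%nat) by (apply Nat.mul_succ_div_gt; lia).
assert (H := lnsum_approx n x (IZR y) 1 (fun j => nth (b * j) (ytab K y) 0%Z) Hx ltac:(lra)).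
eapply Rle_trans; [apply H|].
- intros k Hk; rewrite Ex, <- pow_mult.
  assert (Hv := nth_ytab K y (b * S k) ltac:(nia)); specialize (Hp1 (b * S k)%nat).
  apply Rabs_le; lra.
- assert (H1 : 0 <= IZR y * x ^ S n <= 1).
  { split; [apply Rmult_le_pos; [exact Hy|apply pow_le; lra]|].
    rewrite Ex, <- pow_mult; replace (b * S n)%nat with (S K + (b * S n - S K))%nat by lia.
    rewrite pow_add; assert (Hq := Hp1 (b * S n - S K)%nat).
    assert (Hr : IZR y * (/ 3) ^ S K <= 1).
    { apply Rle_trans with (3 ^ S K * (/ 3) ^ S K).
      - apply Rmult_le_compat_r; [apply pow_le; lra|exact Hy1].
      - rewrite <- Rpow_mult_distr, Rinv_r, pow1 by lra; lra. }
    assert (0 <= IZR y * (/ 3) ^ S K) by (apply Rmult_le_pos; [exact Hy|apply pow_le; lra]).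
    nra. }
  assert (H2 : 0 < / (1 - x) <= 3).
  { split; [apply Rinv_0_lt_compat; lra|].
    apply Rmult_le_reg_r with (1 - x); [lra|]; rewrite Rinv_l by lra; lra. }
  unfold Rdiv; rewrite <- Rmult_assoc; split; [apply Rmult_le_pos; lra|].
  replace 3 with (1 * 3) by ring; apply Rmult_le_compat; lra.
- exact Hy.
- assert (INR n <= INR K) by (apply le_INR; nia).
  assert (0 <= INR n) by apply pos_INR; lra.
Qed.

(** * Logarithms expressed through [lam] and [mu] *)

Lemma inv_al_pow a : 0 < / al ^ S a < 1.
Proof.
assert (Ba := al_bounds); assert (H := al_pow_ge_1 a).
assert (1 < al ^ S a) by (simpl; nra).
split; [apply Rinv_0_lt_compat; lra|rewrite <- Rinv_1; apply Rinv_lt_contravar; lra].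
Qed.

Lemma ln_al_pow_1 a : (1 <= a)%nat -> ln (al ^ a - 1) = INR a * ln al - lam a.
Proof.
intros Ha; destruct a as [|a]; [lia|].
assert (H := inv_al_pow a); assert (Ba := al_bounds).
assert (Hp : 0 < al ^ S a) by (apply pow_lt; lra).
unfold lam; rewrite <- ln_pow by lra.
replace (al ^ S a - 1) with (al ^ S a * (1 - / al ^ S a)) by (field; lra).
rewrite ln_mult by lra; ring.
Qed.

Lemma ln_3_pow_1 b : (1 <= b)%nat -> ln (3 ^ b - 1) = INR b * ln 3 - mu b.
Proof.
intros Hb; unfold mu.
assert (Hp : 1 < 3 ^ b) by (apply Rlt_pow_R1; [lra|lia]).
assert (/ 3 ^ b < 1) by (rewrite <- Rinv_1; apply Rinv_lt_contravar; lra).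
rewrite <- ln_pow by lra.
replace (3 ^ b - 1) with (3 ^ b * (1 - / 3 ^ b)) by (field; lra).
rewrite ln_mult by lra; ring.
Qed.

Lemma ln_al_lam : ln al = lam 1 / 2.
Proof.
assert (E := ln_al_pow_1 1 ltac:(lia)); rewrite pow_1 in E; simpl INR in E.
assert (Ba := al_bounds); assert (Hs := al_sq).
assert (E1 : al - 1 = / al).
{ apply Rmult_eq_reg_l with al; [rewrite Rinv_r by lra; nra|lra]. }
rewrite E1, ln_Rinv in E by lra; lra.
Qed.

(** From al^4 - 1 = sqrt 5 al^2, the coincidence that also makes [a = 4] exceptional. *)
Lemma ln_sqrt5_lam : ln (sqrt 5) = lam 1 - lam 4.
Proof.
assert (E := ln_al_pow_1 4 ltac:(lia)); assert (Ba := al_bounds).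
assert (E1 : al ^ 4 - 1 = sqrt 5 * al ^ 2).
{ replace (sqrt 5) with (2 * al - 1) by (unfold al; field).
  assert (H2 : al ^ 2 = al + 1) by (simpl; rewrite <- al_sq; ring).
  replace (al ^ 4) with (al ^ 2 * al ^ 2) by ring; rewrite !H2.
  assert (Hs : al * al = al + 1) by (rewrite <- H2; ring).
  replace ((al + 1) * (al + 1) - 1) with (al * al + 2 * al) by ring.
  replace ((2 * al - 1) * (al + 1)) with (2 * (al * al) + al - 1) by ring; rewrite Hs; ring. }
rewrite E1, ln_mult, ln_pow in E by (try apply s5_pos; try apply pow_lt; lra).
rewrite ln_al_lam in E; simpl INR in E; lra.
Qed.

(** From al^8 - 1 = 3 sqrt 5 al^4, the coincidence behind the exception [a = 8]. *)
Lemma ln_3_lam : ln 3 = lam 1 + lam 4 - lam 8.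
Proof.
assert (E := ln_al_pow_1 8 ltac:(lia)); assert (Ba := al_bounds).
assert (E1 : al ^ 8 - 1 = 3 * (sqrt 5 * al ^ 4)).
{ replace (sqrt 5) with (2 * al - 1) by (unfold al; field).
  assert (H2 : al ^ 2 = al + 1) by (simpl; rewrite <- al_sq; ring).
  assert (Hs : al * al = al + 1) by (rewrite <- H2; ring).
  assert (H4 : al ^ 4 = 3 * al + 2).
  { replace (al ^ 4) with (al ^ 2 * al ^ 2) by ring; rewrite !H2.
    replace ((al + 1) * (al + 1)) with (al * al + 2 * al + 1) by ring; rewrite Hs; ring. }
  replace (al ^ 8) with (al ^ 4 * al ^ 4) by ring; rewrite !H4.
  replace ((3 * al + 2) * (3 * al + 2)) with (9 * (al * al) + 12 * al + 4) by ring.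
  replace ((2 * al - 1) * (3 * al + 2)) with (6 * (al * al) + al - 2) by ring; rewrite Hs; ring. }
assert (H5 := s5_pos); assert (Hp : 0 < al ^ 4) by (apply pow_lt; lra).
rewrite E1, ln_mult, ln_mult, ln_pow, ln_sqrt5_lam, ln_al_lam in E by (lra || (apply Rmult_lt_0_compat; lra)).
simpl INR in E; lra.
Qed.

(** * The Baker-Davenport reduction *)

Lemma between_multiples G T r k : (0 < G -> G <= Z.abs r <= T - G -> 0 < T -> G <= Z.abs (k * T - r))%Z.
Proof.
intros HG H HT; destruct (Z.eq_dec k 0) as [->|Hk]; [rewrite Z.mul_0_l; lia|].
assert (T <= Z.abs (k * T))%Z by (rewrite Z.abs_mul, (Z.abs_eq T) by lia; nia); lia.
Qed.

(* [U * (x l1 - y l2 - th)], multiplied by [q], is within [5 q e + Y] of an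
   integer multiple of [T] minus [r - s]. *)
Lemma reduction (x y p q T Th M r s i j D Y G e : Z) (U l1 l2 th : R) :
  0 < U -> Rabs (U * l2 - IZR T) <= IZR e ->
  Rabs (U * th - IZR (Th - M)) <= IZR e ->
  Rabs (IZR x * (IZR q * l1 - IZR p * l2)) * U <= IZR Y ->
  (0 < q)%Z -> (Z.abs (Th - M) <= 2 * T)%Z -> G = (D + 5 * q * e + Y)%Z -> (2 * G <= T)%Z ->
  (0 < D)%Z -> (0 <= e)%Z -> (0 <= Y)%Z ->
  (q * Th = T * i + r)%Z -> (q * M = T * j + s)%Z -> (G <= Z.abs (r - s) <= T - G)%Z ->
  IZR D <= IZR q * U * Rabs (IZR x * l1 - IZR y * l2 - th).
Proof.
intros HU H2 Hth HY Hq HThM HG H2G HD He HY0 Er Es Hfar.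
set (dl := IZR x * l1 - IZR y * l2 - th).
destruct (Rle_lt_dec (IZR D) (IZR q * U * Rabs dl)) as [H|H]; [exact H|exfalso].
set (k := (x * p - y * q)%Z).
set (e2 := U * l2 - IZR T) in *; set (e3 := U * th - IZR (Th - M)) in *.
set (w := IZR x * (IZR q * l1 - IZR p * l2)) in *.
assert (Hqr : 1 <= IZR q) by (apply IZR_le; lia).
assert (Her : 0 <= IZR e) by (apply IZR_le; lia).
assert (HDr : 0 < IZR D) by (apply IZR_lt; lia).
assert (Hw : Rabs (w * U) <= IZR Y) by (rewrite Rabs_mult, (Rabs_right U) by lra; exact HY).
assert (Hd : Rabs (IZR q * U * dl) < IZR D).
{ rewrite Rabs_mult, (Rabs_right (IZR q * U)); [exact H|]; apply Rle_ge, Rmult_le_pos; lra. }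
assert (E1 : IZR q * U * dl = IZR k * (U * l2) + w * U - IZR q * (U * th)).
{ unfold dl, k, w; rewrite minus_IZR, !mult_IZR; ring. }
assert (HT5 : 5 * IZR q * IZR e + IZR D + IZR Y <= IZR T / 2).
{ assert (H5 : IZR (2 * (D + 5 * q * e + Y)) <= IZR T) by (apply IZR_le; lia).
  rewrite mult_IZR, !plus_IZR, !mult_IZR in H5; lra. }
assert (HThR : Rabs (IZR (Th - M)) <= 2 * IZR T).
{ rewrite <- abs_IZR, <- mult_IZR; apply IZR_le; lia. }
assert (HYr : 0 <= IZR Y) by (apply IZR_le; lia).
apply Rabs_le_inv in H2; apply Rabs_le_inv in Hth; apply Rabs_le_inv in Hw; apply Rabs_le_inv in HThR.
apply Rabs_def2 in Hd.
assert (Hqe : IZR e <= IZR q * IZR e) by nra.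
assert (HTq : IZR T <= IZR q * IZR T) by nra.
assert (Hk : (Z.abs k < 4 * q)%Z).
{ assert (Hl2 : IZR T - IZR e <= U * l2) by (unfold e2 in H2; lra).
  assert (Hqth : Rabs (IZR q * (U * th)) <= IZR q * (2 * IZR T + IZR e)).
  { rewrite Rabs_mult, Rabs_right by lra; apply Rmult_le_compat_l; [lra|]; apply Rabs_le; unfold e3 in Hth; lra. }
  apply Rabs_le_inv in Hqth.
  assert (Hkb : Rabs (IZR k * (U * l2)) < 4 * IZR q * (U * l2)).
  { apply Rlt_le_trans with (4 * IZR q * (IZR T - IZR e)); [|apply Rmult_le_compat_l; lra].
    apply Rabs_def1; nra. }
  rewrite Rabs_mult, (Rabs_right (U * l2)) in Hkb by lra.
  apply Rmult_lt_reg_r in Hkb; [|lra].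
  apply lt_IZR; rewrite abs_IZR, mult_IZR; exact Hkb. }
assert (Hke : Rabs (IZR k * e2) <= 4 * IZR q * IZR e).
{ rewrite Rabs_mult; apply Rmult_le_compat; try apply Rabs_pos.
  - rewrite <- abs_IZR, <- mult_IZR; apply IZR_le; lia.
  - apply Rabs_le; exact H2. }
assert (Hqe3 : Rabs (IZR q * e3) <= IZR q * IZR e).
{ rewrite Rabs_mult, Rabs_right by lra; apply Rmult_le_compat_l; [lra|]; apply Rabs_le; exact Hth. }
assert (E2 : IZR ((k - i + j) * T - (r - s)) =
  IZR q * U * dl - IZR k * e2 - w * U + IZR q * e3).
{ replace ((k - i + j) * T - (r - s))%Z with (k * T - q * (Th - M))%Z by lia.
  rewrite E1; unfold e2, e3; rewrite minus_IZR, !mult_IZR; ring. }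
assert (Hb := between_multiples G T (r - s) (k - i + j) ltac:(lia) Hfar ltac:(lia)).
apply IZR_le in Hb; rewrite abs_IZR, E2, HG, !plus_IZR, !mult_IZR in Hb.
apply Rabs_le_inv in Hke; apply Rabs_le_inv in Hqe3.
assert (Habs : Rabs (IZR q * U * dl - IZR k * e2 - w * U + IZR q * e3) <
  IZR D + 5 * IZR q * IZR e + IZR Y) by (apply Rabs_def1; lra).
lra.
Qed.

(** * Integer computation of the reduction *)

Open Scope Z_scope.

(* [digit_sum w x] adds the entries of [w] at the binary digits of [x]; applied to
   [doubles], it computes [r * x] modulo [T], in units of [2 ^ s], without
   multiplying or dividing large numbers. *)
Fixpoint digit_sum (w : list Z) (x : positive) : Z :=
  match w with
  | [] => 0
  | u :: w' =>
    match x with xH => u | xO x' => digit_sum w' x' | xI x' => u + digit_sum w' x' end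
  end.

Fixpoint doubles (n : nat) (T s r : Z) : list Z :=
  match n with
  | O => []
  | S n' => Z.shiftr r s :: doubles n' T s (if 2 * r <? T then 2 * r else 2 * r - T)
  end.

(** [E] collects the low parts cut off by the shifts, less than one unit 2^s for each of at most [n]
    digits. *)
Lemma digit_sum_doubles n T s : 0 <= s -> forall r x, 0 <= r < T -> Z.pos x < 2 ^ Z.of_nat n ->
  exists i E, r * Z.pos x = T * i + 2 ^ s * digit_sum (doubles n T s r) x + E /\
    0 <= E <= Z.of_nat n * 2 ^ s /\ 0 <= digit_sum (doubles n T s r) x <= Z.of_nat n * (T / 2 ^ s).
Proof.
intros Hs; assert (HS : 0 < 2 ^ s) by (apply Z.pow_pos_nonneg; lia).
induction n as [|n IH]; intros r x Hr Hx; [simpl in Hx; lia|].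
rewrite Nat2Z.inj_succ, Z.pow_succ_r in Hx by lia.
cbn [doubles]; rewrite Z.shiftr_div_pow2 by lia.
assert (Er := Z.div_mod r (2 ^ s) ltac:(lia)); assert (Mr := Z.mod_pos_bound r (2 ^ s) HS).
assert (Hd : 0 <= r / 2 ^ s <= T / 2 ^ s).
{ split; [apply Z.div_pos; lia|apply Z.div_le_mono; lia]. }
set (r' := if 2 * r <? T then 2 * r else 2 * r - T).
assert (Hr' : 0 <= r' < T /\ exists d, 2 * r = T * d + r').
{ unfold r'; destruct (Z.ltb_spec (2 * r) T); split; try lia; [exists 0|exists 1]; lia. }
destruct Hr' as [Hr' [d Hd']].
assert (Hn0 : 0 <= T / 2 ^ s) by lia.
rewrite Nat2Z.inj_succ; destruct x as [x|x|]; cbn [digit_sum].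
- destruct (IH r' x Hr' ltac:(lia)) as (i & E & H1 & H2 & H3).
  exists (i + d * Z.pos x), (E + r mod 2 ^ s); repeat split; try lia.
- destruct (IH r' x Hr' ltac:(lia)) as (i & E & H1 & H2 & H3).
  exists (i + d * Z.pos x), E; repeat split; try lia.
- exists 0, (r mod 2 ^ s); repeat split; nia.
Qed.

Definition residue (w : list Z) (t x : Z) : Z :=
  match x with Zpos x => digit_sum w x mod t | _ => 0 end.

(** The digit sum is reduced modulo the truncated [T]; each of the at most [n] wraps misplaces less
    than one unit 2^s. *)
Lemma residue_spec n T s q x : 0 <= s -> 0 <= q < T -> 2 ^ s <= T -> 0 <= x < 2 ^ Z.of_nat n ->
  exists i E, q * x = T * i + (2 ^ s * residue (doubles n T s q) (T / 2 ^ s) x + E) /\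
    Z.abs E <= Z.of_nat n * 2 ^ s.
Proof.
intros Hs Hq HT Hx; assert (HS : 0 < 2 ^ s) by (apply Z.pow_pos_nonneg; lia).
destruct x as [|x|x]; [|unfold residue|lia].
- exists 0, 0; simpl residue; nia.
- destruct (digit_sum_doubles n T s Hs q x Hq ltac:(lia)) as (i & E & H1 & H2 & H3).
  set (v := digit_sum _ x) in *; set (t := T / 2 ^ s) in *.
  assert (Ht : 0 < t) by (apply Z.div_str_pos; lia).
  assert (Ev := Z.div_mod v t ltac:(lia)).
  assert (ET := Z.div_mod T (2 ^ s) ltac:(lia)); assert (MT := Z.mod_pos_bound T (2 ^ s) HS).
  fold t in ET; set (k := v / t) in *.
  assert (Hk : 0 <= k <= Z.of_nat n).
  { split; [apply Z.div_pos; lia|]; apply Z.div_le_upper_bound; lia. }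
  exists (i + k), (E - k * (T mod 2 ^ s)); split; [|nia].
  assert (E1 : T * k = 2 ^ s * (t * k) + T mod 2 ^ s * k) by (rewrite ET at 1; ring).
  assert (E2 : 2 ^ s * v = 2 ^ s * (t * k) + 2 ^ s * (v mod t)) by (rewrite Ev at 1; ring).
  lia.
Qed.

(** The margin 2n + 1 covers the errors of both residues and the rounding of [G], in units of
    [S]. *)
Lemma far_truncated r s E E' G T S n : 0 < S -> Z.abs E <= n * S -> Z.abs E' <= n * S ->
  G / S + 1 + 2 * n <= Z.abs (r - s) <= T / S - (G / S + 1 + 2 * n) ->
  G <= Z.abs ((S * r + E) - (S * s + E')) <= T - G.
Proof.
intros HS HE HE' H.
assert (EG := Z.div_mod G S ltac:(lia)); assert (MG := Z.mod_pos_bound G S HS).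
assert (ET := Z.div_mod T S ltac:(lia)); assert (MT := Z.mod_pos_bound T S HS).
set (d := r - s) in *.
replace (S * r + E - (S * s + E')) with (S * d + (E - E')) by (unfold d; ring).
assert (H1 : S * (G / S + 1 + 2 * n) <= S * Z.abs d <= S * (T / S - (G / S + 1 + 2 * n))) by nia.
assert (H2 : S * Z.abs d = Z.abs (S * d)) by (rewrite Z.abs_mul; lia).
rewrite H2 in H1; lia.
Qed.

(** Covers the worst total, for the constant [th] with K <= 1100 and KB <= 500: 6 * 2203 + 2 * 1003
    = 15224. *)
Definition log_error : Z := 16384.

(* Fixed-point values of [ln 3] and [ln (sqrt 5)] in units of [1 / (2 * fib K)]. *)
Definition l3Z (K : nat) (t : list Z) : Z := 2 * (lamZ K t 1 + lamZ K t 4 - lamZ K t 8).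
Definition s5Z (K : nat) (t : list Z) : Z := 2 * (lamZ K t 1 - lamZ K t 4).

(** Pairs for which ln (sqrt 5) + lam a - mu b can be an integer combination of [ln al] and [ln 3],
    so that no reduction succeeds: 2 ln al for [a = 4] and 4 ln al - ln 3 for [a = 8], both with
    [b = 0], and 6 ln al - 2 ln 3 for (12, 2), as al^12 - 1 = 8 sqrt 5 al^6 and 3^2 - 1 = 8. *)
Definition exempt (a b : nat) : bool :=
  ((a =? 4) || (a =? 8) || ((a =? 12) && (b =? 2)))%nat.

Definition in_range (T : Z) (l : list (nat * Z)) : bool :=
  forallb (fun u => (0 <=? snd u) && (snd u <=? 2 * T)) l.

Definition all_far (G T : Z) (ra rb : list (nat * Z)) : bool :=
  forallb (fun u => forallb (fun v =>
    let d := Z.abs (snd u - snd v) in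
    ((G <=? d) && (d <=? T - G)) || exempt (fst u) (fst v)) rb) ra.

Definition reduces (n B0 : nat) (q T U Y D F s : Z) (ta tb : list (nat * Z)) : bool :=
  let G := D + 5 * q * log_error + Y in
  let t := Z.shiftr T s in
  let w := doubles n T s q in
  let res := map (fun u => (fst u, residue w t (snd u))) in
  (0 <? q) && (q <? T) && (0 <? t) && (2 * T <? 2 ^ Z.of_nat n) &&
  (0 <? D) && (2 * G <=? T) && (0 <=? Y) && (13 * U * q <? F * D) &&
  (13 * U * q <? 3 ^ Z.of_nat B0 * D) && in_range T ta && in_range T tb &&
  all_far (Z.shiftr G s + 1 + 2 * Z.of_nat n) t (res ta) (res tb).

(** The error of p/q is multiplied by [n], which may reach [N], so it is measured with the higher
    index [K1], and [K] serves for the constants. The round excludes forms smaller than about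
    2^(-Db) / q, so al^A0 and 3^B0 have to exceed about 13 q 2^Db. *)
Definition round (K1 K KB A0 B0 n : nat) (N p q Db s : Z) : bool :=
  let t1 := ftab K1 in
  let X1 := Z.abs (q * lamZ K1 t1 1 - p * l3Z K1 t1) + (p + q) * log_error in
  let t := ftab K in
  let F := hd 0 t in
  let y := ytab KB F in
  let s5 := s5Z K t in
  (F <=? 3 ^ Z.of_nat (S KB)) &&
  reduces n B0 q (l3Z K t) (2 * F) (N * X1 * F / hd 0 t1 + 1) (Z.shiftr (2 * F) Db)
    (nth (K - A0 - 1) t 0) s
    (map (fun a => (a, s5 + 2 * lamZ K t a)) (seq 0 A0))
    (map (fun b => (b, 2 * muZ KB y b)) (seq 0 B0)).

Open Scope R_scope.

(* The index [0] stands for an absent term, since [ln 0 = 0] in Rocq. *)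
Lemma ln_0 : ln 0 = 0.
Proof. unfold ln; destruct (Rlt_dec 0 0) as [H|H]; [destruct (Rlt_irrefl 0 H)|reflexivity]. Qed.

Lemma lam_0 : lam 0 = 0.
Proof. unfold lam; rewrite pow_O, Rinv_1, Rminus_diag, ln_0; ring. Qed.

Lemma mu_0 : mu 0 = 0.
Proof. unfold mu; rewrite pow_O, Rinv_1, Rminus_diag, ln_0; ring. Qed.

Lemma lamZ_error K a : (a <= K)%nat ->
  Rabs (IZR (fib K) * lam a - IZR (lamZ K (ftab K) a)) <= 2 * INR K + 3.
Proof.
intros H; destruct a as [|a]; [|apply lamZ_spec; lia].
rewrite lam_0; unfold lamZ; simpl (K / 0)%nat; simpl zsum.
rewrite Rmult_0_r, Rminus_diag, Rabs_R0; generalize (pos_INR K); lra.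
Qed.

Lemma muZ_error K y b : (b <= K)%nat -> (0 <= y <= 3 ^ Z.of_nat (S K))%Z ->
  Rabs (IZR y * mu b - IZR (muZ K (ytab K y) b)) <= 2 * INR K + 3.
Proof.
intros H Hy; destruct b as [|b]; [|apply muZ_spec; lia || exact Hy].
rewrite mu_0; unfold muZ; simpl (K / 0)%nat; simpl zsum.
rewrite Rmult_0_r, Rminus_diag, Rabs_R0; generalize (pos_INR K); lra.
Qed.

Lemma hd_ftab K : hd 0%Z (ftab K) = fib K.
Proof.
assert (H := nth_ftab K 0 ltac:(lia)); rewrite Nat.sub_0_r in H; rewrite <- H.
destruct (ftab K); reflexivity.
Qed.

Lemma l3Z_error K : (8 <= K <= 1100)%nat ->
  Rabs (2 * IZR (fib K) * ln 3 - IZR (l3Z K (ftab K))) <= IZR log_error.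
Proof.
intros HK; unfold l3Z; rewrite ln_3_lam, mult_IZR, minus_IZR, plus_IZR; unfold log_error.
assert (H1 := lamZ_error K 1 ltac:(lia)); assert (H4 := lamZ_error K 4 ltac:(lia)).
assert (H8 := lamZ_error K 8 ltac:(lia)).
assert (HK2 : INR K <= 1100) by (replace 1100 with (INR 1100) by (rewrite INR_IZR_INZ; reflexivity); apply le_INR; lia).
apply Rabs_le_inv in H1; apply Rabs_le_inv in H4; apply Rabs_le_inv in H8.
apply Rabs_le; lra.
Qed.

Lemma s5Z_error K : (8 <= K)%nat ->
  Rabs (2 * IZR (fib K) * ln (sqrt 5) - IZR (s5Z K (ftab K))) <= 4 * (2 * INR K + 3).
Proof.
intros HK; unfold s5Z; rewrite ln_sqrt5_lam, mult_IZR, minus_IZR.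
assert (H1 := lamZ_error K 1 ltac:(lia)); assert (H4 := lamZ_error K 4 ltac:(lia)).
apply Rabs_le_inv in H1; apply Rabs_le_inv in H4; apply Rabs_le; lra.
Qed.

Lemma INR_1100 K : (K <= 1100)%nat -> INR K <= 1100.
Proof.
intros H; replace 1100 with (INR 1100) by (rewrite INR_IZR_INZ; reflexivity); apply le_INR; lia.
Qed.

Lemma ratio_error K p q : (8 <= K <= 1100)%nat -> (0 <= p)%Z -> (0 <= q)%Z ->
  Rabs (IZR q * ln al - IZR p * ln 3) * (2 * IZR (fib K)) <=
  IZR (Z.abs (q * lamZ K (ftab K) 1 - p * l3Z K (ftab K)) + (p + q) * log_error).
Proof.
intros HK Hp Hq.
assert (H3 := l3Z_error K HK); assert (H1 := lamZ_error K 1 ltac:(lia)).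
assert (HK2 := INR_1100 K ltac:(lia)).
apply IZR_le in Hp; apply IZR_le in Hq.
assert (HF : 0 <= 2 * IZR (fib K)) by (generalize (IZR_le _ _ (fib_nonneg K)); lra).
rewrite <- (Rabs_right (2 * IZR (fib K))), <- Rabs_mult by lra.
replace ((IZR q * ln al - IZR p * ln 3) * (2 * IZR (fib K))) with
  (IZR (q * lamZ K (ftab K) 1 - p * l3Z K (ftab K)) +
   (IZR q * (IZR (fib K) * lam 1 - IZR (lamZ K (ftab K) 1)) -
    IZR p * (2 * IZR (fib K) * ln 3 - IZR (l3Z K (ftab K))))).
2:{ rewrite ln_al_lam, minus_IZR, !mult_IZR; field. }
eapply Rle_trans; [apply Rabs_triang|].
rewrite plus_IZR, abs_IZR; apply Rplus_le_compat_l.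
unfold Rminus at 1; eapply Rle_trans; [apply Rabs_triang|].
rewrite Rabs_Ropp, !Rabs_mult, (Rabs_right (IZR q)), (Rabs_right (IZR p)) by lra.
rewrite mult_IZR, plus_IZR.
assert (Rabs (IZR (fib K) * lam 1 - IZR (lamZ K (ftab K) 1)) <= IZR log_error) by (unfold log_error; lra).
nra.
Qed.

(** [reduction] bounds the form below by D / (q U). The two size tests in [reduces] put 13/E under
    this value; for E = al^A0 through F_(A0+1) <= al^A0. *)
Lemma round_bound K1 K KB A0 B0 n N p q Db s :
  round K1 K KB A0 B0 n N p q Db s = true ->
  (8 <= K1 <= 1100)%nat -> (8 <= K <= 1100)%nat -> (KB <= 500)%nat ->
  (A0 + 1 <= K)%nat -> (B0 <= KB)%nat -> (0 <= p)%Z -> (0 <= s)%Z -> (0 <= N)%Z ->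
  forall x y a b E, (0 <= x <= N)%Z -> (a < A0)%nat -> (b < B0)%nat -> exempt a b = false ->
  E = al ^ A0 \/ E = 3 ^ B0 ->
  ~ Rabs (IZR x * ln al - IZR y * ln 3 - (ln (sqrt 5) + lam a - mu b)) <= 13 / E.
Proof.
intros Hr HK1 HK HKB HA0 HB0 Hp Hs HN x y a b E Hx Ha Hb Hex HE Hsmall.
unfold round in Hr; rewrite !hd_ftab, nth_ftab in Hr by lia.
replace (K - (K - A0 - 1))%nat with (S A0) in Hr by lia.
set (X1 := (Z.abs _ + _ * log_error)%Z) in Hr.
set (T := l3Z K (ftab K)) in *.
set (Y := (N * X1 * fib K / fib K1 + 1)%Z) in *.
set (D := Z.shiftr _ Db) in *.
apply andb_prop in Hr; destruct Hr as [HF Hr]; apply Z.leb_le in HF.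
unfold reduces in Hr.
set (G := (D + 5 * q * log_error + Y)%Z) in *.
set (res := fun u : nat * Z => _) in Hr.
rewrite !andb_true_iff, !Z.ltb_lt, !Z.leb_le in Hr.
destruct Hr as [[[[[[[[[[[Hq HqT] Ht] HT2] HD] HG] HY] HFD] H3D] Hra] Hrb] Hfar].
unfold in_range in Hra, Hrb; unfold all_far in Hfar.
rewrite forallb_forall in Hra, Hrb, Hfar.
set (Th := (s5Z K (ftab K) + 2 * lamZ K (ftab K) a)%Z).
set (M := (2 * muZ KB (ytab KB (fib K)) b)%Z).
assert (Ina : In (a, Th) (map (fun a => (a, (s5Z K (ftab K) + 2 * lamZ K (ftab K) a)%Z)) (seq 0 A0))).
{ apply in_map_iff; exists a; split; [reflexivity|apply in_seq; lia]. }
assert (Inb : In (b, M) (map (fun b => (b, (2 * muZ KB (ytab KB (fib K)) b)%Z)) (seq 0 B0))).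
{ apply in_map_iff; exists b; split; [reflexivity|apply in_seq; lia]. }
specialize (Hra _ Ina); specialize (Hrb _ Inb); cbn [snd] in Hra, Hrb.
rewrite andb_true_iff, !Z.leb_le in Hra, Hrb.
specialize (Hfar (res (a, Th)) (in_map res _ _ Ina)).
rewrite forallb_forall in Hfar; specialize (Hfar (res (b, M)) (in_map res _ _ Inb)).
unfold res in Hfar; cbn [fst snd] in Hfar.
rewrite Hex, orb_false_r, andb_true_iff, !Z.leb_le, !Z.shiftr_div_pow2 in Hfar by lia.
rewrite Z.shiftr_div_pow2 in Ht by lia.
assert (HS : (0 < 2 ^ s)%Z) by (apply Z.pow_pos_nonneg; lia).
assert (HTS : (2 ^ s <= T)%Z).
{ assert (E0 := Z.div_mod T (2 ^ s) ltac:(lia)); assert (M0 := Z.mod_pos_bound T (2 ^ s) HS); nia. }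
destruct (residue_spec n T s q Th Hs ltac:(lia) HTS ltac:(lia)) as (i & e & Er & He).
destruct (residue_spec n T s q M Hs ltac:(lia) HTS ltac:(lia)) as (j & e' & Es & He').
assert (Hfar2 := far_truncated _ _ e e' G T (2 ^ s) (Z.of_nat n) HS He He' Hfar).
assert (HFK : (0 < fib K)%Z) by (destruct K as [|K']; [lia|apply fib_pos]).
assert (HFK1 : (0 < fib K1)%Z) by (destruct K1 as [|K']; [lia|apply fib_pos]).
assert (HU : 0 < 2 * IZR (fib K)) by (apply IZR_lt in HFK; lra).
assert (Hth : Rabs (2 * IZR (fib K) * (ln (sqrt 5) + lam a - mu b) - IZR (Th - M)) <= IZR log_error).
{ unfold Th, M; rewrite minus_IZR, plus_IZR, !mult_IZR.
  assert (H1 := s5Z_error K ltac:(lia)); assert (H2 := lamZ_error K a ltac:(lia)).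
  assert (H3 := muZ_error KB (fib K) b ltac:(lia) ltac:(lia)).
  assert (HKr := INR_1100 K ltac:(lia)).
  assert (HKBr : INR KB <= 500) by (replace 500 with (INR 500) by (rewrite INR_IZR_INZ; reflexivity); apply le_INR; lia).
  apply Rabs_le_inv in H1; apply Rabs_le_inv in H2; apply Rabs_le_inv in H3.
  apply Rabs_le; unfold log_error; lra. }
assert (HYb : Rabs (IZR x * (IZR q * ln al - IZR p * ln 3)) * (2 * IZR (fib K)) <= IZR Y).
{ assert (H1 := ratio_error K1 p q HK1 Hp ltac:(lia)); fold X1 in H1.
  rewrite Rabs_mult, (Rabs_right (IZR x)) by (apply Rle_ge, IZR_le; lia).
  set (kap := Rabs (IZR q * ln al - IZR p * ln 3)) in *.
  assert (Hk0 : 0 <= kap) by apply Rabs_pos.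
  assert (HY1 : (N * X1 * fib K <= Y * fib K1)%Z).
  { unfold Y; assert (E0 := Z.div_mod (N * X1 * fib K) (fib K1) ltac:(lia)).
    assert (M0 := Z.mod_pos_bound (N * X1 * fib K) (fib K1) HFK1); lia. }
  apply IZR_le in HY1; rewrite !mult_IZR in HY1.
  apply IZR_lt in HFK, HFK1.
  assert (Hx1 : 0 <= IZR x <= IZR N) by (split; apply IZR_le; lia).
  apply Rmult_le_reg_r with (IZR (fib K1)); [exact HFK1|].
  apply Rle_trans with (2 := HY1).
  assert (H5 : IZR x * (kap * (2 * IZR (fib K1))) <= IZR N * IZR X1).
  { apply Rmult_le_compat; [lra| |lra|exact H1]; apply Rmult_le_pos; lra. }
  nra. }
assert (Hred := reduction x y p q T Th M _ _ i j D Y G log_error (2 * IZR (fib K)) (ln al) (ln 3)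
  (ln (sqrt 5) + lam a - mu b) HU (l3Z_error K HK) Hth HYb Hq ltac:(lia) eq_refl HG HD
  ltac:(unfold log_error; lia) HY Er Es Hfar2).
assert (HE1 : 0 < E /\ 13 * (2 * IZR (fib K)) * IZR q < E * IZR D).
{ apply IZR_lt in HFD, H3D, HD; rewrite !mult_IZR in HFD, H3D.
  destruct HE as [-> | ->].
  - assert (H1 := fib_le_al A0); assert (Hp1 := al_pow_ge_1 A0); split; [lra|]; nra.
  - rewrite <- pow_IZR in H3D; split; [apply pow_lt; lra|exact H3D]. }
destruct HE1 as [HE1 HE2].
assert (Hq1 : 0 < IZR q) by (apply IZR_lt; exact Hq).
assert (H1 : IZR D <= IZR q * (2 * IZR (fib K)) * (13 / E)).
{ apply Rle_trans with (1 := Hred); apply Rmult_le_compat_l; [nra|exact Hsmall]. }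
apply (Rmult_le_compat_r E) in H1; [|lra].
replace (IZR q * (2 * IZR (fib K)) * (13 / E) * E) with (13 * (2 * IZR (fib K)) * IZR q) in H1 by (field; lra).
lra.
Qed.

Lemma thirteen_over P Q : 0 < P -> P <= Q -> 13 / Q <= 13 / P.
Proof.
intros HP HPQ; unfold Rdiv; apply Rmult_le_compat_l; [lra|].
apply Rinv_le_contravar; lra.
Qed.

(** Through [lam] and [mu] all four forms take the shape n ln al - m ln 3 - (ln (sqrt 5) + lam a -
    mu b), with index 0 for a part that is discarded. Comparing [a] with [A0] and [b] with [B0]
    selects the form. *)
Lemma round_sound K1 K KB A0 B0 n0 N p q Db s :
  round K1 K KB A0 B0 n0 N p q Db s = true ->
  (8 <= K1 <= 1100)%nat -> (8 <= K <= 1100)%nat -> (KB <= 500)%nat ->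
  (A0 + 1 <= K)%nat -> (B0 <= KB)%nat -> (0 <= p)%Z -> (0 <= s)%Z ->
  (8 <= A0)%nat -> (3 <= B0)%nat ->
  forall n1 a m1 b, (2 <= n1)%nat -> (1 <= a)%nat -> (1 <= b)%nat ->
  (fib (n1 + a) - fib n1 = 3 ^ Z.of_nat (m1 + b) - 3 ^ Z.of_nat m1)%Z ->
  exempt a b = false -> (Z.of_nat (n1 + a) <= N)%Z -> (n1 + a < A0)%nat.
Proof.
intros Hr HK1 HK HKB HA0 HB0 Hp Hs HA8 HB3 n1 a m1 b Hn1 Ha Hb Heq Hex HN.
apply Nat.nle_gt; intros Hbig.
assert (Hrb := round_bound _ _ _ _ _ _ _ _ _ _ _ Hr HK1 HK HKB HA0 HB0 Hp Hs ltac:(lia)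
  (Z.of_nat (n1 + a))).
assert (Hno : forall (y a' b' : nat) E, (a' < A0)%nat -> (b' < B0)%nat -> exempt a' b' = false ->
  E = al ^ A0 \/ E = 3 ^ B0 ->
  ~ Rabs (INR (n1 + a) * ln al - INR y * ln 3 - (ln (sqrt 5) + lam a' - mu b')) <= 13 / E).
{ intros y a' b' E H1 H2 H3 H4; rewrite !INR_IZR_INZ; apply Hrb; auto; lia. }
clear Hrb.
assert (Ba := al_bounds).
assert (Hal8 : 26 <= al ^ A0).
{ apply Rle_trans with (al ^ 8); [|apply Rle_pow; lra || lia].
  apply Rle_trans with (2 := fib_le_al 8); apply IZR_le; vm_compute; discriminate. }
assert (H3B : 26 <= 3 ^ B0).
{ apply Rle_trans with (3 ^ 3); [lra|apply Rle_pow; lra || lia]. }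
assert (Hmono : forall i j, (i <= j)%nat -> al ^ i <= al ^ j) by (intros; apply Rle_pow; lra || lia).
assert (Hmono3 : forall i j, (i <= j)%nat -> 3 ^ i <= 3 ^ j) by (intros; apply Rle_pow; lra || lia).
assert (Hex0 : forall b', exempt 0 b' = false) by reflexivity.
destruct (le_lt_dec A0 a) as [HaA|HaA]; destruct (le_lt_dec B0 b) as [HbB|HbB].
- assert (Hf : forall E, E = al ^ A0 \/ E = 3 ^ B0 -> E <= al ^ a -> E <= 3 ^ b -> False).
  { intros E HE H1 H2; apply (Hno (m1 + b)%nat 0%nat 0%nat E); auto; try lia.
    rewrite lam_0, mu_0; replace (ln (sqrt 5) + 0 - 0) with (ln (sqrt 5)) by ring.
    apply (form1 n1 a m1 b Hn1 Ha Hb Heq E); auto; destruct HE; lra. }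
  specialize (Hmono _ _ HaA); specialize (Hmono3 _ _ HbB).
  destruct (Rle_lt_dec (al ^ A0) (3 ^ B0)); [apply (Hf (al ^ A0))|apply (Hf (3 ^ B0))]; auto; lra.
- assert (H := form2b n1 a m1 b Hn1 Ha Hb Heq ltac:(specialize (Hmono _ _ HaA); lra)).
  assert (Hp3 : 1 < 3 ^ b) by (apply Rlt_pow_R1; lra || lia).
  rewrite ln_mult, ln_3_pow_1 in H by (lia || lra || apply s5_pos).
  apply (Hno (m1 + b)%nat 0%nat b (al ^ A0)); auto; try lia.
  rewrite lam_0; apply Rle_trans with (13 / al ^ a); [|apply thirteen_over; auto; lra].
  refine (Rle_trans _ _ _ (Req_le _ _ _) H); f_equal; rewrite !plus_INR; ring.
- assert (H := form2a n1 a m1 b Hn1 Ha Hb Heq).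
  rewrite ln_al_pow_1 in H by lia.
  assert (Hexa : exempt a 0 = false).
  { revert Hex; unfold exempt; destruct (a =? 4)%nat, (a =? 8)%nat, (a =? 12)%nat; auto. }
  apply (Hno (m1 + b)%nat a 0%nat (3 ^ B0)); auto; try lia.
  rewrite mu_0; apply Rle_trans with (13 / 3 ^ b); [|apply thirteen_over; auto; lra].
  specialize (Hmono3 _ _ HbB).
  apply Rle_trans with (3 / 3 ^ b).
  + refine (Rle_trans _ _ _ (Req_le _ _ _) H); f_equal; rewrite !plus_INR; ring.
  + unfold Rdiv; apply Rmult_le_compat_r; [left; apply Rinv_0_lt_compat; lra|lra].
- assert (H := form3 n1 a m1 b Hn1 Ha Hb Heq ltac:(specialize (Hmono _ _ Hbig); lra)).
  assert (Hp3 : 1 < 3 ^ b) by (apply Rlt_pow_R1; lra || lia).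
  rewrite ln_al_pow_1, ln_mult, ln_3_pow_1 in H by (lia || lra || apply s5_pos).
  apply (Hno (m1 + b)%nat a b (al ^ A0)); auto; try lia.
  specialize (Hmono _ _ Hbig).
  apply Rle_trans with (13 / al ^ (n1 + a)); [|apply thirteen_over; lra].
  apply Rle_trans with (7 / al ^ (n1 + a)).
  + refine (Rle_trans _ _ _ (Req_le _ _ _) H); f_equal; rewrite !plus_INR; ring.
  + unfold Rdiv; apply Rmult_le_compat_r; [left; apply Rinv_0_lt_compat; lra|lra].
Qed.

(* [p / q] is a convergent of the continued fraction of [ln al / ln 3], with [q] somewhat
   larger than the bound on [n] to be reduced. *)
Lemma round1_ok : round 1030 570 250 528 231 400 (2 ^ 320)
  290492209167051457366880945307266742860406105986835034462100081419155831900881504029168409048904704157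
  663197149641409579911238032966681120820273452601455298601774541649372993316679791586332388472834383887
  24 360 = true.
Proof. vm_cast_no_check (eq_refl true). Qed.

(** The first round leaves n < 528, below N = 560, so that a [q] of 22 bits suffices now. *)
Lemma round2_ok : round 120 120 60 58 25 100 560 1498319 3420680 14 50 = true.
Proof. vm_cast_no_check (eq_refl true). Qed.

Lemma small_bound n1 a m1 b : (2 <= n1)%nat -> (1 <= a)%nat -> (1 <= b)%nat ->
  (fib (n1 + a) - fib n1 = 3 ^ Z.of_nat (m1 + b) - 3 ^ Z.of_nat m1)%Z ->
  exempt a b = false -> (n1 + a < 58)%nat.
Proof.
intros Hn1 Ha Hb Heq Hex.
assert (Ha48 : a <> 4%nat /\ a <> 8%nat).
{ split; intros ->; discriminate Hex. }
assert (H := absolute_bound n1 a m1 b Hn1 Ha Hb Heq (proj1 Ha48) (proj2 Ha48)).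
assert (HN : (Z.of_nat (n1 + a) <= 2 ^ 320)%Z).
{ apply le_IZR; rewrite <- INR_IZR_INZ; change (2 ^ 320)%Z with (2 ^ Z.of_nat 320)%Z.
  rewrite <- pow_IZR; lra. }
assert (H1 : (n1 + a < 528)%nat).
{ apply (round_sound _ _ _ _ _ _ _ _ _ _ _ round1_ok) with m1 b; auto; lia. }
apply (round_sound _ _ _ _ _ _ _ _ _ _ _ round2_ok) with m1 b; auto; lia.
Qed.

(** * The exceptional pairs and the final search *)

Open Scope Z_scope.

(** F_6 = 8 = 3^2 - 1 cancels and leaves L_e = 3^m1 with e = n1 + 6. Divisibility by 27 forces 3 |
    e, which makes L_e even. *)
Lemma exempt_12_2 n1 m1 : (2 <= n1)%nat ->
  fib (n1 + 12) - fib n1 <> 3 ^ Z.of_nat (m1 + 2) - 3 ^ Z.of_nat m1.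
Proof.
intros Hn1 Heq; assert (Hd := fib_diff_even n1 6 ltac:(exists 3%nat; reflexivity)).
simpl (2 * 6)%nat in Hd; rewrite Heq in Hd; change (fib 6) with 8 in Hd.
rewrite Nat2Z.inj_add, Z.pow_add_r in Hd by lia; change (3 ^ Z.of_nat 2) with 9 in Hd.
set (e := (n1 + 6)%nat) in *.
assert (Hl : luc e = 3 ^ Z.of_nat m1) by lia.
assert (H29 := luc_ge_29 e ltac:(unfold e; lia)).
assert (Hm1 : (3 <= m1)%nat).
{ apply Nat.nlt_ge; intros Hlt; destruct m1 as [|[|[|m1]]]; simpl in Hl; lia. }
assert (H27 : (luc e + 0) mod 27 = 0).
{ rewrite Z.add_0_r, Hl; replace m1 with (m1 - 3 + 3)%nat by lia.
  rewrite Nat2Z.inj_add, Z.pow_add_r by lia; apply Z.mod_mul; discriminate. }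
assert (H2 : (luc e + 1) mod 2 = 0).
{ rewrite Hl; apply Z.mod_divide; [lia|]; destruct (Z.Even_or_Odd (3 ^ Z.of_nat m1)) as [[k Hk]|[k Hk]].
  - exfalso; assert (Hev : Z.Even (3 ^ Z.of_nat m1)) by (exists k; exact Hk).
    apply Z.even_spec in Hev; rewrite Z.even_pow in Hev by lia; discriminate.
  - exists (k + 1); lia. }
assert (O1 := luc_residues 27 72 (fun r => Nat.eqb (r mod 3) 0) e ltac:(lia) ltac:(lia)
  ltac:(vm_compute; reflexivity) 0 H27 ltac:(vm_compute; reflexivity)).
assert (O2 := luc_residues 2 3 (fun r => negb (Nat.eqb r 0)) e ltac:(lia) ltac:(lia)
  ltac:(vm_compute; reflexivity) 1 H2 ltac:(vm_compute; reflexivity)).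
apply Nat.eqb_eq in O1; change 72%nat with (3 * 24)%nat in O1.
rewrite Nat.Div0.mod_mul_r, (Nat.mul_comm 3), Nat.Div0.mod_add, Nat.Div0.mod_mod in O1.
rewrite O1 in O2; discriminate O2.
Qed.

(** F_2 = 1, so this is the equation of [luc_eq] with e = n1 + 2 = 6. *)
Lemma exempt_4 n1 m1 b : (2 <= n1)%nat -> (1 <= b)%nat ->
  fib (n1 + 4) - fib n1 = 3 ^ Z.of_nat (m1 + b) - 3 ^ Z.of_nat m1 -> n1 = 4%nat.
Proof.
intros Hn1 Hb Heq; assert (Hd := fib_diff_even n1 2 ltac:(exists 1%nat; reflexivity)).
simpl (2 * 2)%nat in Hd; rewrite Heq in Hd; change (fib 2) with 1 in Hd.
rewrite Nat2Z.inj_add, Z.pow_add_r in Hd by lia.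
assert (H := luc_eq (n1 + 2) m1 b ltac:(lia) ltac:(lia) ltac:(lia)); lia.
Qed.

(** F_4 = 3 takes one factor from 3^m1 and [luc_eq] gives n1 + 4 = 6; for m1 = 0 the two sides
    differ modulo 3. *)
Lemma exempt_8 n1 m1 b : (2 <= n1)%nat -> (1 <= b)%nat ->
  fib (n1 + 8) - fib n1 = 3 ^ Z.of_nat (m1 + b) - 3 ^ Z.of_nat m1 -> n1 = 2%nat.
Proof.
intros Hn1 Hb Heq; assert (Hd := fib_diff_even n1 4 ltac:(exists 2%nat; reflexivity)).
simpl (2 * 4)%nat in Hd; rewrite Heq in Hd; change (fib 4) with 3 in Hd.
rewrite Nat2Z.inj_add, Z.pow_add_r in Hd by lia.
destruct m1 as [|u].
- replace b with (1 + (b - 1))%nat in Hd by lia.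
  rewrite Nat2Z.inj_add, Z.pow_add_r in Hd by lia; change (3 ^ Z.of_nat 1) with 3 in Hd.
  change (3 ^ Z.of_nat 0) with 1 in Hd; lia.
- rewrite Nat2Z.inj_succ, Z.pow_succ_r in Hd by lia.
  assert (H := luc_eq (n1 + 4) u b ltac:(lia) ltac:(lia) ltac:(lia)); lia.
Qed.

Lemma n_lt_58 n1 a m1 b : (2 <= n1)%nat -> (1 <= a)%nat -> (1 <= b)%nat ->
  fib (n1 + a) - fib n1 = 3 ^ Z.of_nat (m1 + b) - 3 ^ Z.of_nat m1 -> (n1 + a < 58)%nat.
Proof.
intros Hn1 Ha Hb Heq; destruct (exempt a b) eqn:Hex; [|apply (small_bound n1 a m1 b); assumption].
unfold exempt in Hex; rewrite !orb_true_iff, andb_true_iff, !Nat.eqb_eq in Hex.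
destruct Hex as [[->| ->]|[-> ->]].
- rewrite (exempt_4 n1 m1 b); auto; lia.
- rewrite (exempt_8 n1 m1 b); auto; lia.
- exfalso; exact (exempt_12_2 n1 m1 Hn1 Heq).
Qed.

(** Each entry is ((n1, n), (m1, m)) with n1 < n, so the two representations are (n1, m1) and (n,
    m). *)
Definition solutions : list (nat * nat * (nat * nat)) :=
  [((2, 10), (3, 4)); ((4, 8), (2, 3)); ((3, 6), (1, 2)); ((2, 4), (0, 1));
   ((4, 5), (0, 1)); ((5, 7), (0, 2)); ((6, 9), (0, 3)); ((7, 8), (0, 2))]%nat.

Definition is_solution (u v : nat * nat) : bool :=
  existsb (fun w => (fst u =? fst (fst w)) && (snd u =? snd (fst w)) &&
    ((fst v =? fst (snd w)) && (snd v =? snd (snd w))))%nat solutions.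

Lemma is_solution_In u v : is_solution u v = true -> In (u, v) solutions.
Proof.
unfold is_solution; rewrite existsb_exists; intros (w & Hw & H).
rewrite !andb_true_iff, !Nat.eqb_eq in H.
destruct u, v, w as [[] []]; cbn [fst snd] in H.
destruct H as [[-> ->] [-> ->]]; exact Hw.
Qed.

Definition pow_diffs : list (nat * nat * Z) :=
  flat_map (fun m => map (fun m1 => ((m1, m), 3 ^ Z.of_nat m - 3 ^ Z.of_nat m1)) (seq 0 m)) (seq 0 26).

Definition fib_table : list (nat * Z) :=
  let l := fib_list 58 0 1 in map (fun n => (n, nth n l 0)) (seq 2 56).

Lemma search_ok :
  forallb (fun u => forallb (fun v => if (fst v <=? fst u)%nat then true else
    forallb (fun t => if snd v - snd u =? snd t then is_solution (fst u, fst v) (fst t) else true)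
      pow_diffs) fib_table) fib_table = true.
Proof. vm_compute; reflexivity. Qed.

Lemma In_fib_table k : (2 <= k < 58)%nat -> In (k, fib k) fib_table.
Proof.
intros Hk; apply in_map_iff; exists k; split; [|apply in_seq; lia].
f_equal; apply (nth_fib_list 58 0 k); lia.
Qed.

Lemma fib_57 : fib 57 = 365435296162.
Proof. rewrite <- hd_ftab; vm_compute; reflexivity. Qed.

Lemma collisions n1 m1 n m : (2 <= n1)%nat -> (n1 < n)%nat ->
  fib n1 - 3 ^ Z.of_nat m1 = fib n - 3 ^ Z.of_nat m -> In ((n1, n), (m1, m)) solutions.
Proof.
intros Hn1 Hn Heq.
assert (Hlt := fib_lt n1 n Hn1 Hn).
assert (Hm : (m1 < m)%nat).
{ apply Nat2Z.inj_lt, (Z.pow_lt_mono_r_iff 3); lia. }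
assert (Hb : (n < 58)%nat).
{ replace n with (n1 + (n - n1))%nat by lia.
  apply (n_lt_58 n1 (n - n1) m1 (m - m1)); try lia.
  replace (n1 + (n - n1))%nat with n by lia; replace (m1 + (m - m1))%nat with m by lia; lia. }
(* From 26 on the difference of the powers is at least 2 * 3^25, which exceeds F_57. *)
assert (Hm26 : (m < 26)%nat).
{ apply Nat.nle_gt; intros H26.
  assert (H1 : 3 ^ Z.of_nat m1 * 3 <= 3 ^ Z.of_nat m).
  { rewrite Z.mul_comm, <- Z.pow_succ_r by lia; apply Z.pow_le_mono_r; lia. }
  assert (H2 : 3 ^ 26 <= 3 ^ Z.of_nat m) by (apply Z.pow_le_mono_r; lia).
  assert (H3 := fib_le n 57 ltac:(lia)).
  rewrite fib_57 in H3; generalize (fib_nonneg n1); lia. }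
assert (Hs := search_ok).
rewrite forallb_forall in Hs; specialize (Hs _ (In_fib_table n1 ltac:(lia))).
rewrite forallb_forall in Hs; specialize (Hs _ (In_fib_table n ltac:(lia))); cbn [fst snd] in Hs.
destruct (Nat.leb_spec n n1); [lia|].
rewrite forallb_forall in Hs.
specialize (Hs ((m1, m), 3 ^ Z.of_nat m - 3 ^ Z.of_nat m1)); cbn [fst snd] in Hs.
destruct (Z.eqb_spec (fib n - fib n1) (3 ^ Z.of_nat m - 3 ^ Z.of_nat m1)); [|lia].
apply is_solution_In, Hs; unfold pow_diffs; apply in_flat_map; exists m; split; [apply in_seq; lia|].
apply in_map_iff; exists m1; split; [reflexivity|apply in_seq; lia].
Qed.

Lemma distinct_reps c n1 m1 n2 m2 : is_rep c n1 m1 -> is_rep c n2 m2 ->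
  (n1, m1) = (n2, m2) \/ In ((n1, n2), (m1, m2)) solutions \/ In ((n2, n1), (m2, m1)) solutions.
Proof.
intros [Hn1 H1] [Hn2 H2]; destruct (lt_eq_lt_dec n1 n2) as [[Hlt|Heq]|Hlt].
- right; left; apply collisions; auto; lia.
- left; subst n2; f_equal; apply Nat2Z.inj, (Z.pow_inj_r 3); lia.
- right; right; apply collisions; auto; lia.
Qed.

Theorem theorem1 :
  (forall c : Z,
     (exists n1 m1 n2 m2 : nat,
        (n1, m1) <> (n2, m2) /\ is_rep c n1 m1 /\ is_rep c n2 m2)
     <-> (c = -26 \/ c = -6 \/ c = -1 \/ c = 0 \/ c = 2 \/ c = 4 \/ c = 7 \/ c = 12))
  /\
  (forall (c : Z) (n m : nat),
     (c = -26 \/ c = -6 \/ c = -1 \/ c = 0 \/ c = 2 \/ c = 4 \/ c = 7 \/ c = 12) ->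
     (is_rep c n m <->
        (c = -26 /\ ((n, m) = (10%nat, 4%nat) \/ (n, m) = (2%nat, 3%nat))) \/
        (c = -6  /\ ((n, m) = (8%nat, 3%nat)  \/ (n, m) = (4%nat, 2%nat))) \/
        (c = -1  /\ ((n, m) = (6%nat, 2%nat)  \/ (n, m) = (3%nat, 1%nat))) \/
        (c = 0   /\ ((n, m) = (4%nat, 1%nat)  \/ (n, m) = (2%nat, 0%nat))) \/
        (c = 2   /\ ((n, m) = (5%nat, 1%nat)  \/ (n, m) = (4%nat, 0%nat))) \/
        (c = 4   /\ ((n, m) = (7%nat, 2%nat)  \/ (n, m) = (5%nat, 0%nat))) \/
        (c = 7   /\ ((n, m) = (9%nat, 3%nat)  \/ (n, m) = (6%nat, 0%nat))) \/
        (c = 12  /\ ((n, m) = (8%nat, 2%nat)  \/ (n, m) = (7%nat, 0%nat))))).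
Proof.
assert (Hrep : forall k j, (2 <= k)%nat -> is_rep (fib k - 3 ^ Z.of_nat j) k j) by (split; auto).
split.
- intros c; split.
  + intros (n1 & m1 & n2 & m2 & Hne & H1 & H2).
    destruct (distinct_reps c n1 m1 n2 m2 H1 H2) as [H|[H|H]]; [contradiction| |];
    unfold solutions in H; cbn [In] in H;
    repeat destruct H as [H|H]; try contradiction; injection H as <- <- <- <-;
    destruct H1 as [_ H1]; vm_compute in H1; lia.
  + intros [->|[->|[->|[->|[->|[->|[->| ->]]]]]]].
    * exists 10%nat, 4%nat, 2%nat, 3%nat; split; [discriminate|split; apply Hrep; lia].
    * exists 8%nat, 3%nat, 4%nat, 2%nat; split; [discriminate|split; apply Hrep; lia].
    * exists 6%nat, 2%nat, 3%nat, 1%nat; split; [discriminate|split; apply Hrep; lia].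
    * exists 4%nat, 1%nat, 2%nat, 0%nat; split; [discriminate|split; apply Hrep; lia].
    * exists 5%nat, 1%nat, 4%nat, 0%nat; split; [discriminate|split; apply Hrep; lia].
    * exists 7%nat, 2%nat, 5%nat, 0%nat; split; [discriminate|split; apply Hrep; lia].
    * exists 9%nat, 3%nat, 6%nat, 0%nat; split; [discriminate|split; apply Hrep; lia].
    * exists 8%nat, 2%nat, 7%nat, 0%nat; split; [discriminate|split; apply Hrep; lia].
- intros c n m Hc; split.
  + intros H.
    (* One known representation is fixed for each [c]; any other one must share an entry of
       [solutions] with it. *)
    assert (Hk : forall k j, (2 <= k)%nat -> fib k - 3 ^ Z.of_nat j = c ->
      (n, m) = (k, j) \/ In ((n, k), (m, j)) solutions \/ In ((k, n), (j, m)) solutions).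
    { intros k j Hk Hkj; apply (distinct_reps c); [exact H|split; assumption]. }
    unfold solutions in Hk; cbn [In] in Hk.
    destruct Hc as [->|[->|[->|[->|[->|[->|[->| ->]]]]]]];
      [specialize (Hk 2%nat 3%nat)|specialize (Hk 4%nat 2%nat)|specialize (Hk 3%nat 1%nat)
      |specialize (Hk 2%nat 0%nat)|specialize (Hk 4%nat 0%nat)|specialize (Hk 5%nat 0%nat)
      |specialize (Hk 6%nat 0%nat)|specialize (Hk 7%nat 0%nat)];
      specialize (Hk ltac:(lia) eq_refl);
      repeat destruct Hk as [Hk|Hk]; try contradiction; try discriminate Hk;
      injection Hk as ->; subst; auto 20.
  + intros [[-> [E|E]]|[[-> [E|E]]|[[-> [E|E]]|[[-> [E|E]]|[[-> [E|E]]|[[-> [E|E]]|[[-> [E|E]]|[-> [E|E]]]]]]]]];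
    injection E as -> ->; apply Hrep; lia.
Qed.
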